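(* (i) There is an absolute constant $C>0$ such that for every integer $N\geq 10$ there exist a uniformly convex sequence $\{a_n\}_{n=1}^N$ (with parameter $N$) and a sequence of complex numbers $\{b_n\}_{n=1}^N$ such that \[ \left\| \sup_{x\in [0,N]} \left|\sum_{n=1}^N b_n e \left(x\frac{n}{N} + ta_n \right) \right| \right\|_{L^4([0,N^2])} \geq C N^{\frac{5}{8}} \Big(\sum_{n=1}^N |b_n|^2\Big)^{1/2}, \] where the $L^4([0,N^2])$ norm is taken in the variable $t$. (ii) For every $\epsilon>0$ there exists $C_\epsilon>0$ such that for every integer $N\geq 1$, every uniformly convex sequence $\{a_n\}_{n=1}^N$ (with parameter $N$) and every sequence of complex numbers $\{b_n\}_{n=1}^N$, \[ \left\| \sup_{x\in [0,N]} \left|\sum_{n=1}^N b_n e \left(x\frac{n}{N} + ta_n \right) \right| \right\|_{L^4([0,N^2])} \leq C_\epsilon N^\epsilon N^{\frac{2}{3}} \Big(\sum_{n=1}^N |b_n|^2\Big)^{1/2}. \]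
   Context: $e(x):=e^{2\pi i x}$. A real sequence $\{a_n\}_{n=1}^N$ is called uniformly convex (with parameter $N$) if for all admissible $n$: $a_{n+1}-a_n\in[\frac{1}{4N},\frac{4}{N}]$ and $(a_{n+2}-a_{n+1})-(a_{n+1}-a_n)\in[\frac{1}{4N^2},\frac{4}{N^2}]$. *)

(* Defs.v *)
From Stdlib Require Import Reals List.
From Coquelicot Require Import Coquelicot.
Open Scope R_scope.

Definition e (x : R) : C := (cos (2 * PI * x), sin (2 * PI * x)).

Definition uniformly_convex (N : nat) (a : nat -> R) : Prop :=
  (forall n, (1 <= n)%nat -> (n + 1 <= N)%nat ->
     / (4 * INR N) <= a (S n) - a n <= 4 / INR N) /\
  (forall n, (1 <= n)%nat -> (n + 2 <= N)%nat ->
     / (4 * INR N ^ 2) <= (a (S (S n)) - a (S n)) - (a (S n) - a n) <= 4 / INR N ^ 2).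

Definition expsum (N : nat) (a : nat -> R) (b : nat -> C) (t x : R) : C :=
  fold_right Cplus (RtoC 0)
    (map (fun n => Cmult (b n) (e (x * INR n / INR N + t * a n))) (seq 1 N)).

Definition maxfun (N : nat) (a : nat -> R) (b : nat -> C) (t : R) : R :=
  real (Lub_Rbar (fun y => exists x, 0 <= x <= INR N /\ y = Cmod (expsum N a b t x))).

Definition L4norm (N : nat) (a : nat -> R) (b : nat -> C) : R :=
  sqrt (sqrt (RInt (fun t => (maxfun N a b t) ^ 4) 0 (INR N ^ 2))).

Definition l2norm (N : nat) (b : nat -> C) : R :=
  sqrt (fold_right Rplus 0 (map (fun n => Cmod (b n) ^ 2) (seq 1 N))).

(* Main.v *)
Require Import Defs.
From Stdlib Require Import Reals List Lra Lia Psatz ZArith Arith FinFun Classical.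
From Coquelicot Require Import Coquelicot.
Open Scope R_scope.

(* (ii) Put A_n = N^2 a_n, whose second differences lie in [1/4, 4]. The function
   F(x,t) = sum b_n e(x n/N + t a_n) satisfies the l^2 decoupling estimate
   |F|_6^6 <= K N^eps |b|_2^6 (mean values), whose proof is elementary here: after rounding
   16 A_n to integers alpha_n and merging the two frequencies into v_n = alpha_n + H n with H
   huge, everything lives on a finite cyclic group. Bilinear means of |F_I|^2 |F_J|^4 over
   separated intervals I, J are decoupled by orthogonality into pieces of I of length about
   |J|^2 / dist(I, J), Cauchy-Schwarz exchanges the roles of I and J, and after n exchanges a
   bound M^eta for the sixth moment improves to M^(eta - kappa eps). Since F^3 has degree 3N in
   x, Cauchy-Schwarz bounds sup_x |F|^6 by 3N times the L^2 mass of F^3 in x, and the integral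
   in t costs only a logarithm. Finally g^4 <= mu^4 + g^6 / mu^2 with mu^2 = N^(1/3) |b|_2^2.

   (i) Let a_n = 6 N^(-1/2) (m - sqrt (m^2 - n)) with m^2 between 2N and 3N, and let b be the
   indicator of the points n_k = 2 m k - k^2, k <= sqrt N / 4, so that t a_(n_k) is linear in k:
   the sum is sum_k e((2 m k - k^2) y + k s) with s proportional to t. If r/q is a Dirichlet
   approximation of s with q of order sqrt M (M the number of points), then for y = 1/q or
   1/(2q) this is essentially a sum of complete Gauss sums and has size M^(3/4). The t whose
   Dirichlet denominator is too small are removed by integrating a majorant of their set. *)

(** * Finite sums and exponentials *)

(** At a single scale the exchange gains nothing: decoupling an interval against one of length M/k
    at distance M/k gives back pieces of length M/k. So the second interval is first cut to length
    M/k^2, after which the lengths M/k^(2^i+1) fall doubly exponentially. Every exchange halves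
    exponents through its square root, and the doubling makes up for it: n exchanges gain k^(n
    eta/2). All other losses stay below a constant times k^9 for every n, so n of order 1/eta pays
    for them. The [a n] are real and the window [0, N^2] is too short for orthogonality in t, so
    approximate solutions of the equation in the [a n] must be counted as well. Absolute values can
    be taken there, because the sixth moment bound may be applied to |b_n|. In (i) both phases are
    polynomials in k at the chosen points, quadratic in x and linear in t, so a suitable x produces
    a Gauss sum whatever the linear term is. With M about sqrt N the sum has size M^(3/4) for at
    least half of the t: the L^4 norm is about N^(1/2) M^(3/4) against |b|_2 = M^(1/2), and the
    quotient N^(1/2) M^(1/4) is N^(5/8). *)

Definition rsum {A} (l : list A) (f : A -> R) : R := fold_right Rplus 0 (map f l).
Definition csum {A} (l : list A) (f : A -> C) : C := fold_right Cplus (RtoC 0) (map f l).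

Lemma rsum_cons {A} (x : A) l f : rsum (x :: l) f = f x + rsum l f.
Proof. reflexivity. Qed.

Lemma csum_cons {A} (x : A) l f : csum (x :: l) f = Cplus (f x) (csum l f).
Proof. reflexivity. Qed.

Lemma rsum_ext {A} (l : list A) f g : (forall x, In x l -> f x = g x) -> rsum l f = rsum l g.
Proof.
  induction l as [|x l IH]; intros H; [reflexivity|].
  rewrite !rsum_cons, IH, (H x); auto with datatypes.
Qed.

Lemma csum_ext {A} (l : list A) f g : (forall x, In x l -> f x = g x) -> csum l f = csum l g.
Proof.
  induction l as [|x l IH]; intros H; [reflexivity|].
  rewrite !csum_cons, IH, (H x); auto with datatypes.
Qed.

Lemma rsum_le {A} (l : list A) f g : (forall x, In x l -> f x <= g x) -> rsum l f <= rsum l g.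
Proof.
  induction l as [|x l IH]; intros H; [apply Rle_refl|].
  rewrite !rsum_cons. apply Rplus_le_compat; auto with datatypes.
Qed.

Lemma rsum_0 {A} (l : list A) f : (forall x, In x l -> f x = 0) -> rsum l f = 0.
Proof.
  induction l as [|x l IH]; intros H; [reflexivity|].
  rewrite rsum_cons, IH, (H x); auto with datatypes; lra.
Qed.

Lemma rsum_ge0 {A} (l : list A) f : (forall x, In x l -> 0 <= f x) -> 0 <= rsum l f.
Proof. intros H. rewrite <- (rsum_0 l (fun _ => 0)); auto. now apply rsum_le. Qed.

Lemma rsum_plus {A} (l : list A) f g : rsum l (fun x => f x + g x) = rsum l f + rsum l g.
Proof. induction l as [|x l IH]; [unfold rsum; simpl; lra|]. rewrite !rsum_cons, IH; lra. Qed.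

Lemma rsum_scal {A} (l : list A) c f : rsum l (fun x => c * f x) = c * rsum l f.
Proof. induction l as [|x l IH]; [unfold rsum; simpl; lra|]. rewrite !rsum_cons, IH; lra. Qed.

Lemma rsum_scal_r {A} (l : list A) c f : rsum l (fun x => f x * c) = rsum l f * c.
Proof. induction l as [|x l IH]; [unfold rsum; simpl; lra|]. rewrite !rsum_cons, IH; lra. Qed.

Lemma rsum_const {A} (l : list A) c : rsum l (fun _ => c) = INR (length l) * c.
Proof.
  induction l as [|x l IH]; [unfold rsum; simpl; lra|].
  rewrite rsum_cons, IH. simpl length. rewrite S_INR. lra.
Qed.

Lemma rsum_swap {A B} (l : list A) (m : list B) f :
  rsum l (fun x => rsum m (fun y => f x y)) = rsum m (fun y => rsum l (fun x => f x y)).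
Proof.
  induction l as [|x l IH].
  - symmetry. apply rsum_0. reflexivity.
  - rewrite rsum_cons, IH, <- rsum_plus. apply rsum_ext; intros; now rewrite rsum_cons.
Qed.

Lemma rsum_mult {A B} (l : list A) (m : list B) f g :
  rsum l f * rsum m g = rsum l (fun x => rsum m (fun y => f x * g y)).
Proof. rewrite <- rsum_scal_r. apply rsum_ext; intros. now rewrite rsum_scal. Qed.

Lemma rsum_app {A} (l m : list A) f : rsum (l ++ m) f = rsum l f + rsum m f.
Proof. induction l as [|x l IH]; [unfold rsum; simpl; lra|]. simpl app. rewrite !rsum_cons, IH; lra. Qed.

Lemma csum_app {A} (l m : list A) f : csum (l ++ m) f = Cplus (csum l f) (csum m f).
Proof.
  induction l as [|x l IH]; [unfold csum; simpl; ring|]. simpl app. rewrite !csum_cons, IH; ring.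
Qed.

Lemma rsum_map {A B} (h : A -> B) (l : list A) f : rsum (map h l) f = rsum l (fun x => f (h x)).
Proof. unfold rsum. now rewrite map_map. Qed.

Lemma csum_map {A B} (h : A -> B) (l : list A) f : csum (map h l) f = csum l (fun x => f (h x)).
Proof. unfold csum. now rewrite map_map. Qed.

Lemma rsum_term {A} (l : list A) f x : In x l -> (forall y, In y l -> 0 <= f y) -> f x <= rsum l f.
Proof.
  induction l as [|y l IH]; intros Hx Hf; [easy|].
  rewrite rsum_cons. destruct Hx as [<-|Hx].
  - assert (0 <= rsum l f) by (apply rsum_ge0; auto with datatypes). lra.
  - assert (0 <= f y) by auto with datatypes. assert (f x <= rsum l f) by auto with datatypes. lra.
Qed.

Lemma rsum_indic (l : list nat) n f : NoDup l -> In n l ->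
  rsum l (fun s => if Nat.eqb n s then f s else 0) = f n.
Proof.
  induction l as [|y l IH]; intros Hd Hn; [easy|].
  inversion Hd as [|? ? Hy Hd']; subst. rewrite rsum_cons. destruct Hn as [<-|Hn].
  - rewrite Nat.eqb_refl, rsum_0; [lra|]. intros x Hx.
    destruct (Nat.eqb_spec y x); [subst; easy|reflexivity].
  - rewrite (IH Hd' Hn). destruct (Nat.eqb_spec n y); [subst; easy|lra].
Qed.

Lemma cauchy_schwarz {A} (l : list A) f g :
  (rsum l (fun x => f x * g x)) ^ 2 <= rsum l (fun x => f x ^ 2) * rsum l (fun x => g x ^ 2).
Proof.
  set (a := rsum l (fun x => f x ^ 2)). set (c := rsum l (fun x => g x ^ 2)).
  set (b := rsum l (fun x => f x * g x)).
  assert (Ha : 0 <= a) by (apply rsum_ge0; intros; apply pow2_ge_0).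
  assert (Hc : 0 <= c) by (apply rsum_ge0; intros; apply pow2_ge_0).
  assert (H : forall s t, 0 <= s ^ 2 * a + 2 * s * t * b + t ^ 2 * c).
  { intros s t. replace (s ^ 2 * a + 2 * s * t * b + t ^ 2 * c)
      with (rsum l (fun x => (s * f x + t * g x) ^ 2)).
    - apply rsum_ge0; intros; apply pow2_ge_0.
    - unfold a, b, c. rewrite <- !rsum_scal, <- !rsum_plus. apply rsum_ext; intros; ring. }
  destruct (Req_dec a 0) as [E|E].
  - destruct (Req_dec b 0) as [E'|E']; [rewrite E'; nra|].
    specialize (H (- (c + 1) / (2 * b)) 1). rewrite E in H.
    replace ((- (c + 1) / (2 * b)) ^ 2 * 0 + 2 * (- (c + 1) / (2 * b)) * 1 * b + 1 ^ 2 * c)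
      with (-1) in H by (field; auto). lra.
  - specialize (H (- b) a). assert (0 < a) by lra. nra.
Qed.

Lemma rsum_sq_le {A} (l : list A) f : (rsum l f) ^ 2 <= INR (length l) * rsum l (fun x => f x ^ 2).
Proof.
  replace (rsum l f) with (rsum l (fun x => 1 * f x)) by (apply rsum_ext; intros; ring).
  eapply Rle_trans; [apply cauchy_schwarz|]. cbv beta. rewrite rsum_const. lra.
Qed.

Lemma csum_mod {A} (l : list A) f : Cmod (csum l f) <= rsum l (fun x => Cmod (f x)).
Proof.
  induction l as [|x l IH]; [unfold csum, rsum; simpl; rewrite Cmod_0; lra|].
  rewrite csum_cons, rsum_cons. eapply Rle_trans; [apply Cmod_triangle|]. lra.
Qed.

Lemma csum_plus {A} (l : list A) f g : csum l (fun x => Cplus (f x) (g x)) = Cplus (csum l f) (csum l g).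
Proof. induction l as [|x l IH]; [unfold csum; simpl; ring|]. rewrite !csum_cons, IH; ring. Qed.

Lemma csum_scal {A} (l : list A) c f : csum l (fun x => Cmult c (f x)) = Cmult c (csum l f).
Proof. induction l as [|x l IH]; [unfold csum; simpl; ring|]. rewrite !csum_cons, IH; ring. Qed.

Lemma csum_scal_r {A} (l : list A) c f : csum l (fun x => Cmult (f x) c) = Cmult (csum l f) c.
Proof. induction l as [|x l IH]; [unfold csum; simpl; ring|]. rewrite !csum_cons, IH; ring. Qed.

Lemma csum_0 {A} (l : list A) f : (forall x, In x l -> f x = RtoC 0) -> csum l f = RtoC 0.
Proof.
  induction l as [|x l IH]; intros H; [reflexivity|].
  rewrite csum_cons, IH, (H x); auto with datatypes; ring.
Qed.

Lemma csum_swap {A B} (l : list A) (m : list B) f :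
  csum l (fun x => csum m (fun y => f x y)) = csum m (fun y => csum l (fun x => f x y)).
Proof.
  induction l as [|x l IH].
  - symmetry. apply csum_0. reflexivity.
  - rewrite csum_cons, IH, <- csum_plus. apply csum_ext; intros; now rewrite csum_cons.
Qed.

Lemma csum_indic (l : list nat) n f : NoDup l -> In n l ->
  csum l (fun s => if Nat.eqb n s then f s else RtoC 0) = f n.
Proof.
  induction l as [|y l IH]; intros Hd Hn; [easy|].
  inversion Hd as [|? ? Hy Hd']; subst. rewrite csum_cons. destruct Hn as [<-|Hn].
  - rewrite Nat.eqb_refl, csum_0; [ring|]. intros x Hx.
    destruct (Nat.eqb_spec y x); [subst; easy|reflexivity].
  - rewrite (IH Hd' Hn). destruct (Nat.eqb_spec n y); [subst; easy|ring].
Qed.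

Lemma csum_list_prod {A B} (l : list A) (m : list B) f g :
  csum (list_prod l m) (fun p => Cmult (f (fst p)) (g (snd p))) = Cmult (csum l f) (csum m g).
Proof.
  induction l as [|x l IH]; [unfold csum; simpl; ring|].
  simpl list_prod. rewrite csum_app, csum_map, IH, csum_cons. simpl.
  rewrite csum_scal. ring.
Qed.

Lemma Re_csum {A} (l : list A) f : Re (csum l f) = rsum l (fun x => Re (f x)).
Proof. induction l as [|x l IH]; [reflexivity|]. rewrite csum_cons, rsum_cons, <- IH. reflexivity. Qed.

Lemma Im_csum {A} (l : list A) f : Im (csum l f) = rsum l (fun x => Im (f x)).
Proof. induction l as [|x l IH]; [reflexivity|]. rewrite csum_cons, rsum_cons, <- IH. reflexivity. Qed.

Lemma Cmod_sq (z : C) : Cmod z ^ 2 = Re z ^ 2 + Im z ^ 2.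
Proof. unfold Cmod. rewrite pow2_sqrt; [reflexivity|]. apply Rplus_le_le_0_compat; apply pow2_ge_0. Qed.

Lemma Re_mult_conj_le (z w : C) : Re z * Re w + Im z * Im w <= (Cmod z ^ 2 + Cmod w ^ 2) / 2.
Proof. rewrite !Cmod_sq. pose proof (pow2_ge_0 (Re z - Re w)). pose proof (pow2_ge_0 (Im z - Im w)). nra. Qed.

Lemma e_plus x y : e (x + y) = Cmult (e x) (e y).
Proof.
  unfold e, Cmult; simpl. replace (2 * PI * (x + y)) with (2 * PI * x + 2 * PI * y) by ring.
  rewrite cos_plus, sin_plus. f_equal; ring.
Qed.

Lemma Cmod_e x : Cmod (e x) = 1.
Proof.
  unfold Cmod, e; simpl. rewrite !Rmult_1_r. rewrite Rplus_comm.
  change (sqrt (Rsqr (sin (2 * PI * x)) + Rsqr (cos (2 * PI * x))) = 1).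
  rewrite sin2_cos2. apply sqrt_1.
Qed.

Lemma e_0 : e 0 = RtoC 1.
Proof. unfold e. rewrite Rmult_0_r, cos_0, sin_0. reflexivity. Qed.

Lemma e_nat (n : nat) : e (INR n) = RtoC 1.
Proof.
  unfold e. replace (2 * PI * INR n) with (0 + 2 * INR n * PI) by ring.
  rewrite cos_period, sin_period, cos_0, sin_0. reflexivity.
Qed.

Lemma e_opp_nat (n : nat) : e (- INR n) = RtoC 1.
Proof.
  pose proof (e_nat n) as H. unfold e in *.
  replace (2 * PI * - INR n) with (- (2 * PI * INR n)) by ring.
  rewrite cos_neg, sin_neg. inversion H as [[H1 H2]]. rewrite H1, H2. unfold RtoC. f_equal. ring.
Qed.

Lemma e_Z (z : Z) : e (IZR z) = RtoC 1.
Proof.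
  destruct (Z_le_gt_dec 0 z).
  - rewrite <- (Z2Nat.id z) by lia. rewrite <- INR_IZR_INZ. apply e_nat.
  - replace z with (- Z.of_nat (Z.to_nat (- z)))%Z by lia.
    rewrite opp_IZR, <- INR_IZR_INZ. apply e_opp_nat.
Qed.

Lemma e_mult_nat x (n : nat) : e (x * INR n) = Cpow (e x) n.
Proof.
  induction n as [|n IH]; [simpl; rewrite Rmult_0_r; apply e_0|].
  rewrite S_INR, Rmult_plus_distr_l, Rmult_1_r, e_plus, IH. simpl. ring.
Qed.

Lemma e_neq_1 x : -1 < x < 1 -> x <> 0 -> e x <> RtoC 1.
Proof.
  intros Hx Hx0 H. unfold e in H. inversion H as [[H1 H2]].
  replace (2 * PI * x) with (2 * (PI * x)) in H1 by ring. rewrite cos_2a_sin in H1.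
  assert (sin (PI * x) <> 0); [|nra]. pose proof PI_RGT_0.
  destruct (Rlt_dec 0 x).
  - apply Rgt_not_eq, sin_gt_0; nra.
  - assert (0 < sin (- (PI * x))) by (apply sin_gt_0; nra). rewrite sin_neg in H3. lra.
Qed.

Lemma geometric_csum z n : Cmult (Cminus z (RtoC 1)) (csum (seq 0 n) (fun j => Cpow z j)) = Cminus (Cpow z n) (RtoC 1).
Proof.
  induction n as [|n IH]; [unfold csum; simpl; ring|].
  rewrite seq_S, csum_app. unfold csum at 2. simpl map; simpl fold_right.
  replace (Cmult (Cminus z (RtoC 1)) (Cplus (csum (seq 0 n) (fun j => Cpow z j)) (Cplus (Cpow z n) (RtoC 0))))
    with (Cplus (Cmult (Cminus z (RtoC 1)) (csum (seq 0 n) (fun j => Cpow z j))) (Cmult (Cminus z (RtoC 1)) (Cpow z n))) by ring.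
  rewrite IH. simpl. ring.
Qed.

Lemma csum_e_eq0 (v : Z) (Q : nat) : v <> 0%Z -> (Z.abs v < Z.of_nat Q)%Z ->
  csum (seq 0 Q) (fun j => e (IZR v * (INR j / INR Q))) = RtoC 0.
Proof.
  intros Hv HQ.
  assert (HQ0 : 0 < INR Q) by (apply lt_0_INR; lia).
  rewrite (csum_ext _ _ (fun j => Cpow (e (IZR v / INR Q)) j)).
  2:{ intros j _. rewrite <- e_mult_nat. f_equal. field. lra. }
  set (z := e (IZR v / INR Q)).
  assert (Hz : z <> RtoC 1).
  { apply e_neq_1.
    - rewrite INR_IZR_INZ in *. assert (IZR (Z.abs v) < IZR (Z.of_nat Q)) by now apply IZR_lt.
      rewrite abs_IZR in H. apply Rabs_def2 in H.
      split; [apply Rmult_lt_reg_r with (IZR (Z.of_nat Q)) | apply Rmult_lt_reg_r with (IZR (Z.of_nat Q))]; auto;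
      unfold Rdiv; rewrite Rmult_assoc, Rinv_l; lra.
    - assert (IZR v <> 0) by now apply not_0_IZR. unfold Rdiv. apply Rmult_integral_contrapositive; split; auto.
      apply Rinv_neq_0_compat; lra. }
  pose proof (geometric_csum z Q) as H.
  assert (HzQ : Cpow z Q = RtoC 1).
  { unfold z. rewrite <- e_mult_nat. replace (IZR v / INR Q * INR Q) with (IZR v) by (field; lra). apply e_Z. }
  rewrite HzQ in H. replace (Cminus (RtoC 1) (RtoC 1)) with (RtoC 0) in H by ring.
  destruct (Ceq_dec (csum (seq 0 Q) (fun j => Cpow z j)) (RtoC 0)) as [E|E]; auto.
  exfalso. revert H. apply Cmult_neq_0; [|exact E].
  intros E'. apply Hz. replace z with (Cplus (Cminus z (RtoC 1)) (RtoC 1)) by ring. rewrite E'. ring.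
Qed.

(** * Mean values over a cyclic group *)

Definition dot (z w : C) : R := Re z * Re w + Im z * Im w.

Definition trigpoly {A} (l : list A) (c : A -> R) (v : A -> Z) (x : R) : C :=
  csum l (fun a => Cmult (RtoC (c a)) (e (IZR (v a) * x))).

(* Replaces the integral over a period: exact for frequencies smaller than [Q], and linear with no integrability side conditions. *)
Definition avg (Q : nat) (g : R -> R) : R :=
  / INR Q * rsum (seq 0 Q) (fun j => g (INR j / INR Q)).

Lemma dot_csum {A B} (l : list A) (m : list B) f g :
  dot (csum l f) (csum m g) = rsum l (fun x => rsum m (fun y => dot (f x) (g y))).
Proof.
  unfold dot. rewrite !Re_csum, !Im_csum, !rsum_mult, <- rsum_plus.
  apply rsum_ext; intros. now rewrite <- rsum_plus.
Qed.

Lemma dot_self z : dot z z = Cmod z ^ 2.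
Proof. rewrite Cmod_sq. unfold dot. ring. Qed.

Lemma dot_scal_e (c c' x y : R) :
  dot (Cmult (RtoC c) (e x)) (Cmult (RtoC c') (e y)) = c * c' * Re (e (x - y)).
Proof.
  unfold dot, e, Re, Im, Cmult, RtoC; simpl.
  replace (2 * PI * (x - y)) with (2 * PI * x - 2 * PI * y) by ring. rewrite cos_minus. ring.
Qed.

Lemma dot_mult_r z z' w : dot (Cmult z w) (Cmult z' w) = dot z z' * Cmod w ^ 2.
Proof. rewrite Cmod_sq. unfold dot, Re, Im, Cmult; simpl. ring. Qed.

Lemma Re_csum_e (v : Z) (Q : nat) : (0 < Q)%nat -> (Z.abs v < Z.of_nat Q)%Z ->
  rsum (seq 0 Q) (fun j => Re (e (IZR v * (INR j / INR Q)))) = if Z.eqb v 0 then INR Q else 0.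
Proof.
  intros HQ Hv. destruct (Z.eqb_spec v 0) as [->|H].
  - rewrite (rsum_ext _ _ (fun _ => 1)); [rewrite rsum_const, length_seq; ring|].
    intros. rewrite Rmult_0_l, e_0. reflexivity.
  - rewrite <- Re_csum, csum_e_eq0; auto.
Qed.

Lemma avg_ext Q f g : (forall x, f x = g x) -> avg Q f = avg Q g.
Proof. intros H. unfold avg. f_equal. apply rsum_ext; auto. Qed.

Lemma avg_le Q f g : (forall x, f x <= g x) -> avg Q f <= avg Q g.
Proof.
  intros H. unfold avg. apply Rmult_le_compat_l.
  - destruct Q; [simpl; rewrite Rinv_0; lra|]. apply Rlt_le, Rinv_0_lt_compat, lt_0_INR; lia.
  - apply rsum_le; auto.
Qed.

Lemma avg_ge0 Q f : (forall x, 0 <= f x) -> 0 <= avg Q f.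
Proof.
  intros H. replace 0 with (avg Q (fun _ => 0)); [now apply avg_le|].
  unfold avg. rewrite rsum_0; [ring|auto].
Qed.

Lemma avg_plus Q f g : avg Q (fun x => f x + g x) = avg Q f + avg Q g.
Proof. unfold avg. rewrite rsum_plus. ring. Qed.

Lemma avg_scal Q c f : avg Q (fun x => c * f x) = c * avg Q f.
Proof. unfold avg. rewrite rsum_scal. ring. Qed.

Lemma avg_rsum {A} Q (l : list A) f : avg Q (fun x => rsum l (fun a => f a x)) = rsum l (fun a => avg Q (f a)).
Proof. unfold avg. now rewrite rsum_scal, rsum_swap. Qed.

Lemma avg_const Q c : (0 < Q)%nat -> avg Q (fun _ => c) = c.
Proof.
  intros H. unfold avg. rewrite rsum_const, length_seq. field. apply not_0_INR; lia.
Qed.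

Lemma avg_cauchy_schwarz Q f g :
  (avg Q (fun x => f x * g x)) ^ 2 <= avg Q (fun x => f x ^ 2) * avg Q (fun x => g x ^ 2).
Proof.
  unfold avg. rewrite Rpow_mult_distr.
  replace (/ INR Q * rsum (seq 0 Q) (fun j : nat => f (INR j / INR Q) ^ 2) * (/ INR Q * rsum (seq 0 Q) (fun j : nat => g (INR j / INR Q) ^ 2)))
   with ((/ INR Q) ^ 2 * (rsum (seq 0 Q) (fun j : nat => f (INR j / INR Q) ^ 2) * rsum (seq 0 Q) (fun j : nat => g (INR j / INR Q) ^ 2))) by ring.
  apply Rmult_le_compat_l; [apply pow2_ge_0|].
  apply (cauchy_schwarz (seq 0 Q) (fun j => f (INR j / INR Q)) (fun j => g (INR j / INR Q))).
Qed.

(** Two distinct frequencies differ by a nonzero integer below [Q] in absolute value, so their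
    product averages to 0 over the multiples of 1/[Q]. The frequencies of the two sums may differ: a
    sum will also be paired with a shifted copy of itself. *)
Lemma parseval {A B} (l : list A) (m : list B) c c' v v' Q : (0 < Q)%nat ->
  (forall a b, In a l -> In b m -> (Z.abs (v a - v' b) < Z.of_nat Q)%Z) ->
  avg Q (fun x => dot (trigpoly l c v x) (trigpoly m c' v' x)) =
  rsum l (fun a => rsum m (fun b => if Z.eqb (v a) (v' b) then c a * c' b else 0)).
Proof.
  intros HQ HV.
  rewrite (avg_ext _ _ (fun x => rsum l (fun a => rsum m (fun b =>
      c a * c' b * Re (e (IZR (v a - v' b) * x)))))).
  2:{ intros x. unfold trigpoly. rewrite dot_csum. apply rsum_ext; intros a _. apply rsum_ext; intros b _.
      rewrite dot_scal_e, minus_IZR. do 3 f_equal. ring. }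
  rewrite avg_rsum. apply rsum_ext; intros a Ha. rewrite avg_rsum. apply rsum_ext; intros b Hb.
  rewrite avg_scal. unfold avg. rewrite Re_csum_e; auto.
  assert (INR Q <> 0) by (apply not_0_INR; lia).
  destruct (Z.eqb_spec (v a) (v' b)) as [E|E]; destruct (Z.eqb_spec (v a - v' b) 0); try lia; [field; auto | ring].
Qed.

Lemma trigpoly_mult {A B} (l : list A) (m : list B) c c' v v' x :
  Cmult (trigpoly l c v x) (trigpoly m c' v' x) =
  trigpoly (list_prod l m) (fun p => c (fst p) * c' (snd p)) (fun p => (v (fst p) + v' (snd p))%Z) x.
Proof.
  unfold trigpoly. rewrite <- csum_list_prod. apply csum_ext; intros [a b] _; simpl.
  rewrite plus_IZR, Rmult_plus_distr_r, e_plus, RtoC_mult. ring.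
Qed.

(** * Integer sequences with second differences between 1 and [Cc] *)

Section Convex.
Variables (alpha : nat -> Z) (Cc : Z).
Hypothesis Hconv : forall n, (1 <= alpha (S (S n)) - 2 * alpha (S n) + alpha n <= Cc)%Z.
Let delta n := (alpha (S n) - alpha n)%Z.
Local Open Scope Z_scope.

Lemma slope_mono (m k : nat) : delta m + Z.of_nat k <= delta (k + m)%nat <= delta m + Cc * Z.of_nat k.
Proof.
  induction k as [|k IH]; [simpl; lia|].
  pose proof (Hconv (k + m)). unfold delta in *. simpl Nat.add. rewrite Nat2Z.inj_succ. lia.
Qed.

Lemma increment_le (m k : nat) s : (forall i, (m <= i < k + m)%nat -> delta i <= s) ->
  alpha (k + m)%nat - alpha m <= s * Z.of_nat k.
Proof.
  induction k as [|k IH]; intros H; [simpl; lia|].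
  assert (delta (k + m)%nat <= s) by (apply H; lia).
  assert (alpha (k + m)%nat - alpha m <= s * Z.of_nat k) by (apply IH; intros; apply H; lia).
  unfold delta in *. simpl Nat.add. rewrite Nat2Z.inj_succ. lia.
Qed.

Lemma increment_ge (m k : nat) s : (forall i, (m <= i < k + m)%nat -> s <= delta i) ->
  s * Z.of_nat k <= alpha (k + m)%nat - alpha m.
Proof.
  induction k as [|k IH]; intros H; [simpl; lia|].
  assert (s <= delta (k + m)%nat) by (apply H; lia).
  assert (s * Z.of_nat k <= alpha (k + m)%nat - alpha m) by (apply IH; intros; apply H; lia).
  unfold delta in *. simpl Nat.add. rewrite Nat2Z.inj_succ. lia.
Qed.

(** All increments between [c] and [n] differ from the slope at [c] by at most [Cc * L], and there
    are at most [L] of them; convexity gives the sign. *)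
Lemma tangent_deviation (c n : nat) L : (Z.abs (Z.of_nat n - Z.of_nat c) <= L) ->
  0 <= alpha n - alpha c - delta c * (Z.of_nat n - Z.of_nat c) <= Cc * L * L.
Proof.
  intros HL. pose proof (Hconv 0).
  destruct (le_lt_dec c n) as [H1|H1].
  - replace n with ((n - c) + c)%nat by lia. set (k := (n - c)%nat).
    assert (Hk : Z.of_nat k <= L) by lia.
    assert (A1 : delta c * Z.of_nat k <= alpha (k + c)%nat - alpha c).
    { apply increment_ge. intros i Hi. pose proof (slope_mono c (i - c)).
      replace (i - c + c)%nat with i in * by lia. lia. }
    assert (A2 : alpha (k + c)%nat - alpha c <= (delta c + Cc * L) * Z.of_nat k).
    { apply increment_le. intros i Hi. pose proof (slope_mono c (i - c)).
      replace (i - c + c)%nat with i in * by lia. nia. }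
    assert (Cc * L * Z.of_nat k <= Cc * L * L) by (apply Z.mul_le_mono_nonneg_l; nia).
    replace (Z.of_nat (k + c) - Z.of_nat c) with (Z.of_nat k) by lia. nia.
  - set (k := (c - n)%nat). assert (Hk : Z.of_nat k <= L) by lia.
    assert (A1 : (delta c - Cc * L) * Z.of_nat k <= alpha (k + n)%nat - alpha n).
    { apply increment_ge. intros i Hi. pose proof (slope_mono i (c - i)).
      replace (c - i + i)%nat with c in * by lia. nia. }
    assert (A2 : alpha (k + n)%nat - alpha n <= delta c * Z.of_nat k).
    { apply increment_le. intros i Hi. pose proof (slope_mono i (c - i)).
      replace (c - i + i)%nat with c in * by lia. lia. }
    replace (k + n)%nat with c in * by lia.
    assert (Cc * L * Z.of_nat k <= Cc * L * L) by (apply Z.mul_le_mono_nonneg_l; nia).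
    replace (Z.of_nat n - Z.of_nat c) with (- Z.of_nat k) by lia. nia.
Qed.

(* The slopes on the two clusters differ by at least [D], so the linear parts of both equations determine [n - m] up to the quadratic error of the cluster of the [p]'s. *)
Lemma transversality (n m p1 p2 p3 p4 : nat) (L D : Z) :
  (m < n)%nat ->
  (forall p, In p (p2 :: p3 :: p4 :: nil) -> Z.abs (Z.of_nat p - Z.of_nat p1) <= L) ->
  (Z.of_nat p1 + D <= Z.of_nat m \/ Z.of_nat n + D <= Z.of_nat p1) -> 0 <= D ->
  (n + p1 + p2 = m + p3 + p4)%nat ->
  alpha n + alpha p1 + alpha p2 = alpha m + alpha p3 + alpha p4 ->
  (Z.of_nat n - Z.of_nat m) * D <= 2 * Cc * L * L.
Proof.
  intros Hmn HL Hsep HD E1 E2.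
  assert (T2 := tangent_deviation p1 p2 L (HL p2 ltac:(simpl; auto))).
  assert (T3 := tangent_deviation p1 p3 L (HL p3 ltac:(simpl; auto))).
  assert (T4 := tangent_deviation p1 p4 L (HL p4 ltac:(simpl; auto))).
  set (k := (n - m)%nat). replace (Z.of_nat n - Z.of_nat m) with (Z.of_nat k) by lia.
  assert (Ek : n = (k + m)%nat) by lia.
  set (s := delta p1) in *.
  assert (Es : s * (Z.of_nat p3 - Z.of_nat p1) + s * (Z.of_nat p4 - Z.of_nat p1) - s * (Z.of_nat p2 - Z.of_nat p1) = s * Z.of_nat k).
  { rewrite <- Z.mul_add_distr_l, <- Z.mul_sub_distr_l. f_equal. lia. }
  destruct Hsep as [Hs|Hs].
  - assert ((s + D) * Z.of_nat k <= alpha (k + m)%nat - alpha m).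
    { apply increment_ge. intros i Hi. pose proof (slope_mono p1 (i - p1)).
      replace (i - p1 + p1)%nat with i in * by lia. fold s in H. lia. }
    rewrite <- Ek in H. nia.
  - assert (alpha (k + m)%nat - alpha m <= (s - D) * Z.of_nat k).
    { apply increment_le. intros i Hi. pose proof (slope_mono i (p1 - i)).
      replace (p1 - i + i)%nat with p1 in * by lia. fold s in H. lia. }
    rewrite <- Ek in H. nia.
Qed.
End Convex.

(** * Bilinear means and broad-narrow decomposition *)

(* [v] encodes the pair (index, alpha): equality of sums of three [v]'s is equivalent to both equations. *)
Definition admissible (Cc : Z) (N Q : nat) (alpha v : nat -> Z) : Prop :=
  (0 < Q)%nat /\
  (forall n, (1 <= alpha (S (S n)) - 2 * alpha (S n) + alpha n <= Cc)%Z) /\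
  (forall n1 n2 n3 n4 n5 n6,
     (n1 < N)%nat -> (n2 < N)%nat -> (n3 < N)%nat -> (n4 < N)%nat -> (n5 < N)%nat -> (n6 < N)%nat ->
     (Z.abs (v n1 + v n2 + v n3 - (v n4 + v n5 + v n6)) < Z.of_nat Q)%Z /\
     ((v n1 + v n2 + v n3 = v n4 + v n5 + v n6)%Z ->
       (n1 + n2 + n3 = n4 + n5 + n6)%nat /\
       (alpha n1 + alpha n2 + alpha n3 = alpha n4 + alpha n5 + alpha n6)%Z)).

Definition piece (l s : nat) (b : nat -> R) (n : nat) : R := if Nat.eqb (n / l) s then b n else 0.

Definition supp (u L : nat) (b : nat -> R) : Prop := forall n, b n <> 0 -> (u <= n < u + L)%nat.

Definition separated (D : nat) (b b' : nat -> R) : Prop :=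
  (forall n m, b n <> 0 -> b' m <> 0 -> (m + D <= n)%nat) \/
  (forall n m, b n <> 0 -> b' m <> 0 -> (n + D <= m)%nat).

Lemma separated_sym D b b' : separated D b b' -> separated D b' b.
Proof. intros [H|H]; [right|left]; intros; auto. Qed.

Lemma piece_neq0 l s b n : piece l s b n <> 0 -> b n <> 0 /\ (n / l)%nat = s.
Proof. unfold piece. destruct (Nat.eqb_spec (n / l) s); [auto | intros H; now elim H]. Qed.

Lemma separated_piece_l D l s b b' : separated D b b' -> separated D (piece l s b) b'.
Proof. intros [H|H]; [left|right]; intros n m Hn Hm; apply piece_neq0 in Hn; apply H; tauto. Qed.

Lemma supp_piece l s b : (0 < l)%nat -> supp (l * s) l (piece l s b).
Proof.
  intros Hl n Hn. apply piece_neq0 in Hn as [_ <-].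
  pose proof (Nat.div_mod_eq n l). pose proof (Nat.mod_upper_bound n l). lia.
Qed.

Lemma supp_piece_sub u L l s b : supp u L b -> supp u L (piece l s b).
Proof. intros H n Hn. apply piece_neq0 in Hn as [Hn _]. auto. Qed.

Lemma rsum_indic_le (l : list nat) n : NoDup l -> rsum l (fun t => if Nat.eqb n t then 1 else 0) <= 1.
Proof.
  intros Hd. destruct (in_dec Nat.eq_dec n l) as [H|H].
  - rewrite (rsum_indic l n (fun _ => 1)); auto; lra.
  - rewrite rsum_0; [lra|]. intros t Ht. destruct (Nat.eqb_spec n t); [subst; easy|reflexivity].
Qed.

(** Excludes equal and adjacent blocks, so that two far blocks of length l are separated by l. Real
    values let it weight summands. *)
Definition far (s t : nat) : R := if (Nat.leb s (t + 1) && Nat.leb t (s + 1))%bool then 0 else 1.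

Lemma far_ge0 s t : 0 <= far s t.
Proof. unfold far. destruct andb; lra. Qed.

Lemma far_sym s t : far s t = far t s.
Proof. unfold far. now rewrite Bool.andb_comm. Qed.

Lemma near_count S s : NoDup S -> rsum S (fun t => 1 - far s t) <= 3.
Proof.
  intros Hd. apply Rle_trans with (rsum S (fun t => (if Nat.eqb s t then 1 else 0) +
      ((if Nat.eqb (s + 1) t then 1 else 0) + (if Nat.eqb (s - 1) t then 1 else 0)))).
  - apply rsum_le; intros t _. unfold far.
    destruct (Nat.leb_spec s (t + 1)); destruct (Nat.leb_spec t (s + 1)); cbn [andb];
    destruct (Nat.eqb_spec s t); destruct (Nat.eqb_spec (s + 1) t);
    destruct (Nat.eqb_spec (s - 1) t); try lra; lia.
  - rewrite !rsum_plus. pose proof (rsum_indic_le S s Hd). pose proof (rsum_indic_le S (s + 1) Hd).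
    pose proof (rsum_indic_le S (s - 1) Hd). lra.
Qed.

Lemma max_exists {A} (l : list A) (f : A -> R) : l <> nil -> exists t, In t l /\ forall s, In s l -> f s <= f t.
Proof.
  induction l as [|x l IH]; [easy|]. intros _. destruct l as [|y l].
  - exists x. split; [simpl; auto|]. intros s [<-|[]]; lra.
  - destruct IH as [t [Ht Hm]]; [easy|]. destruct (Rle_dec (f x) (f t)) as [H|H].
    + exists t. split; [now right|]. intros s [<-|Hs]; auto.
    + exists x. split; [now left|]. intros s [<-|Hs]; [lra|]. specialize (Hm s Hs). lra.
Qed.

Lemma rsum_le_max {A} (l : list A) (f : A -> R) : l <> nil ->
  exists t, In t l /\ rsum l f <= INR (length l) * f t.
Proof.
  intros Hl. destruct (max_exists l f Hl) as [t [Ht Hm]]. exists t. split; auto.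
  rewrite <- rsum_const. now apply rsum_le.
Qed.

(** Let [a s] be the largest term. If the sum exceeds [6 * a s], the at most three terms near [s]
    make up less than half of it, so some far [a t] is at least the sum divided by [2 * length S];
    as [a t <= a s], its sixth power is at most [a s ^ 3 * a t ^ 3]. *)
Lemma broad_narrow_pointwise (S : list nat) (a : nat -> R) : NoDup S -> (forall s, 0 <= a s) ->
  (rsum S a) ^ 6 <= 6 ^ 6 * rsum S (fun s => a s ^ 6) +
    (2 * INR (length S)) ^ 6 * rsum S (fun s => rsum S (fun t => far s t * (a s ^ 3 * a t ^ 3))).
Proof.
  intros Hd Ha.
  destruct (list_eq_dec Nat.eq_dec S nil) as [->|Hne]; [unfold rsum; simpl; lra|].
  assert (H1 : 0 <= rsum S (fun s => a s ^ 6)) by (apply rsum_ge0; intros; now apply pow_le).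
  assert (H2' : forall s t, 0 <= far s t * (a s ^ 3 * a t ^ 3)).
  { intros. apply Rmult_le_pos; [apply far_ge0|]. apply Rmult_le_pos; now apply pow_le. }
  assert (H2 : 0 <= rsum S (fun s => rsum S (fun t => far s t * (a s ^ 3 * a t ^ 3)))).
  { apply rsum_ge0; intros; apply rsum_ge0; auto. }
  assert (HT : 0 <= rsum S a) by (apply rsum_ge0; auto).
  assert (HL : 0 < INR (length S)) by (apply lt_0_INR; destruct S; [easy|simpl; lia]).
  destruct (max_exists S a Hne) as [s [Hs Hm]].
  destruct (Rle_dec (rsum S a) (6 * a s)) as [H|H].
  - assert ((rsum S a) ^ 6 <= (6 * a s) ^ 6) by (apply pow_incr; lra).
    assert (a s ^ 6 <= rsum S (fun s => a s ^ 6)).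
    { apply (rsum_term S (fun s => a s ^ 6)); auto. intros; now apply pow_le. }
    rewrite Rpow_mult_distr in H0.
    assert (0 <= (2 * INR (length S)) ^ 6) by (apply pow_le; lra). nra.
  - destruct (rsum_le_max S (fun t => far s t * a t) Hne) as [t [Ht Hmt]].
    assert (Hsplit : rsum S a = rsum S (fun t => (1 - far s t) * a t) + rsum S (fun t => far s t * a t)).
    { rewrite <- rsum_plus. apply rsum_ext; intros; ring. }
    assert (Hn : rsum S (fun t => (1 - far s t) * a t) <= 3 * a s).
    { apply Rle_trans with (rsum S (fun t => (1 - far s t) * a s)).
      - apply rsum_le; intros y Hy. apply Rmult_le_compat_l; auto. unfold far; destruct andb; lra.
      - rewrite rsum_scal_r. apply Rmult_le_compat_r; auto. now apply near_count. }
    assert (Hb : rsum S a <= 2 * INR (length S) * (far s t * a t)) by lra.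
    assert (Hf : far s t = 1).
    { unfold far in *. destruct andb; [|reflexivity]. pose proof (Ha s). nra. }
    rewrite Hf, Rmult_1_l in Hb.
    assert ((rsum S a) ^ 6 <= (2 * INR (length S) * a t) ^ 6) by (apply pow_incr; lra).
    rewrite Rpow_mult_distr in H0.
    assert (a t ^ 6 <= far s t * (a s ^ 3 * a t ^ 3)).
    { rewrite Hf, Rmult_1_l. replace (a t ^ 6) with (a t ^ 3 * a t ^ 3) by ring.
      apply Rmult_le_compat_r; [now apply pow_le|]. apply pow_incr; auto. }
    assert (far s t * (a s ^ 3 * a t ^ 3) <= rsum S (fun s => rsum S (fun t => far s t * (a s ^ 3 * a t ^ 3)))).
    { eapply Rle_trans; [|apply (rsum_term S (fun s => rsum S (fun t => far s t * (a s ^ 3 * a t ^ 3))) s)]; auto.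
      - apply (rsum_term S (fun t => far s t * (a s ^ 3 * a t ^ 3)) t); auto.
      - intros; apply rsum_ge0; auto. }
    assert (0 <= (2 * INR (length S)) ^ 6) by (apply pow_le; lra). nra.
Qed.

(** * Mixed and sixth moments of a fixed admissible system *)

Section Core.
Variables (Cc : Z) (N Q : nat) (alpha v : nat -> Z).
Hypothesis Hadm : admissible Cc N Q alpha v.

Definition expo (b : nat -> R) (x : R) : C := trigpoly (seq 0 N) b v x.
Definition energy (b : nat -> R) : R := rsum (seq 0 N) (fun n => b n ^ 2).
Definition mixed (b b' : nat -> R) : R := avg Q (fun x => Cmod (expo b x) ^ 2 * Cmod (expo b' x) ^ 4).
Definition sixth (b : nat -> R) : R := avg Q (fun x => Cmod (expo b x) ^ 6).

Lemma energy_ge0 b : 0 <= energy b.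
Proof. apply rsum_ge0; intros; apply pow2_ge_0. Qed.

Lemma sixth_ge0 b : 0 <= sixth b.
Proof. apply avg_ge0; intros. apply pow_le, Cmod_ge_0. Qed.

Lemma mixed_ge0 b b' : 0 <= mixed b b'.
Proof. apply avg_ge0; intros. apply Rmult_le_pos; apply pow_le, Cmod_ge_0. Qed.

Lemma expo_pieces l (S : list nat) b x : NoDup S ->
  (forall n, (n < N)%nat -> b n <> 0 -> In (n / l)%nat S) ->
  expo b x = csum S (fun s => expo (piece l s b) x).
Proof.
  intros Hd HS. unfold expo, trigpoly. rewrite csum_swap. apply csum_ext; intros n Hn. apply in_seq in Hn.
  destruct (Req_dec (b n) 0) as [E|E].
  - rewrite csum_0; [rewrite E; ring|]. intros s _. unfold piece. destruct Nat.eqb; rewrite ?E; ring.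
  - rewrite (csum_ext _ _ (fun s => if Nat.eqb (n / l) s then Cmult (RtoC (b n)) (e (IZR (v n) * x)) else RtoC 0)).
    + rewrite (csum_indic S (n / l) (fun _ => Cmult (RtoC (b n)) (e (IZR (v n) * x)))); auto.
      apply HS; auto; lia.
    + intros s _. unfold piece. destruct Nat.eqb; ring.
Qed.

Lemma energy_pieces l (S : list nat) b : NoDup S ->
  (forall n, (n < N)%nat -> b n <> 0 -> In (n / l)%nat S) ->
  energy b = rsum S (fun s => energy (piece l s b)).
Proof.
  intros Hd HS. unfold energy. rewrite rsum_swap. apply rsum_ext; intros n Hn. apply in_seq in Hn.
  destruct (Req_dec (b n) 0) as [E|E].
  - rewrite rsum_0; [rewrite E; ring|]. intros s _. unfold piece. destruct Nat.eqb; rewrite ?E; ring.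
  - rewrite (rsum_ext _ _ (fun s => if Nat.eqb (n / l) s then b n ^ 2 else 0)).
    + rewrite (rsum_indic S (n / l) (fun _ => b n ^ 2)); auto. apply HS; auto; lia.
    + intros s _. unfold piece. destruct Nat.eqb; ring.
Qed.

Lemma energy_piece_le l s b : energy (piece l s b) <= energy b.
Proof.
  apply rsum_le; intros n _. unfold piece. destruct Nat.eqb; [lra|]. pose proof (pow2_ge_0 (b n)). lra.
Qed.

(** Since |F_2|^4 = |F_2^2|^2, this is an inner product of two threefold products. A common
    frequency would solve both equations, and [transversality] would then bound the distance of [n]
    and [m] by 2 Cc L^2 / D, hence by [l]. *)
Lemma mixed_orthogonal b b1 b1' b2 u L D l : (0 < D)%nat -> separated D b b2 ->
  (forall n, b1 n <> 0 -> b n <> 0) -> (forall n, b1' n <> 0 -> b n <> 0) ->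
  supp u L b2 -> (2 * Cc * Z.of_nat L * Z.of_nat L <= Z.of_nat D * Z.of_nat l)%Z ->
  (forall n m, b1 n <> 0 -> b1' m <> 0 -> (n + l < m \/ m + l < n)%nat) ->
  avg Q (fun x => dot (expo b1 x) (expo b1' x) * Cmod (expo b2 x) ^ 4) = 0.
Proof.
  destruct Hadm as (HQ & Hconv & Hfreq). intros HD Hs Hb Hb' Hsupp Hl Hfar.
  set (l3 := list_prod (list_prod (seq 0 N) (seq 0 N)) (seq 0 N)).
  set (c3 := fun (b : nat -> R) (p : nat * nat * nat) => b (fst (fst p)) * b2 (snd (fst p)) * b2 (snd p)).
  set (v3 := fun p : nat * nat * nat => (v (fst (fst p)) + v (snd (fst p)) + v (snd p))%Z).
  rewrite (avg_ext _ _ (fun x => dot (trigpoly l3 (c3 b1) v3 x) (trigpoly l3 (c3 b1') v3 x))).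
  2:{ intros x.
      assert (E : forall b0, trigpoly l3 (c3 b0) v3 x = Cmult (expo b0 x) (Cmult (expo b2 x) (expo b2 x))).
      { intros b0. unfold expo. rewrite Cmult_assoc, !trigpoly_mult. reflexivity. }
      rewrite !E, dot_mult_r, Cmod_mult. ring. }
  rewrite parseval; auto.
  - apply rsum_0; intros [[n p1] p2] Hin'. apply rsum_0; intros [[m p3] p4] Hin.
    unfold v3, c3; simpl. destruct (Z.eqb_spec (v n + v p1 + v p2) (v m + v p3 + v p4)) as [E|]; [|reflexivity].
    destruct (Req_dec (b1 n * b2 p1 * b2 p2) 0) as [->|H1]; [ring|].
    destruct (Req_dec (b1' m * b2 p3 * b2 p4) 0) as [->|H2]; [ring|].
    exfalso. unfold l3 in Hin, Hin'. rewrite !in_prod_iff, !in_seq in Hin, Hin'.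
    destruct (Hfreq n p1 p2 m p3 p4) as [_ Hf]; try lia. destruct (Hf E) as [E1 E2]. clear Hf.
    assert (Hn : b1 n <> 0) by (intros Z0; apply H1; rewrite Z0; ring).
    assert (Hm : b1' m <> 0) by (intros Z0; apply H2; rewrite Z0; ring).
    assert (Hp1 : b2 p1 <> 0) by (intros Z0; apply H1; rewrite Z0; ring).
    assert (Hp2 : b2 p2 <> 0) by (intros Z0; apply H1; rewrite Z0; ring).
    assert (Hp3 : b2 p3 <> 0) by (intros Z0; apply H2; rewrite Z0; ring).
    assert (Hp4 : b2 p4 <> 0) by (intros Z0; apply H2; rewrite Z0; ring).
    pose proof (Hsupp _ Hp1). pose proof (Hsupp _ Hp2). pose proof (Hsupp _ Hp3). pose proof (Hsupp _ Hp4).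
    specialize (Hfar n m Hn Hm).
    assert (Hnm : forall p, b2 p <> 0 -> (p + D <= n /\ p + D <= m \/ n + D <= p /\ m + D <= p)%nat)
      by (intros p Hp; destruct Hs; auto).
    assert (Hc : (Z.of_nat l * Z.of_nat D < (Z.of_nat (Nat.max n m) - Z.of_nat (Nat.min n m)) * Z.of_nat D)%Z).
    { apply Z.mul_lt_mono_pos_r; lia. }
    destruct (le_lt_dec n m).
    + assert (HT := transversality alpha Cc Hconv m n p3 p4 p1 p2 (Z.of_nat L) (Z.of_nat D) ltac:(lia)).
      cut ((Z.of_nat m - Z.of_nat n) * Z.of_nat D <= 2 * Cc * Z.of_nat L * Z.of_nat L)%Z.
      { replace (Nat.max n m) with m in Hc by lia. replace (Nat.min n m) with n in Hc by lia. lia. }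
      apply HT; try lia.
      * simpl. intros p [<-|[<-|[<-|[]]]]; lia.
      * specialize (Hnm p3 Hp3). lia.
    + assert (HT := transversality alpha Cc Hconv n m p1 p2 p3 p4 (Z.of_nat L) (Z.of_nat D) ltac:(lia)).
      cut ((Z.of_nat n - Z.of_nat m) * Z.of_nat D <= 2 * Cc * Z.of_nat L * Z.of_nat L)%Z.
      { replace (Nat.max n m) with n in Hc by lia. replace (Nat.min n m) with m in Hc by lia. lia. }
      apply HT; try lia.
      * simpl. intros p [<-|[<-|[<-|[]]]]; lia.
      * specialize (Hnm p1 Hp1). lia.
  - intros [[n1 n2] n3] [[n4 n5] n6] H1 H2. unfold l3 in *. rewrite !in_prod_iff, !in_seq in *.
    unfold v3; simpl. apply Hfreq; lia.
Qed.

(** When |F|^2 is expanded over blocks, orthogonality leaves the pairs of equal or adjacent blocks.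
    A block has at most three such partners, whence the factor 3. *)
Lemma mixed_decouple b b2 u L D l (S : list nat) : (0 < D)%nat -> (0 < l)%nat -> separated D b b2 ->
  supp u L b2 -> (2 * Cc * Z.of_nat L * Z.of_nat L <= Z.of_nat D * Z.of_nat l)%Z ->
  NoDup S -> (forall n, (n < N)%nat -> b n <> 0 -> In (n / l)%nat S) ->
  mixed b b2 <= 3 * rsum S (fun s => mixed (piece l s b) b2).
Proof.
  intros HD Hl Hs Hsupp Hc Hd HS.
  set (near := fun s t : nat => 1 - far s t).
  assert (Hnear : forall s t, near s t = near t s) by (intros; unfold near; now rewrite far_sym).
  assert (Hnear0 : forall s t, 0 <= near s t) by (intros; unfold near, far; destruct andb; lra).
  assert (Hcount : forall s, rsum S (near s) <= 3) by (intros; now apply near_count).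
  assert (E : mixed b b2 = rsum S (fun s => rsum S (fun t =>
     avg Q (fun x => dot (expo (piece l s b) x) (expo (piece l t b) x) * Cmod (expo b2 x) ^ 4)))).
  { unfold mixed.
    rewrite (avg_ext _ _ (fun x => rsum S (fun s => rsum S (fun t =>
       dot (expo (piece l s b) x) (expo (piece l t b) x) * Cmod (expo b2 x) ^ 4)))).
    - rewrite !avg_rsum. apply rsum_ext; intros s _. now rewrite avg_rsum.
    - intros x. rewrite <- dot_self, (expo_pieces l S b x Hd HS), dot_csum, <- rsum_scal_r.
      apply rsum_ext; intros s _. now rewrite rsum_scal_r. }
  rewrite E.
  apply Rle_trans with (rsum S (fun s => rsum S (fun t => near s t * ((mixed (piece l s b) b2 + mixed (piece l t b) b2) / 2)))).
  - apply rsum_le; intros s _. apply rsum_le; intros t _. unfold near, far.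
    destruct (Nat.leb_spec s (t + 1)); [destruct (Nat.leb_spec t (s + 1))|]; cbn [andb].
    + rewrite Rminus_0_r, Rmult_1_l. unfold mixed. unfold Rdiv. rewrite <- avg_plus, Rmult_comm, <- avg_scal. apply avg_le; intros x.
      assert (0 <= Cmod (expo b2 x) ^ 4) by apply pow_le, Cmod_ge_0.
      pose proof (Re_mult_conj_le (expo (piece l s b) x) (expo (piece l t b) x)). unfold dot. nra.
    + rewrite (mixed_orthogonal b _ _ b2 u L D l); auto; try lra.
      * intros n Hn; now apply piece_neq0 in Hn.
      * intros n Hn; now apply piece_neq0 in Hn.
      * intros n m Hn Hm. apply piece_neq0 in Hn as [_ Hn]. apply piece_neq0 in Hm as [_ Hm]. left.
        pose proof (Nat.div_mod_eq n l). pose proof (Nat.mod_upper_bound n l).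
        pose proof (Nat.div_mod_eq m l). pose proof (Nat.mod_upper_bound m l).
        rewrite Hn in *. rewrite Hm in *. assert (l * (s + 2) <= l * t)%nat by (apply Nat.mul_le_mono_l; lia). lia.
    + rewrite (mixed_orthogonal b _ _ b2 u L D l); auto; try lra.
      * intros n Hn; now apply piece_neq0 in Hn.
      * intros n Hn; now apply piece_neq0 in Hn.
      * intros n m Hn Hm. apply piece_neq0 in Hn as [_ Hn]. apply piece_neq0 in Hm as [_ Hm]. right.
        pose proof (Nat.div_mod_eq n l). pose proof (Nat.mod_upper_bound n l).
        pose proof (Nat.div_mod_eq m l). pose proof (Nat.mod_upper_bound m l).
        rewrite Hn in *. rewrite Hm in *. assert (l * (t + 2) <= l * s)%nat by (apply Nat.mul_le_mono_l; lia). lia.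
  - assert (E2 : rsum S (fun s => rsum S (fun t => near s t * ((mixed (piece l s b) b2 + mixed (piece l t b) b2) / 2)))
       = rsum S (fun s => mixed (piece l s b) b2 * rsum S (near s))).
    { transitivity (/2 * rsum S (fun s => rsum S (fun t => near s t * mixed (piece l s b) b2))
                  + /2 * rsum S (fun s => rsum S (fun t => near s t * mixed (piece l t b) b2))).
      - rewrite <- !rsum_scal, <- rsum_plus. apply rsum_ext; intros s _.
        rewrite <- !rsum_scal, <- rsum_plus. apply rsum_ext; intros t _. field.
      - rewrite (rsum_swap S S (fun s t => near s t * mixed (piece l t b) b2)).
        rewrite <- !rsum_scal, <- rsum_plus. apply rsum_ext; intros s _.
        rewrite (rsum_ext S (fun x => near x s * _) (fun t => near s t * mixed (piece l s b) b2)).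
        + rewrite rsum_scal_r. field.
        + intros t _. now rewrite (Hnear t s). }
    rewrite E2, <- rsum_scal. apply rsum_le; intros s _. pose proof (mixed_ge0 (piece l s b) b2).
    specialize (Hcount s). nra.
Qed.

(** Cauchy-Schwarz for the factors |F'| |F|^2 and |F'|^3. The exponents 2 and 4 change places at the
    price of a sixth moment of [b'] alone, which will be supported on a short interval. *)
Lemma mixed_switch b b' : mixed b b' <= sqrt (mixed b' b) * sqrt (sixth b').
Proof.
  rewrite <- sqrt_mult; [|apply mixed_ge0|apply sixth_ge0].
  rewrite <- (sqrt_pow2 (mixed b b')) by apply mixed_ge0. apply sqrt_le_1_alt.
  unfold mixed, sixth.
  rewrite (avg_ext Q (fun x => Cmod (expo b x) ^ 2 * Cmod (expo b' x) ^ 4)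
     (fun x => (Cmod (expo b' x) * Cmod (expo b x) ^ 2) * Cmod (expo b' x) ^ 3)) by (intros; ring).
  eapply Rle_trans; [apply avg_cauchy_schwarz|]. apply Req_le. f_equal; apply avg_ext; intros; ring.
Qed.

Lemma expo_sq_le u L b x : supp u L b -> Cmod (expo b x) ^ 2 <= INR L * energy b.
Proof.
  intros Hs. set (ind := fun n : nat => rsum (seq u L) (fun s => if Nat.eqb s n then 1 else 0)).
  assert (Hind : forall n, b n <> 0 -> ind n = 1).
  { intros n Hn. unfold ind. specialize (Hs n Hn).
    rewrite (rsum_ext _ _ (fun s => if Nat.eqb n s then 1 else 0)).
    - rewrite (rsum_indic (seq u L) n (fun _ => 1)); auto; [apply seq_NoDup | apply in_seq; lia].
    - intros s _. now rewrite Nat.eqb_sym. }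
  assert (H1 : Cmod (expo b x) <= rsum (seq 0 N) (fun n => ind n * Rabs (b n))).
  { unfold expo, trigpoly. eapply Rle_trans; [apply csum_mod|]. apply rsum_le; intros n _.
    rewrite Cmod_mult, Cmod_e, Cmod_R, Rmult_1_r.
    destruct (Req_dec (b n) 0) as [->|E]; [rewrite Rabs_R0; lra|]. rewrite (Hind n E). lra. }
  assert (Hi01 : forall n, 0 <= ind n <= 1).
  { intros n. split; [apply rsum_ge0; intros; destruct Nat.eqb; lra|]. unfold ind.
    rewrite (rsum_ext _ _ (fun s => if Nat.eqb n s then 1 else 0)).
    - apply rsum_indic_le, seq_NoDup.
    - intros s _. now rewrite Nat.eqb_sym. }
  apply Rle_trans with ((rsum (seq 0 N) (fun n => ind n * Rabs (b n))) ^ 2).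
  { apply pow_incr. split; [apply Cmod_ge_0 | exact H1]. }
  eapply Rle_trans; [apply cauchy_schwarz|]. apply Rmult_le_compat.
  - apply rsum_ge0; intros; apply pow2_ge_0.
  - apply rsum_ge0; intros; apply pow2_ge_0.
  - apply Rle_trans with (rsum (seq 0 N) ind).
    + apply rsum_le; intros n _. specialize (Hi01 n). nra.
    + unfold ind. rewrite rsum_swap. apply Rle_trans with (rsum (seq u L) (fun _ => 1)).
      * apply rsum_le; intros s _. apply rsum_indic_le, seq_NoDup.
      * rewrite rsum_const, length_seq. lra.
  - apply Req_le, rsum_ext; intros n _. apply pow2_abs.
Qed.

Lemma sixth_trivial u L b : supp u L b -> sixth b <= INR L ^ 3 * energy b ^ 3.
Proof.
  intros Hs. destruct Hadm as [HQ _]. rewrite <- (avg_const Q (INR L ^ 3 * energy b ^ 3)) by auto.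
  apply avg_le; intros x. rewrite <- Rpow_mult_distr.
  replace (Cmod (expo b x) ^ 6) with ((Cmod (expo b x) ^ 2) ^ 3) by ring.
  apply pow_incr. split; [apply pow2_ge_0 | now apply expo_sq_le with u].
Qed.

Lemma expo_energy0 u L b x : supp u L b -> energy b = 0 -> Cmod (expo b x) = 0.
Proof.
  intros Hs E. pose proof (expo_sq_le u L b x Hs) as H. rewrite E in H. nra.
Qed.

Lemma mixed_terminal u M b b2 V : supp u M b -> supp u M b2 -> 0 <= V ->
  sixth b <= V * energy b ^ 3 -> sixth b2 <= V * energy b2 ^ 3 ->
  mixed b b2 <= 2 * V * energy b * energy b2 ^ 2.
Proof.
  intros Hs Hs2 HV H1 H2. pose proof (energy_ge0 b). pose proof (energy_ge0 b2).
  destruct (Req_dec (energy b) 0) as [E|E].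
  { replace (mixed b b2) with (avg Q (fun _ => 0)).
    - destruct Hadm as [HQ _]. rewrite avg_const, E by auto. lra.
    - apply avg_ext; intros x. rewrite (expo_energy0 u M b x Hs E). ring. }
  destruct (Req_dec (energy b2) 0) as [E2|E2].
  { replace (mixed b b2) with (avg Q (fun _ => 0)).
    - destruct Hadm as [HQ _]. rewrite avg_const, E2 by auto. lra.
    - apply avg_ext; intros x. rewrite (expo_energy0 u M b2 x Hs2 E2). ring. }
  set (p := energy b) in *. set (q := energy b2) in *. assert (0 < p) by lra. assert (0 < q) by lra.
  apply Rle_trans with (p * q ^ 2 * (/ p ^ 3 * sixth b + / q ^ 3 * sixth b2)).
  - unfold mixed, sixth. rewrite <- !avg_scal, <- avg_plus, <- avg_scal. apply avg_le; intros x.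
    set (f := Cmod (expo b x) ^ 2 / p). set (g := Cmod (expo b2 x) ^ 2 / q).
    assert (0 <= f) by (apply Rdiv_le_0_compat; auto; apply pow2_ge_0).
    assert (0 <= g) by (apply Rdiv_le_0_compat; auto; apply pow2_ge_0).
    replace (Cmod (expo b x) ^ 2 * Cmod (expo b2 x) ^ 4) with (p * q ^ 2 * (f * g ^ 2)) by (unfold f, g; field; lra).
    replace (/ p ^ 3 * Cmod (expo b x) ^ 6 + / q ^ 3 * Cmod (expo b2 x) ^ 6) with (f ^ 3 + g ^ 3) by (unfold f, g; field; lra).
    apply Rmult_le_compat_l; [nra|].
    destruct (Rle_dec f g).
    + assert (f * g ^ 2 <= g * g ^ 2) by (apply Rmult_le_compat_r; [apply pow2_ge_0|auto]).
      assert (0 <= f ^ 3) by now apply pow_le. lra.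
    + assert (g ^ 2 <= f ^ 2) by (apply pow_incr; lra).
      assert (f * g ^ 2 <= f * f ^ 2) by (apply Rmult_le_compat_l; auto).
      assert (0 <= g ^ 3) by now apply pow_le. lra.
  - replace (2 * V * p * q ^ 2) with (p * q ^ 2 * (V + V)) by ring.
    apply Rmult_le_compat_l; [nra|].
    assert (0 < p ^ 3) by now apply pow_lt. assert (0 < q ^ 3) by now apply pow_lt.
    apply Rplus_le_compat.
    + apply Rmult_le_reg_l with (p ^ 3); auto. rewrite <- Rmult_assoc, Rinv_r; lra.
    + apply Rmult_le_reg_l with (q ^ 3); auto. rewrite <- Rmult_assoc, Rinv_r; lra.
Qed.

(** One step decouples [b] into blocks of length [l (S i)], exchanges the roles, and applies the
    claim at [S i] with [b2] in first place and a block of [b] in second. The factor 3 of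
    [mixed_decouple] and the square root of [mixed_switch] dictate the recursion for [W]. Both
    functions stay inside one interval of length [M], where [Vtop] serves the last step. *)
Lemma bilinear_iteration (n D u M : nat) (l : nat -> nat) (V W : nat -> R) (Vtop : R) :
  (0 < D)%nat -> (forall i, (0 < l i)%nat) ->
  (forall i, (i < n)%nat -> (2 * Cc * Z.of_nat (l i) * Z.of_nat (l i) <= Z.of_nat D * Z.of_nat (l (S i)))%Z) ->
  (forall i w b, (i < n)%nat -> supp w (l i) b -> sixth b <= V i * energy b ^ 3) ->
  (forall b, supp u M b -> sixth b <= Vtop * energy b ^ 3) ->
  0 <= Vtop -> (forall i, 0 <= V i) -> (forall i, 0 <= W i) ->
  2 * Vtop <= W n -> (forall i, (i < n)%nat -> 3 * sqrt (W (S i) * V i) <= W i) ->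
  forall j i, (i + j = n)%nat -> forall b b2 w, separated D b b2 -> supp u M b -> supp u M b2 ->
    supp w (l i) b2 -> mixed b b2 <= W i * energy b * energy b2 ^ 2.
Proof.
  intros HD Hl Hlen HV Htop HVtop HV0 HW0 HWn HW j.
  induction j as [|j IH]; intros i Hij b b2 w Hsep Hb Hb2 Hw.
  - replace i with n by lia. eapply Rle_trans; [apply (mixed_terminal u M _ _ Vtop); auto|].
    pose proof (energy_ge0 b). pose proof (pow2_ge_0 (energy b2)).
    apply Rmult_le_compat_r; auto. apply Rmult_le_compat_r; auto.
  (* All indices below [N] may serve as block indices: the estimate sums energies and never counts
     blocks. *)
  - assert (Hcov : forall k, (k < N)%nat -> b k <> 0 -> In (k / l (S i))%nat (seq 0 N)).
    { intros k Hk _. apply in_seq. pose proof (Nat.Div0.div_le_upper_bound k (l (S i)) k). specialize (Hl (S i)). nia. }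
    eapply Rle_trans; [apply (mixed_decouple b b2 w (l i) D (l (S i)) (seq 0 N)); auto|].
    { apply Hlen; lia. } { apply seq_NoDup. }
    apply Rle_trans with (3 * rsum (seq 0 N) (fun s => sqrt (W (S i) * V i) * energy b2 ^ 2 * energy (piece (l (S i)) s b))).
    + apply Rmult_le_compat_l; [lra|]. apply rsum_le; intros s _.
      set (bs := piece (l (S i)) s b).
      eapply Rle_trans; [apply mixed_switch|].
      assert (M1 : mixed b2 bs <= W (S i) * energy b2 * energy bs ^ 2).
      { apply (IH (S i) ltac:(lia) b2 bs (l (S i) * s)%nat); auto.
        - apply separated_sym. now apply separated_piece_l.
        - now apply supp_piece_sub.
        - now apply supp_piece. }
      assert (M2 : sixth b2 <= V i * energy b2 ^ 3) by (apply (HV i w); auto; lia).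
      pose proof (energy_ge0 b2). pose proof (energy_ge0 bs).
      rewrite <- sqrt_mult; [|apply mixed_ge0|apply sixth_ge0].
      replace (sqrt (W (S i) * V i) * energy b2 ^ 2 * energy bs)
        with (sqrt (W (S i) * V i * (energy b2 ^ 2 * energy bs) ^ 2)).
      * apply sqrt_le_1_alt. eapply Rle_trans.
        -- apply Rmult_le_compat; [apply mixed_ge0|apply sixth_ge0|exact M1|exact M2].
        -- apply Req_le; ring.
      * specialize (HV0 i). specialize (HW0 (S i)).
        rewrite sqrt_mult; [|nra|apply pow2_ge_0]. rewrite sqrt_pow2; [ring|].
        apply Rmult_le_pos; auto. apply pow2_ge_0.
    + rewrite rsum_scal, <- (energy_pieces (l (S i)) (seq 0 N) b (seq_NoDup _ _) Hcov).
      specialize (HW i ltac:(lia)). pose proof (energy_ge0 b). pose proof (pow2_ge_0 (energy b2)).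
      assert (0 <= energy b * energy b2 ^ 2) by now apply Rmult_le_pos. nra.
Qed.

(** Hölder's inequality without any orthogonality. The loss is acceptable because the subdivision
    happens only once, before the iteration. *)
Lemma mixed_subdivide b b2 l (S : list nat) : NoDup S ->
  (forall n, (n < N)%nat -> b2 n <> 0 -> In (n / l)%nat S) ->
  mixed b b2 <= INR (length S) ^ 3 * rsum S (fun t => mixed b (piece l t b2)).
Proof.
  intros Hd HS. unfold mixed. rewrite <- avg_rsum, <- avg_scal. apply avg_le; intros x.
  rewrite rsum_scal, <- Rmult_assoc, (Rmult_comm (INR (length S) ^ 3)), Rmult_assoc.
  apply Rmult_le_compat_l; [apply pow2_ge_0|]. rewrite (expo_pieces l S b2 x Hd HS).
  set (a := fun t => Cmod (expo (piece l t b2) x)).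
  apply Rle_trans with ((rsum S a) ^ 4).
  { apply pow_incr. split; [apply Cmod_ge_0|apply csum_mod]. }
  replace ((rsum S a) ^ 4) with (((rsum S a) ^ 2) ^ 2) by ring.
  apply Rle_trans with ((INR (length S) * rsum S (fun t => a t ^ 2)) ^ 2).
  { apply pow_incr. split; [apply pow2_ge_0|apply rsum_sq_le]. }
  rewrite Rpow_mult_distr. replace (INR (length S) ^ 3) with (INR (length S) ^ 2 * INR (length S)) by ring.
  rewrite Rmult_assoc. apply Rmult_le_compat_l; [apply pow2_ge_0|].
  eapply Rle_trans; [apply rsum_sq_le|]. apply Req_le. f_equal. apply rsum_ext; intros; unfold a; ring.
Qed.

(** The inequality 2 a^3 c^3 <= a^2 c^4 + a^4 c^2 turns the symmetric products of the broad part
    into mixed means. Spare powers of block energies are bounded by [energy b], and one sum of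
    energies per index closes up by additivity. *)
Lemma broad_narrow b l (S : list nat) V W : NoDup S -> 0 <= V -> 0 <= W ->
  (forall n, (n < N)%nat -> b n <> 0 -> In (n / l)%nat S) ->
  (forall s, sixth (piece l s b) <= V * energy (piece l s b) ^ 3) ->
  (forall s t, (s + 2 <= t \/ t + 2 <= s)%nat ->
     mixed (piece l s b) (piece l t b) <= W * energy (piece l s b) * energy (piece l t b) ^ 2) ->
  sixth b <= (6 ^ 6 * V + (2 * INR (length S)) ^ 6 * W) * energy b ^ 3.
Proof.
  intros Hd HV HW HS H6 HM.
  assert (Hm : 0 <= (2 * INR (length S)) ^ 6) by (apply pow_le; pose proof (pos_INR (length S)); lra).
  assert (HE : energy b = rsum S (fun s => energy (piece l s b))) by now apply energy_pieces.
  pose proof (energy_ge0 b) as HE0.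
  apply Rle_trans with (6 ^ 6 * rsum S (fun s => sixth (piece l s b)) + (2 * INR (length S)) ^ 6 *
     rsum S (fun s => rsum S (fun t => far s t * mixed (piece l s b) (piece l t b)))).
  - apply Rle_trans with (6 ^ 6 * rsum S (fun s => sixth (piece l s b)) + (2 * INR (length S)) ^ 6 *
     rsum S (fun s => rsum S (fun t => far s t * ((/ 2) * (mixed (piece l s b) (piece l t b) + mixed (piece l t b) (piece l s b)))))).
    + unfold sixth at 1 2, mixed.
      rewrite (rsum_ext S (fun s => rsum S _) (fun s => avg Q (fun x => rsum S (fun t => far s t * (/ 2 *
         (Cmod (expo (piece l s b) x) ^ 2 * Cmod (expo (piece l t b) x) ^ 4 +
          Cmod (expo (piece l t b) x) ^ 2 * Cmod (expo (piece l s b) x) ^ 4)))))).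
      2:{ intros s _. rewrite avg_rsum. apply rsum_ext; intros t _. now rewrite !avg_scal, avg_plus. }
      rewrite <- !avg_rsum, <- !avg_scal, <- avg_plus. apply avg_le; intros x.
      rewrite (expo_pieces l S b x Hd HS).
      set (a := fun t => Cmod (expo (piece l t b) x)).
      assert (Ha : forall t, 0 <= a t) by (intros; apply Cmod_ge_0).
      apply Rle_trans with ((rsum S a) ^ 6).
      { apply pow_incr. split; [apply Cmod_ge_0|apply csum_mod]. }
      eapply Rle_trans; [apply broad_narrow_pointwise; auto|].
      apply Rplus_le_compat_l, Rmult_le_compat_l; auto.
      apply rsum_le; intros s _. apply rsum_le; intros t _. apply Rmult_le_compat_l; [apply far_ge0|].
      fold (a s) (a t). specialize (Ha s) as Has. specialize (Ha t) as Hat.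
      assert (0 <= a s ^ 2 * a t ^ 2 * (a s - a t) ^ 2) by (replace (a s ^ 2 * a t ^ 2 * (a s - a t) ^ 2) with ((a s * a t * (a s - a t)) ^ 2) by ring; apply pow2_ge_0).
      nra.
    + apply Rplus_le_compat_l, Rmult_le_compat_l; auto. apply Req_le.
      transitivity (/2 * rsum S (fun s => rsum S (fun t => far s t * mixed (piece l s b) (piece l t b)))
         + /2 * rsum S (fun s => rsum S (fun t => far s t * mixed (piece l t b) (piece l s b)))).
      * rewrite <- !rsum_scal, <- rsum_plus. apply rsum_ext; intros s _.
        rewrite <- !rsum_scal, <- rsum_plus. apply rsum_ext; intros t _. ring.
      * rewrite (rsum_swap S S (fun s t => far s t * mixed (piece l t b) (piece l s b))).
        rewrite (rsum_ext S (fun y => rsum S (fun x => far x y * _)) (fun s => rsum S (fun t => far s t * mixed (piece l s b) (piece l t b)))).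
        -- field.
        -- intros s _. apply rsum_ext; intros t _. now rewrite far_sym.
  - rewrite Rmult_plus_distr_r. apply Rplus_le_compat.
    + rewrite Rmult_assoc. apply Rmult_le_compat_l; [lra|].
      apply Rle_trans with (rsum S (fun s => V * energy b ^ 2 * energy (piece l s b))).
      * apply rsum_le; intros s _. eapply Rle_trans; [apply H6|].
        pose proof (energy_piece_le l s b). pose proof (energy_ge0 (piece l s b)).
        replace (V * energy b ^ 2 * energy (piece l s b)) with (V * (energy b ^ 2 * energy (piece l s b))) by ring.
        apply Rmult_le_compat_l; auto. replace (energy (piece l s b) ^ 3) with (energy (piece l s b) ^ 2 * energy (piece l s b)) by ring.
        apply Rmult_le_compat_r; auto. apply pow_incr; auto.
      * rewrite rsum_scal, <- HE. apply Req_le; ring.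
    + rewrite Rmult_assoc. apply Rmult_le_compat_l; auto.
      apply Rle_trans with (rsum S (fun s => rsum S (fun t => W * energy b * (energy (piece l s b) * energy (piece l t b))))).
      * apply rsum_le; intros s _. apply rsum_le; intros t _.
        pose proof (energy_piece_le l t b). pose proof (energy_ge0 (piece l s b)). pose proof (energy_ge0 (piece l t b)).
        assert (Hp : energy (piece l s b) * energy (piece l t b) ^ 2 <= energy b * (energy (piece l s b) * energy (piece l t b))).
        { replace (energy (piece l s b) * energy (piece l t b) ^ 2) with (energy (piece l t b) * (energy (piece l s b) * energy (piece l t b))) by ring.
          apply Rmult_le_compat_r; auto. now apply Rmult_le_pos. }
        assert (Hp0 : 0 <= energy b * (energy (piece l s b) * energy (piece l t b))) by (repeat apply Rmult_le_pos; auto).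
        unfold far. destruct (Nat.leb_spec s (t + 1)); [destruct (Nat.leb_spec t (s + 1))|]; cbn [andb].
        -- rewrite Rmult_0_l. nra.
        -- rewrite Rmult_1_l. eapply Rle_trans; [apply HM; lia|]. nra.
        -- rewrite Rmult_1_l. eapply Rle_trans; [apply HM; lia|]. nra.
      * rewrite (rsum_ext S _ (fun s => W * energy b * energy b * energy (piece l s b))).
        -- rewrite rsum_scal, <- HE. apply Req_le; ring.
        -- intros s _. rewrite !rsum_scal, <- HE. ring.
Qed.
End Core.

(** * The sixth moment estimate *)

(** [K] is uniform in the system, and the exponent sees only the length [M] of the supporting
    interval, not [N]. Blocks at every scale can therefore be fed back into the same bound. *)
Definition sixth_moment_bound (Cc : Z) (eta K : R) : Prop :=
  forall N Q alpha v, admissible Cc N Q alpha v -> forall u M b, (1 <= M)%nat -> supp u M b ->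
    sixth N Q v b <= K * Rpower (INR M) eta * energy N b ^ 3.

Lemma supp_pieces u L l b : supp u L b -> forall n, b n <> 0 -> In (n / l)%nat (seq (u / l) (L / l + 2)).
Proof.
  intros H n Hn. specialize (H n Hn). apply in_seq.
  destruct l as [|l]; [simpl; lia|].
  assert (u / S l <= n / S l)%nat by (apply Nat.Div0.div_le_mono; lia).
  pose proof (Nat.div_mod_eq n (S l)). pose proof (Nat.mod_upper_bound u (S l)).
  pose proof (Nat.div_mod_eq u (S l)). pose proof (Nat.mod_upper_bound L (S l)).
  pose proof (Nat.div_mod_eq L (S l)).
  assert (Hlt : (S l * (n / S l) < S l * (u / S l + (L / S l + 2)))%nat) by lia.
  apply Nat.mul_lt_mono_pos_l in Hlt; lia.
Qed.

Lemma separated_pieces l s t b : (0 < l)%nat -> (s + 2 <= t \/ t + 2 <= s)%nat ->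
  separated l (piece l s b) (piece l t b).
Proof.
  intros Hl [H|H]; [right|left]; intros n m Hn Hm;
  apply supp_piece in Hn; auto; apply supp_piece in Hm; auto; nia.
Qed.

Lemma INR_div_le a b : (0 < b)%nat -> INR (a / b) <= INR a / INR b.
Proof.
  intros Hb. assert (0 < INR b) by now apply lt_0_INR.
  apply Rmult_le_reg_r with (INR b); auto. unfold Rdiv. rewrite Rmult_assoc, Rinv_l, Rmult_1_r by lra.
  rewrite <- mult_INR. apply le_INR. pose proof (Nat.div_mod_eq a b). lia.
Qed.

Lemma INR_div_gt a b : (0 < b)%nat -> INR a / INR b < INR (a / b + 1).
Proof.
  intros Hb. assert (0 < INR b) by now apply lt_0_INR.
  apply Rmult_lt_reg_r with (INR b); auto. unfold Rdiv. rewrite Rmult_assoc, Rinv_l, Rmult_1_r by lra.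
  rewrite <- mult_INR. apply lt_INR. pose proof (Nat.div_mod_eq a b). pose proof (Nat.mod_upper_bound a b). lia.
Qed.

(** The next length is the one [mixed_decouple] permits at distance [D], namely 2 Cc L^2 / D rounded
    up. *)
Fixpoint scale_len (Cc D l0 i : nat) : nat :=
  match i with O => l0 | S i => (2 * Cc * (scale_len Cc D l0 i) ^ 2 / D + 1)%nat end.

Fixpoint scale_cst (Cc : R) (i : nat) : R :=
  match i with O => 2 | S i => 2 * Cc * scale_cst Cc i ^ 2 + 1 end.

Lemma scale_cst_mono Cc i j : 1 <= Cc -> (i <= j)%nat -> 1 <= scale_cst Cc i <= scale_cst Cc j.
Proof.
  intros HC. assert (H1 : forall i, 1 <= scale_cst Cc i).
  { intros k; destruct k; simpl; [lra|]. pose proof (pow2_ge_0 (scale_cst Cc k)). nra. }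
  induction 1 as [|j H IH]; [split; [auto|lra]|]. split; auto. destruct IH as [_ IH].
  eapply Rle_trans; [exact IH|]. simpl. specialize (H1 j). nra.
Qed.

(** Squaring M/k^(2^i+1) and dividing by M/k turns 2^i into 2^(i+1). The hypothesis on
    [INR k ^ (2 ^ n + 1)] keeps the main term at least 1, so it absorbs the [+ 1] of the
    rounding. *)
Lemma scale_len_bound (Cc D l0 M k n : nat) : (1 <= Cc)%nat -> (0 < D)%nat -> (1 <= k)%nat -> (1 <= M)%nat ->
  INR M / INR k <= INR D -> INR l0 <= 2 * (INR M / INR k ^ 2) ->
  INR k ^ (2 ^ n + 1) <= INR M ->
  forall i, (i <= n)%nat -> INR (scale_len Cc D l0 i) <= scale_cst (INR Cc) i * (INR M / INR k ^ (2 ^ i + 1)).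
Proof.
  intros HC HD Hk HM HDk Hl0 Hn i. induction i as [|i IH]; intros Hi.
  - simpl scale_len. simpl scale_cst. simpl Nat.pow. exact Hl0.
  - specialize (IH ltac:(lia)). cbn [scale_len scale_cst].
    assert (HM' : 1 <= INR M) by (apply (le_INR 1); lia).
    assert (Hk' : 1 <= INR k) by (apply (le_INR 1); lia).
    assert (HC' : 1 <= INR Cc) by (apply (le_INR 1); lia).
    assert (Hmk : 0 < INR M / INR k) by (apply Rdiv_lt_0_compat; lra).
    set (p := (2 ^ i)%nat) in *.
    assert (Hkp : 0 < INR k ^ (p + 1)) by (apply pow_lt; lra).
    rewrite plus_INR. replace (INR 1) with 1 by reflexivity. rewrite Rmult_plus_distr_r, Rmult_1_l.
    apply Rplus_le_compat.
    + eapply Rle_trans; [apply INR_div_le; auto|]. rewrite !mult_INR, pow_INR. simpl (INR 2).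
      set (c := scale_cst (INR Cc) i) in *. set (x := INR (scale_len Cc D l0 i)) in *.
      assert (Hx : 0 <= x) by apply pos_INR.
      assert (Hx2 : x ^ 2 <= (c * (INR M / INR k ^ (p + 1))) ^ 2) by (apply pow_incr; auto).
      apply Rle_trans with (2 * INR Cc * x ^ 2 / (INR M / INR k)).
      * unfold Rdiv at 1 2. apply Rmult_le_compat_l.
        -- apply Rmult_le_pos; [lra|apply pow2_ge_0].
        -- apply Rinv_le_contravar; auto.
      * apply Rle_trans with (2 * INR Cc * (c * (INR M / INR k ^ (p + 1))) ^ 2 / (INR M / INR k)).
        -- unfold Rdiv at 1 2. apply Rmult_le_compat_r; [left; now apply Rinv_0_lt_compat|].
           apply Rmult_le_compat_l; lra.
        -- apply Req_le. replace (2 ^ S i + 1)%nat with (p + p + 1)%nat by (unfold p; simpl; lia).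
           rewrite !pow_add. simpl (INR k ^ 1). field. repeat split; try lra; apply pow_nonzero; lra.
    + assert (INR k ^ (2 ^ S i + 1) <= INR M).
      { eapply Rle_trans; [|exact Hn]. apply Rle_pow; auto.
        assert (2 ^ S i <= 2 ^ n)%nat by (apply Nat.pow_le_mono_r; lia). lia. }
      assert (0 < INR k ^ (2 ^ S i + 1)) by (apply pow_lt; lra).
      apply Rmult_le_reg_r with (INR k ^ (2 ^ S i + 1)); auto.
      unfold Rdiv. rewrite Rmult_assoc, Rinv_l; lra.
Qed.

Lemma Rpower_pos x y : 0 < Rpower x y.
Proof. apply exp_pos. Qed.

Lemma Rpower_ge_1 x y : 1 <= x -> 0 <= y -> 1 <= Rpower x y.
Proof. intros Hx Hy. rewrite <- (Rpower_O x) by lra. apply Rle_Rpower; auto. Qed.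

Lemma Rpower_le_pow x y n : 1 <= x -> y <= INR n -> Rpower x y <= x ^ n.
Proof. intros Hx Hy. rewrite <- Rpower_pow by lra. apply Rle_Rpower; auto. Qed.

Lemma Rpower_div x y z : 0 < x -> 0 < y -> Rpower (x / y) z = Rpower x z / Rpower y z.
Proof.
  intros Hx Hy. apply Rmult_eq_reg_r with (Rpower y z); [|apply Rgt_not_eq, Rpower_pos].
  rewrite Rpower_mult_distr; auto; [|now apply Rdiv_lt_0_compat].
  unfold Rdiv. rewrite Rmult_assoc, Rinv_l, Rmult_1_r by lra.
  rewrite Rmult_assoc, Rinv_l, Rmult_1_r; [reflexivity|apply Rgt_not_eq, Rpower_pos].
Qed.

(* One pass of the broad-narrow and bilinear arguments at the scales M, M/k, M/k^2, M/k^3, M/k^5, ... *)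
Lemma sixth_step (Cc N Q : nat) alpha v (n k u M : nat) b eta K :
  (1 <= Cc)%nat -> admissible (Z.of_nat Cc) N Q alpha v -> sixth_moment_bound (Z.of_nat Cc) eta K ->
  0 <= K -> 0 <= eta <= 3 -> 18 <= eta * (INR n - 2) -> (2 <= k)%nat -> (1 <= M)%nat ->
  INR k ^ (2 ^ n + 1) <= INR M -> supp u M b ->
  sixth N Q v b <= (8 * 6 ^ 6 + 8 ^ 6 * 27 * 9 * scale_cst (INR Cc) n ^ 3) * K * Rpower (INR M) eta
      / Rpower (INR k) eta * energy N b ^ 3.
Proof.
  intros HC Hadm HB HK Heta Hn Hk HM HkM Hb.
  assert (HM' : 1 <= INR M) by (apply (le_INR 1); lia).
  assert (Hk' : 2 <= INR k) by (apply (le_INR 2); lia).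
  assert (HC' : 1 <= INR Cc) by (apply (le_INR 1); lia).
  set (c := scale_cst (INR Cc) n).
  assert (Hc1 : 1 <= c) by (apply (scale_cst_mono (INR Cc) n n HC'); lia).
  assert (Hk2M : INR k ^ 2 <= INR M).
  { eapply Rle_trans; [|exact HkM]. apply Rle_pow; [lra|]. pose proof (Nat.pow_nonzero 2 n). lia. }
  assert (Hk1M : INR k <= INR M) by nra.
  (* The gain aimed at is [z ^ 2]; taking the square root of k^eta as unit keeps every exponent
     below a natural number despite the square roots of the exchanges. *)
  set (Y := Rpower (INR M) eta). set (z := Rpower (INR k) (eta / 2)).
  assert (HY : 0 < Y) by apply Rpower_pos.
  assert (Hz : 1 <= z) by (apply Rpower_ge_1; lra).
  assert (Hz2 : Rpower (INR k) eta = z ^ 2).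
  { unfold z. simpl. rewrite Rmult_1_r, <- Rpower_plus. f_equal. field. }
  set (lb := (M / k + 1)%nat). set (l0 := (M / k ^ 2 + 1)%nat).
  assert (Hk0 : (0 < k ^ 2)%nat) by (pose proof (Nat.pow_nonzero k 2); lia).
  assert (Hlb1 : INR M / INR k <= INR lb) by (left; apply INR_div_gt; lia).
  assert (Hl01 : INR M / INR k ^ 2 <= INR l0) by (rewrite <- pow_INR; left; apply INR_div_gt; lia).
  assert (HMk1 : 1 <= INR M / INR k).
  { apply Rmult_le_reg_r with (INR k); [lra|]. unfold Rdiv; rewrite Rmult_assoc, Rinv_l; lra. }
  assert (HMk2 : 1 <= INR M / INR k ^ 2).
  { apply Rmult_le_reg_r with (INR k ^ 2); [nra|]. unfold Rdiv; rewrite Rmult_assoc, Rinv_l; nra. }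
  assert (Hlb2 : INR lb <= 2 * (INR M / INR k)).
  { unfold lb. rewrite plus_INR. pose proof (INR_div_le M k ltac:(lia)). simpl (INR 1). lra. }
  assert (Hl02 : INR l0 <= 2 * (INR M / INR k ^ 2)).
  { unfold l0. rewrite plus_INR. pose proof (INR_div_le M (k ^ 2) ltac:(lia)). rewrite pow_INR in H. simpl (INR 1). lra. }
  set (len := scale_len Cc lb l0).
  assert (Hlen0 : forall i, (0 < len i)%nat) by (intros [|i]; unfold len, l0; cbn [scale_len]; lia).
  (* The assumed bound at length c M/k^(2^i), which gives away a factor k in [len i]; [c ^ 3]
     suffices because eta <= 3. *)
  set (V := fun i : nat => K * c ^ 3 * Y / z ^ (2 * 2 ^ i)).
  (* Solves W_i = 3 sqrt (W_(i+1) V_i) exactly: half of 2^(i+1) (n-i-1) + 2 * 2^i is 2^i (n-i), and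
     9 = 3 sqrt 9. Thus [W 0] carries the gain [z ^ n]. *)
  set (W := fun i : nat => 9 * c ^ 3 * K * Y / z ^ (2 ^ i * (n - i))).
  assert (Hzp : forall j, 0 < z ^ j) by (intros; apply pow_lt; lra).
  assert (Hc3 : 1 <= c ^ 3) by (apply pow_R1_Rle; auto).
  assert (HV0 : forall i, 0 <= V i).
  { intros i. apply Rdiv_le_0_compat; auto. repeat apply Rmult_le_pos; lra. }
  assert (HW0 : forall i, 0 <= W i).
  { intros i. apply Rdiv_le_0_compat; auto. repeat apply Rmult_le_pos; lra. }
  assert (HV : forall i w b, (i < n)%nat -> supp w (len i) b -> sixth N Q v b <= V i * energy N b ^ 3).
  { intros i w b' Hi Hs. eapply Rle_trans; [apply (HB N Q alpha v Hadm w (len i)); auto; specialize (Hlen0 i); lia|].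
    apply Rmult_le_compat_r; [apply pow_le, energy_ge0|]. unfold V, Rdiv. rewrite 2!Rmult_assoc.
    apply Rmult_le_compat_l; auto.
    assert (HL : INR (len i) <= c * (INR M / INR k ^ (2 ^ i))).
    { eapply Rle_trans; [apply (scale_len_bound Cc lb l0 M k n); auto; try lia; unfold lb; lia|].
      apply Rmult_le_compat.
      - destruct (scale_cst_mono (INR Cc) i i HC'); [lia|lra].
      - apply Rdiv_le_0_compat; [lra|apply pow_lt; lra].
      - destruct (scale_cst_mono (INR Cc) i n HC'); [lia|auto].
      - unfold Rdiv. apply Rmult_le_compat_l; [lra|]. apply Rinv_le_contravar; [apply pow_lt; lra|].
        apply Rle_pow; [lra|lia]. }
    assert (Hkp : 0 < INR k ^ (2 ^ i)) by (apply pow_lt; lra).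
    assert (HMkp : 0 < INR M / INR k ^ (2 ^ i)) by (apply Rdiv_lt_0_compat; lra).
    apply Rle_trans with (Rpower (c * (INR M / INR k ^ (2 ^ i))) eta).
    { apply Rle_Rpower_l; [lra|]. split; auto. apply lt_0_INR; auto. }
    rewrite <- Rpower_mult_distr by lra. rewrite Rpower_div by lra.
    replace (Rpower (INR k ^ (2 ^ i)) eta) with (z ^ (2 * 2 ^ i)).
    2:{ rewrite pow_mult, <- Hz2. rewrite <- !Rpower_pow; [|lra|apply Rpower_pos].
        rewrite !Rpower_mult. f_equal. ring. }
    fold Y. apply Rmult_le_compat_r.
    - apply Rdiv_le_0_compat; auto; lra.
    - apply Rpower_le_pow; simpl; lra. }
  assert (HVtop : forall b, supp u M b -> sixth N Q v b <= K * Y * energy N b ^ 3).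
  { intros b' Hs. apply (HB N Q alpha v Hadm u M); auto. }
  assert (HWn : 2 * (K * Y) <= W n).
  { unfold W. rewrite Nat.sub_diag, Nat.mul_0_r. simpl (z ^ 0). unfold Rdiv. rewrite Rinv_1, Rmult_1_r.
    assert (0 <= K * Y) by (apply Rmult_le_pos; lra). nra. }
  assert (HW : forall i, (i < n)%nat -> 3 * sqrt (W (S i) * V i) <= W i).
  { intros i Hi. apply Req_le.
    replace (W (S i) * V i) with ((3 * c ^ 3 * K * Y / z ^ (2 ^ i * (n - i))) ^ 2).
    - rewrite sqrt_pow2; [unfold W; field; apply Rgt_not_eq, Hzp|].
      apply Rdiv_le_0_compat; auto. repeat apply Rmult_le_pos; lra.
    - unfold W, V. replace (2 ^ i * (n - i))%nat with (2 ^ i * (n - S i) + 2 ^ i)%nat.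
      2:{ replace (n - i)%nat with (n - S i + 1)%nat by lia. ring. }
      replace (2 ^ S i * (n - S i))%nat with (2 ^ i * (n - S i) + 2 ^ i * (n - S i))%nat by (simpl; ring).
      replace (2 * 2 ^ i)%nat with (2 ^ i + 2 ^ i)%nat by ring. rewrite !pow_add.
      field. repeat split; apply Rgt_not_eq, Hzp. }
  assert (HbilW : forall s t t', (s + 2 <= t \/ t + 2 <= s)%nat ->
     mixed N Q v (piece lb s b) (piece l0 t' (piece lb t b))
       <= W 0%nat * energy N (piece lb s b) * energy N (piece l0 t' (piece lb t b)) ^ 2).
  { intros s t t' Hst.
    apply (bilinear_iteration (Z.of_nat Cc) N Q alpha v Hadm n lb u M len V W (K * Y)) with (j := n) (w := (l0 * t')%nat); auto.
    - unfold lb; lia.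
    - intros i Hi. unfold len. cbn [scale_len]. set (x := scale_len Cc lb l0 i).
      assert (Hlbn : (lb <> 0)%nat) by (unfold lb; lia).
      pose proof (Nat.div_mod_eq (2 * Cc * x ^ 2) lb) as E1. pose proof (Nat.mod_upper_bound (2 * Cc * x ^ 2) lb Hlbn) as E2.
      assert (E3 : (2 * Cc * x * x <= lb * (2 * Cc * x ^ 2 / lb + 1))%nat).
      { rewrite Nat.mul_add_distr_l. replace (2 * Cc * x * x)%nat with (2 * Cc * x ^ 2)%nat by (simpl; ring). lia. }
      apply inj_le in E3. rewrite !Nat2Z.inj_mul in E3. exact E3.
    - apply Rmult_le_pos; lra.
    - apply separated_sym, separated_piece_l, separated_pieces; [unfold lb; lia|]. lia.
    - now apply supp_piece_sub.
    - now apply supp_piece_sub, supp_piece_sub.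
    - apply supp_piece. unfold l0; lia. }
  (* Upper bounds for the number of blocks of length [l0] meeting one of length [lb], and of blocks
     of length [lb] meeting the support; both are O(k). They enter as m0^3 from [mixed_subdivide]
     and (2m)^6 from [broad_narrow], together k^9. *)
  set (m0 := (lb / l0 + 2)%nat). set (m := (M / lb + 2)%nat).
  assert (Hlbpos : 0 < INR lb) by lra. assert (Hl0pos : 0 < INR l0) by lra.
  assert (Hm0 : INR m0 <= 4 * INR k).
  { unfold m0. rewrite plus_INR. pose proof (INR_div_le lb l0 ltac:(unfold l0; lia)). simpl (INR 2).
    assert (INR lb / INR l0 <= 2 * INR k); [|lra].
    apply Rmult_le_reg_r with (INR l0); auto. unfold Rdiv. rewrite Rmult_assoc, Rinv_l, Rmult_1_r by lra.
    eapply Rle_trans; [exact Hlb2|]. replace (2 * (INR M / INR k)) with (2 * INR k * (INR M / INR k ^ 2)) by (field; lra).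
    apply Rmult_le_compat_l; lra. }
  assert (Hm : INR m <= 2 * INR k).
  { unfold m. rewrite plus_INR. pose proof (INR_div_le M lb ltac:(unfold lb; lia)). simpl (INR 2).
    assert (INR M / INR lb <= INR k); [|lra].
    apply Rmult_le_reg_r with (INR lb); auto. unfold Rdiv. rewrite Rmult_assoc, Rinv_l, Rmult_1_r by lra.
    replace (INR M) with (INR k * (INR M / INR k)) by (field; lra). apply Rmult_le_compat_l; lra. }
  assert (Hbil : forall s t, (s + 2 <= t \/ t + 2 <= s)%nat ->
     mixed N Q v (piece lb s b) (piece lb t b)
       <= INR m0 ^ 3 * W 0%nat * energy N (piece lb s b) * energy N (piece lb t b) ^ 2).
  { intros s t Hst.
    assert (Hcov : forall n0, (n0 < N)%nat -> piece lb t b n0 <> 0 -> In (n0 / l0)%nat (seq (lb * t / l0) m0)).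
    { intros n0 _. apply supp_pieces. apply supp_piece. unfold lb; lia. }
    eapply Rle_trans; [apply (mixed_subdivide N Q v _ (piece lb t b) l0 (seq (lb * t / l0) m0)); auto; apply seq_NoDup|].
    rewrite length_seq, !Rmult_assoc. apply Rmult_le_compat_l; [apply pow_le, pos_INR|].
    apply Rle_trans with (rsum (seq (lb * t / l0) m0) (fun t' =>
       W 0%nat * energy N (piece lb s b) * energy N (piece lb t b) * energy N (piece l0 t' (piece lb t b)))).
    - apply rsum_le; intros t' _. eapply Rle_trans; [apply HbilW; auto|].
      pose proof (energy_piece_le N l0 t' (piece lb t b)). pose proof (energy_ge0 N (piece l0 t' (piece lb t b))).
      pose proof (energy_ge0 N (piece lb s b)). specialize (HW0 0%nat).
      rewrite (Rmult_assoc _ (energy N (piece lb t b))). apply Rmult_le_compat_l; [now apply Rmult_le_pos|].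
      simpl. rewrite Rmult_1_r. apply Rmult_le_compat_r; auto.
    - rewrite rsum_scal, <- (energy_pieces N l0 (seq (lb * t / l0) m0) (piece lb t b) (seq_NoDup _ _) Hcov).
      apply Req_le; ring. }
  set (Vb := K * 8 * Y / z ^ 2).
  assert (HVb : forall s, sixth N Q v (piece lb s b) <= Vb * energy N (piece lb s b) ^ 3).
  { intros s. eapply Rle_trans; [apply (HB N Q alpha v Hadm (lb * s)%nat lb); [unfold lb; lia|apply supp_piece; unfold lb; lia]|].
    apply Rmult_le_compat_r; [apply pow_le, energy_ge0|]. unfold Vb, Rdiv. rewrite 2!Rmult_assoc.
    apply Rmult_le_compat_l; auto.
    apply Rle_trans with (Rpower (2 * (INR M / INR k)) eta).
    { apply Rle_Rpower_l; lra. }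
    rewrite <- Rpower_mult_distr by lra. rewrite Rpower_div by lra. rewrite Hz2. fold Y.
    apply Rmult_le_compat_r; [apply Rdiv_le_0_compat; [lra|auto]|].
    replace 8 with (2 ^ 3) by ring. apply Rpower_le_pow; simpl; lra. }
  assert (Hfin : sixth N Q v b <= (6 ^ 6 * Vb + (2 * INR m) ^ 6 * (INR m0 ^ 3 * W 0%nat)) * energy N b ^ 3).
  { rewrite <- (length_seq m (u / lb)).
    apply (broad_narrow N Q v b lb (seq (u / lb) m)); auto.
    - apply seq_NoDup.
    - unfold Vb. apply Rdiv_le_0_compat; auto. repeat apply Rmult_le_pos; lra.
    - apply Rmult_le_pos; auto. apply pow_le, pos_INR.
    - intros n0 _. now apply supp_pieces. }
  eapply Rle_trans; [exact Hfin|]. apply Rmult_le_compat_r; [apply pow_le, energy_ge0|].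
  rewrite Hz2.
  (* The condition on [n] is made for this: k^9 <= z^(n-2) says 9 <= (eta/2) (n-2). *)
  assert (Hkz : INR k ^ 9 / z ^ n <= / z ^ 2).
  { assert (Hn2 : (2 <= n)%nat).
    { destruct (le_lt_dec 2 n); auto. assert (INR n <= 1) by (apply (le_INR n 1); lia). nra. }
    replace n with (2 + (n - 2))%nat at 1 by lia. rewrite pow_add.
    assert (INR k ^ 9 <= z ^ (n - 2)).
    { unfold z. rewrite <- !Rpower_pow; [|apply Rpower_pos|lra]. rewrite Rpower_mult. apply Rle_Rpower; [lra|].
      rewrite minus_INR by lia. simpl. lra. }
    apply Rmult_le_reg_r with (z ^ 2 * z ^ (n - 2)); [apply Rmult_lt_0_compat; apply Hzp|].
    unfold Rdiv. rewrite Rmult_assoc, Rinv_l, Rmult_1_r by (apply Rgt_not_eq, Rmult_lt_0_compat; apply Hzp).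
    rewrite <- Rmult_assoc, Rinv_l by (apply Rgt_not_eq, Hzp). lra. }
  assert (Hk9 : (2 * INR m) ^ 6 * INR m0 ^ 3 <= 8 ^ 6 * 27 * INR k ^ 9).
  { apply Rle_trans with ((2 * (2 * INR k)) ^ 6 * (4 * INR k) ^ 3).
    - pose proof (pos_INR m). pose proof (pos_INR m0). apply Rmult_le_compat; try (apply pow_le; lra); apply pow_incr; lra.
    - replace ((2 * (2 * INR k)) ^ 6 * (4 * INR k) ^ 3) with (4 ^ 9 * INR k ^ 9) by ring.
      apply Rmult_le_compat_r; [apply pow_le; lra|lra]. }
  unfold Vb, W. rewrite Nat.sub_0_r. replace (2 ^ 0 * n)%nat with n by (simpl; lia).
  assert (HKY : 0 <= 9 * c ^ 3 * K * Y) by (repeat apply Rmult_le_pos; lra).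
  apply Rle_trans with (6 ^ 6 * (K * 8 * Y / z ^ 2) + (8 ^ 6 * 27) * (9 * c ^ 3 * K * Y) * (INR k ^ 9 / z ^ n)).
  - apply Rplus_le_compat_l.
    replace ((2 * INR m) ^ 6 * (INR m0 ^ 3 * (9 * c ^ 3 * K * Y / z ^ n))) with
      ((2 * INR m) ^ 6 * INR m0 ^ 3 * (9 * c ^ 3 * K * Y / z ^ n)) by ring.
    replace (8 ^ 6 * 27 * (9 * c ^ 3 * K * Y) * (INR k ^ 9 / z ^ n)) with
      (8 ^ 6 * 27 * INR k ^ 9 * (9 * c ^ 3 * K * Y / z ^ n)) by (field; apply Rgt_not_eq, Hzp).
    apply Rmult_le_compat_r; auto. apply Rdiv_le_0_compat; auto.
  - apply Rle_trans with (6 ^ 6 * (K * 8 * Y / z ^ 2) + (8 ^ 6 * 27) * (9 * c ^ 3 * K * Y) * / z ^ 2).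
    + apply Rplus_le_compat_l, Rmult_le_compat_l; auto. apply Rmult_le_pos; lra.
    + apply Req_le. field. lra.
Qed.

Lemma sixth_moment_bound_mono Cc eta eta' K : 0 <= K -> eta <= eta' ->
  sixth_moment_bound Cc eta K -> sixth_moment_bound Cc eta' K.
Proof.
  intros HK H HB N Q alpha v Hadm u M b HM Hb.
  eapply Rle_trans; [apply (HB N Q alpha v Hadm u M b HM Hb)|].
  apply Rmult_le_compat_r; [apply pow_le, energy_ge0|]. apply Rmult_le_compat_l; auto.
  apply Rle_Rpower; auto. apply (le_INR 1); lia.
Qed.

(** The scales allow k up to M^(1/(2^n+1)). With k of that size the factor k^(-eta) is a power of M,
    and eta >= eps makes the gain in the exponent independent of eta. *)
Lemma sixth_moment_improve (Cc n : nat) eps eta K : (1 <= Cc)%nat -> 0 < eps <= 1 ->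
  18 <= eps * (INR n - 2) -> eps <= eta <= 3 -> 0 <= K -> sixth_moment_bound (Z.of_nat Cc) eta K ->
  exists K', 0 <= K' /\ sixth_moment_bound (Z.of_nat Cc) (eta - / (INR (2 ^ n + 1)) * eps) K'.
Proof.
  intros HC Heps Hn Heta HK HB.
  set (kap := / INR (2 ^ n + 1)).
  assert (Hp : 0 < INR (2 ^ n + 1)) by (apply lt_0_INR; lia).
  assert (Hkap : 0 < kap) by now apply Rinv_0_lt_compat.
  assert (HC' : 1 <= INR Cc) by (apply (le_INR 1); lia).
  set (B := 8 * 6 ^ 6 + 8 ^ 6 * 27 * 9 * scale_cst (INR Cc) n ^ 3).
  assert (HB0 : 1 <= B).
  { destruct (scale_cst_mono (INR Cc) n n HC') as [H _]; [lia|].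
    assert (0 <= scale_cst (INR Cc) n ^ 3) by (apply pow_le; lra). unfold B. lra. }
  (* [B] is the constant of one step; 8 = 2^3 pays for rounding [X] down to [k >= X / 2], as eta <=
     3. *)
  exists (8 * B * K). split; [apply Rmult_le_pos; lra|].
  intros N Q alpha v Hadm u M b HM Hb.
  assert (HM' : 1 <= INR M) by (apply (le_INR 1); lia).
  set (X := Rpower (INR M) kap).
  assert (HX1 : 1 <= X) by (apply Rpower_ge_1; lra).
  assert (HXe : Rpower (INR M) eta = Rpower (INR M) (eta - kap * eps) * Rpower X eps).
  { unfold X. rewrite Rpower_mult, <- Rpower_plus. f_equal. ring. }
  set (Y := Rpower (INR M) (eta - kap * eps)) in *.
  assert (HY : 0 < Y) by apply Rpower_pos.
  (* For X < 2 no [k >= 2] is available, but the gain sought is then at most 2 and goes into the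
     constant. *)
  destruct (Rlt_dec X 2) as [HX|HX].
  - eapply Rle_trans; [apply (HB N Q alpha v Hadm u M b HM Hb)|].
    apply Rmult_le_compat_r; [apply pow_le, energy_ge0|]. rewrite HXe.
    assert (Rpower X eps <= 2).
    { eapply Rle_trans; [apply (Rpower_le_pow X eps 1); auto; simpl; lra|]. simpl; lra. }
    replace (8 * B * K * Y) with (K * (Y * (8 * B))) by ring.
    apply Rmult_le_compat_l; auto. apply Rmult_le_compat_l; lra.
  - destruct (nfloor_ex X) as [k [Hk1 Hk2]]; [lra|].
    assert (Hk : (2 <= k)%nat).
    { apply INR_le. simpl (INR 2). destruct (le_lt_dec 2 k) as [H|H]; [apply (le_INR 2) in H; simpl in H; lra|].
      assert (INR k <= 1) by (apply (le_INR k 1); lia). lra. }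
    assert (Hk' : 2 <= INR k) by (apply (le_INR 2); lia).
    assert (HkM : INR k ^ (2 ^ n + 1) <= INR M).
    { apply Rle_trans with (X ^ (2 ^ n + 1)); [apply pow_incr; lra|].
      rewrite <- Rpower_pow by lra. unfold X. rewrite Rpower_mult. unfold kap. rewrite Rinv_l by lra.
      rewrite Rpower_1; lra. }
    eapply Rle_trans; [apply (sixth_step Cc N Q alpha v n k u M b eta K); auto|].
    { lra. } { nra. }
    apply Rmult_le_compat_r; [apply pow_le, energy_ge0|]. fold B. rewrite HXe.
    assert (Hke : Rpower X eps <= 8 * Rpower (INR k) eta).
    { apply Rle_trans with (Rpower X eta); [apply Rle_Rpower; lra|].
      apply Rle_trans with (Rpower (2 * INR k) eta); [apply Rle_Rpower_l; lra|].
      rewrite <- Rpower_mult_distr by lra. apply Rmult_le_compat_r; [left; apply Rpower_pos|].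
      replace 8 with (2 ^ 3) by ring. apply Rpower_le_pow; simpl; lra. }
    pose proof (Rpower_pos (INR k) eta) as Hpk.
    apply Rmult_le_reg_r with (Rpower (INR k) eta); auto.
    replace (B * K * (Y * Rpower X eps) / Rpower (INR k) eta * Rpower (INR k) eta)
      with (B * K * Y * Rpower X eps) by (field; lra).
    replace (8 * B * K * Y * Rpower (INR k) eta) with (B * K * Y * (8 * Rpower (INR k) eta)) by ring.
    apply Rmult_le_compat_l; auto. repeat apply Rmult_le_pos; lra.
Qed.

(** The start is the trivial exponent 3. Since [n] is fixed by eps, every round lowers the exponent
    by the same [d], and finitely many rounds suffice. *)
Theorem sixth_moment (Cc : nat) eps : (1 <= Cc)%nat -> 0 < eps ->
  exists K, 0 <= K /\ sixth_moment_bound (Z.of_nat Cc) eps K.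
Proof.
  intros HC Heps0. set (e := Rmin eps 1).
  assert (He : 0 < e <= 1) by (unfold e; pose proof (Rmin_r eps 1); split; auto; apply Rmin_glb_lt; lra).
  destruct (nfloor_ex (18 / e)) as [n0 [_ Hn0]]; [left; apply Rdiv_lt_0_compat; lra|].
  set (n := (n0 + 3)%nat).
  assert (Hn : 18 <= e * (INR n - 2)).
  { unfold n. rewrite plus_INR. simpl (INR 3).
    apply Rmult_lt_compat_l with (r := e) in Hn0; [|lra].
    replace (e * (18 / e)) with 18 in Hn0 by (field; lra). lra. }
  set (d := / INR (2 ^ n + 1) * e).
  assert (Hd : 0 < d).
  { apply Rmult_lt_0_compat; [apply Rinv_0_lt_compat, lt_0_INR; lia|lra]. }
  assert (Hj : forall j : nat, exists K, 0 <= K /\ sixth_moment_bound (Z.of_nat Cc) (Rmax e (3 - INR j * d)) K).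
  { induction j as [|j [K [HK HB]]].
    - exists 1. split; [lra|]. simpl INR. replace (3 - 0 * d) with 3 by ring. rewrite Rmax_right by lra.
      intros N Q alpha v Hadm u M b HM Hb.
      replace (Rpower (INR M) 3) with (INR M ^ 3).
      + rewrite Rmult_1_l. now apply (sixth_trivial (Z.of_nat Cc) N Q alpha v Hadm u).
      + rewrite <- Rpower_pow by (apply lt_0_INR; lia). simpl INR. f_equal. ring.
    - rewrite S_INR. destruct (Rle_dec e (3 - INR j * d)) as [H|H].
      + rewrite Rmax_right in HB by auto.
        destruct (sixth_moment_improve Cc n e (3 - INR j * d) K) as [K' [HK' HB']]; auto.
        { split; auto. pose proof (pos_INR j). nra. }
        exists K'. split; auto. eapply sixth_moment_bound_mono; [auto| |exact HB'].
        eapply Rle_trans; [|apply Rmax_r]. apply Req_le. unfold d. ring.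
      + exists K. split; auto. rewrite Rmax_left in HB by lra. rewrite Rmax_left by lra. auto. }
  destruct (nfloor_ex (3 / d)) as [j [_ Hjd]]; [left; apply Rdiv_lt_0_compat; lra|].
  destruct (Hj (S j)) as [K [HK HB]]. exists K. split; auto.
  rewrite Rmax_left in HB.
  - eapply sixth_moment_bound_mono; [auto|apply Rmin_l|exact HB].
  - rewrite S_INR. apply Rmult_lt_compat_r with (r := d) in Hjd; [|lra].
    replace (3 / d * d) with 3 in Hjd by (field; lra). lra.
Qed.

(** * The maximal function *)

Lemma expsum_csum N a b t x :
  expsum N a b t x = csum (seq 1 N) (fun n => Cmult (b n) (e (x * INR n / INR N + t * a n))).
Proof. reflexivity. Qed.

Lemma expsum_mod_le N a b t x : Cmod (expsum N a b t x) <= rsum (seq 1 N) (fun n => Cmod (b n)).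
Proof.
  rewrite expsum_csum. eapply Rle_trans; [apply csum_mod|]. apply rsum_le; intros n _.
  rewrite Cmod_mult, Cmod_e. lra.
Qed.

(** [real] would send an infinite supremum to 0, so finiteness comes first; it follows from the
    trivial bound by the sum of the |b_n|. *)
Lemma maxfun_lub N a b t :
  (forall x, 0 <= x <= INR N -> Cmod (expsum N a b t x) <= maxfun N a b t) /\
  (forall M, (forall x, 0 <= x <= INR N -> Cmod (expsum N a b t x) <= M) -> maxfun N a b t <= M).
Proof.
  unfold maxfun. set (E := fun y => exists x, 0 <= x <= INR N /\ y = Cmod (expsum N a b t x)).
  destruct (Lub_Rbar_correct E) as [Hub Hlub].
  assert (H0 : E (Cmod (expsum N a b t 0))) by (exists 0; split; auto; split; [lra|apply pos_INR]).
  set (B := rsum (seq 1 N) (fun n => Cmod (b n))).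
  assert (HB : Rbar_le (Lub_Rbar E) B).
  { apply Hlub. intros y [x [_ ->]]. apply expsum_mod_le. }
  assert (Hfin : is_finite (Lub_Rbar E)).
  { specialize (Hub _ H0). destruct (Lub_Rbar E); simpl in *; easy. }
  split.
  - intros x Hx. assert (Hy : E (Cmod (expsum N a b t x))) by (exists x; auto).
    specialize (Hub _ Hy). rewrite <- Hfin in Hub. exact Hub.
  - intros M HM. assert (HM' : Rbar_le (Lub_Rbar E) M).
    { apply Hlub. intros y [x [Hx ->]]. apply HM; auto. }
    rewrite <- Hfin in HM'. exact HM'.
Qed.

Lemma maxfun_ge0 N a b t : 0 <= maxfun N a b t.
Proof.
  destruct (maxfun_lub N a b t) as [H _]. eapply Rle_trans; [|apply (H 0)].
  - apply Cmod_ge_0.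
  - split; [lra|apply pos_INR].
Qed.

Lemma Rabs_sin_le x : Rabs (sin x) <= Rabs x.
Proof.
  assert (H : forall y, 0 <= y -> Rabs (sin y) <= y).
  { intros y Hy. destruct (Req_dec y 0) as [->|]; [rewrite sin_0, Rabs_R0; lra|].
    pose proof (sin_lt_x y ltac:(lra)). destruct (Rle_dec y 1).
    - rewrite Rabs_right; [lra|]. apply Rle_ge, sin_ge_0; pose proof PI_RGT_0; pose proof PI2_1; lra.
    - pose proof (SIN_bound y). apply Rabs_le; lra. }
  destruct (Rle_dec 0 x); [rewrite (Rabs_right x) by lra; auto|].
  rewrite <- (Rabs_Ropp (sin x)), <- sin_neg, (Rabs_left x) by lra. apply H; lra.
Qed.

Lemma e_lipschitz u v : Cmod (Cminus (e u) (e v)) <= 2 * PI * Rabs (u - v).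
Proof.
  assert (E : Cmod (Cminus (e u) (e v)) ^ 2 = (2 * Rabs (sin (PI * (u - v)))) ^ 2).
  { rewrite Cmod_sq, Rpow_mult_distr, pow2_abs. unfold e, Cminus, Cplus, Copp, Re, Im; simpl.
    assert (H : cos (2 * PI * u - 2 * PI * v) = 1 - 2 * sin (PI * (u - v)) * sin (PI * (u - v))).
    { rewrite <- cos_2a_sin. f_equal. ring. }
    rewrite cos_minus in H. pose proof (sin2_cos2 (2 * PI * u)). pose proof (sin2_cos2 (2 * PI * v)).
    unfold Rsqr in *. nra. }
  apply Rle_trans with (2 * Rabs (sin (PI * (u - v)))).
  - apply Req_le. apply Rsqr_inj; rewrite ?Rsqr_pow2; auto; [apply Cmod_ge_0|].
    pose proof (Rabs_pos (sin (PI * (u - v)))). lra.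
  - pose proof (Rabs_sin_le (PI * (u - v))) as H. rewrite Rabs_mult in H.
    rewrite (Rabs_right PI) in H by (pose proof PI_RGT_0; lra). lra.
Qed.

(** The sums are Lipschitz in [t] uniformly in [x], and a supremum inherits this. The resulting
    continuity makes the powers of [maxfun] Riemann integrable, without which [RInt] carries no
    information. *)
Lemma maxfun_lipschitz N a b : exists C, 0 <= C /\
  forall t s, maxfun N a b t <= maxfun N a b s + C * Rabs (t - s).
Proof.
  set (C := rsum (seq 1 N) (fun n => Cmod (b n) * (2 * PI * Rabs (a n)))).
  pose proof PI_RGT_0. exists C. split.
  { apply rsum_ge0; intros n _. pose proof (Cmod_ge_0 (b n)). pose proof (Rabs_pos (a n)).
    apply Rmult_le_pos; auto. apply Rmult_le_pos; lra. }
  intros t s. apply (proj2 (maxfun_lub N a b t)). intros x Hx.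
  pose proof (proj1 (maxfun_lub N a b s) x Hx) as Hs.
  assert (Hd : Cmod (Cminus (expsum N a b t x) (expsum N a b s x)) <= C * Rabs (t - s)).
  { replace (Cminus (expsum N a b t x) (expsum N a b s x)) with
      (csum (seq 1 N) (fun n => Cmult (b n) (Cminus (e (x * INR n / INR N + t * a n)) (e (x * INR n / INR N + s * a n))))).
    - eapply Rle_trans; [apply csum_mod|]. unfold C. rewrite <- rsum_scal_r. apply rsum_le; intros n _.
      rewrite Cmod_mult, Rmult_assoc. apply Rmult_le_compat_l; [apply Cmod_ge_0|].
      eapply Rle_trans; [apply e_lipschitz|].
      replace (x * INR n / INR N + t * a n - (x * INR n / INR N + s * a n)) with (a n * (t - s)) by ring.
      rewrite Rabs_mult. lra.
    - rewrite !expsum_csum.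
      rewrite (csum_ext _ _ (fun n => Cplus (Cmult (b n) (e (x * INR n / INR N + t * a n)))
         (Cmult (RtoC (-1)) (Cmult (b n) (e (x * INR n / INR N + s * a n)))))).
      + rewrite csum_plus, csum_scal. unfold Cminus. f_equal. ring.
      + intros n _. replace (RtoC (-1)) with (Copp (RtoC 1)) by (unfold Copp, RtoC; simpl; f_equal; ring). ring. }
  replace (expsum N a b t x) with (Cplus (Cminus (expsum N a b t x) (expsum N a b s x)) (expsum N a b s x)) by ring.
  eapply Rle_trans; [apply Cmod_triangle|]. lra.
Qed.

Lemma maxfun_continuous N a b t : continuous (maxfun N a b) t.
Proof.
  destruct (maxfun_lipschitz N a b) as [C [HC H]].
  apply continuity_pt_filterlim. intros eps Heps. exists (eps / (C + 1)). split.
  - apply Rdiv_lt_0_compat; lra.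
  - intros s [_ Hs]. simpl in *. unfold R_dist in *.
    assert (Hs' : C * Rabs (s - t) < eps).
    { apply Rle_lt_trans with ((C + 1) * Rabs (s - t)); [pose proof (Rabs_pos (s - t)); nra|].
      apply Rlt_le_trans with ((C + 1) * (eps / (C + 1))); [apply Rmult_lt_compat_l; lra|].
      apply Req_le; field; lra. }
    pose proof (H s t) as H1. pose proof (H t s) as H2. rewrite (Rabs_minus_sym t s) in H2.
    apply Rabs_def1; lra.
Qed.

Lemma maxfun_pow_continuous N a b n t : continuous (fun t => maxfun N a b t ^ n) t.
Proof.
  induction n as [|n IH]; simpl; [apply continuous_const|].
  apply (continuous_mult (maxfun N a b) (fun t => maxfun N a b t ^ n)); auto. apply maxfun_continuous.
Qed.

Lemma ex_RInt_maxfun N a b n u w : ex_RInt (fun t => maxfun N a b t ^ n) u w.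
Proof. apply (@ex_RInt_continuous R_CompleteNormedModule). intros; apply maxfun_pow_continuous. Qed.

Lemma is_RInt_rsum {A} (l : list A) (f : A -> R -> R) (I : A -> R) u w :
  (forall x, In x l -> is_RInt (f x) u w (I x)) -> is_RInt (fun t => rsum l (fun x => f x t)) u w (rsum l I).
Proof.
  induction l as [|x l IH]; intros H.
  - unfold rsum; simpl. pose proof (@is_RInt_const R_NormedModule u w 0) as H0. 
    change (is_RInt (fun _ => 0) u w ((w - u) * 0)) in H0. rewrite Rmult_0_r in H0. exact H0.
  - apply (is_RInt_ext (fun t => plus (f x t) (rsum l (fun x => f x t)))).
    + intros. reflexivity.
    + rewrite rsum_cons. apply (is_RInt_plus (V := R_NormedModule)); auto with datatypes.
Qed.

(** The integrand is a combination p cos + q sin with |p| and |q| at most |c c'|. The trivial bound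
    serves nearby frequencies; the explicit primitive gives a constant 3/(2 pi) < 1 for the
    others. *)
Lemma dot_oscillation (c c' : C) lam lam' T : 0 <= T ->
  exists I, is_RInt (fun t => dot (Cmult c (e (t * lam))) (Cmult c' (e (t * lam')))) 0 T I /\
    Rabs I <= Cmod c * Cmod c' * T /\
    (lam <> lam' -> Rabs I <= Cmod c * Cmod c' / Rabs (lam - lam')).
Proof.
  intros HT. set (mu := lam - lam'). set (p := dot c c'). set (q := Re c * Im c' - Im c * Re c').
  assert (Hpq : p ^ 2 + q ^ 2 = (Cmod c * Cmod c') ^ 2).
  { rewrite Rpow_mult_distr, !Cmod_sq. unfold p, q, dot. ring. }
  set (w := Cmod c * Cmod c'). assert (Hw : 0 <= w) by (apply Rmult_le_pos; apply Cmod_ge_0).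
  assert (Hp : Rabs p <= w). { apply Rsqr_incr_0; rewrite ?Rsqr_pow2, ?pow2_abs; [fold w in Hpq; nra|apply Rabs_pos|auto]. }
  assert (Hq : Rabs q <= w). { apply Rsqr_incr_0; rewrite ?Rsqr_pow2, ?pow2_abs; [fold w in Hpq; nra|apply Rabs_pos|auto]. }
  set (f := fun t => p * cos (2 * PI * mu * t) + q * sin (2 * PI * mu * t)).
  assert (Hf : forall t, dot (Cmult c (e (t * lam))) (Cmult c' (e (t * lam'))) = f t).
  { intros t. unfold f, p, q, dot, mu, e, Cmult, Re, Im; simpl.
    replace (2 * PI * (lam - lam') * t) with (2 * PI * (t * lam) - 2 * PI * (t * lam')) by ring.
    rewrite cos_minus, sin_minus. ring. }
  assert (Hc : forall t, continuous f t).
  { intros t. apply (ex_derive_continuous (K := R_AbsRing) (V := R_NormedModule)). unfold f. auto_derive; auto. }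
  assert (Hex : ex_RInt f 0 T) by (apply (@ex_RInt_continuous R_CompleteNormedModule); auto).
  exists (RInt f 0 T). split; [|split].
  - apply is_RInt_ext with f; [intros; now rewrite Hf|]. now apply (@RInt_correct R_CompleteNormedModule).
  - rewrite <- (Rminus_0_r T) at 2. rewrite Rmult_comm. apply abs_RInt_le_const; auto.
    intros t _. rewrite <- Hf. unfold dot. 
    pose proof (Cmod_mult c (e (t * lam))) as H1. pose proof (Cmod_mult c' (e (t * lam'))) as H2.
    rewrite Cmod_e, Rmult_1_r in H1, H2. unfold w. rewrite <- H1, <- H2.
    set (z := Cmult c (e (t * lam))). set (z' := Cmult c' (e (t * lam'))).
    apply Rsqr_incr_0; [|apply Rabs_pos|apply Rmult_le_pos; apply Cmod_ge_0].
    rewrite !Rsqr_pow2, pow2_abs, Rpow_mult_distr, !Cmod_sq.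
    pose proof (pow2_ge_0 (Re z * Im z' - Im z * Re z')). nra.
  - intros Hne. assert (Hmu : mu <> 0) by (unfold mu; lra). pose proof PI_RGT_0.
    set (G := fun t => (p * sin (2 * PI * mu * t) - q * cos (2 * PI * mu * t)) / (2 * PI * mu)).
    assert (HI : is_RInt f 0 T (minus (G T) (G 0))).
    { apply (is_RInt_derive (V := R_CompleteNormedModule)).
      - intros t _. unfold G, f. auto_derive; auto. field. split; lra.
      - intros t _. apply Hc. }
    rewrite (is_RInt_unique _ _ _ _ HI). unfold minus, plus, opp, G; simpl.
    rewrite Rmult_0_r, sin_0, cos_0.
    set (th := 2 * PI * mu * T).
    replace ((p * sin th - q * cos th) / (2 * PI * mu) + - ((p * 0 - q * 1) / (2 * PI * mu)))
      with ((p * sin th + q * (1 - cos th)) * / (2 * PI) * / mu) by (field; split; lra).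
    rewrite (Rabs_mult _ (/ mu)), (Rabs_mult _ (/ (2 * PI))), !Rabs_inv, (Rabs_right (2 * PI)) by lra. unfold Rdiv. apply Rmult_le_compat_r.
    { left. now apply Rinv_0_lt_compat, Rabs_pos_lt. }
    assert (Hs : Rabs (p * sin th + q * (1 - cos th)) <= 3 * w).
    { eapply Rle_trans; [apply Rabs_triang|]. rewrite !Rabs_mult.
      assert (Rabs (sin th) <= 1) by (apply Rabs_le; apply SIN_bound).
      assert (Rabs (1 - cos th) <= 2) by (apply Rabs_le; pose proof (COS_bound th); lra).
      assert (Rabs p * Rabs (sin th) <= w * 1) by (apply Rmult_le_compat; auto using Rabs_pos).
      assert (Rabs q * Rabs (1 - cos th) <= w * 2) by (apply Rmult_le_compat; auto using Rabs_pos). lra. }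
    apply Rmult_le_reg_r with (2 * PI); [lra|]. rewrite Rmult_assoc, Rinv_l, Rmult_1_r by lra.
    pose proof PI2_1. fold w. nra.
Qed.

(** * Rounding of convex sequences *)

(** The convexity in [admissible] concerns all indices, 0 and those beyond [N] included. The
    sequence is prolonged on both sides with second difference 1. *)
Lemma convex_extension N (A : nat -> R) : (1 <= N)%nat ->
  (forall n, (1 <= n)%nat -> (n + 2 <= N)%nat -> / 4 <= A (S (S n)) - 2 * A (S n) + A n <= 4) ->
  exists B : nat -> R, (forall n, (1 <= n <= N)%nat -> B n = A n) /\
    (forall n, / 4 <= B (S (S n)) - 2 * B (S n) + B n <= 4).
Proof.
  intros HN HA. set (d := if le_lt_dec 2 N then A N - A (N - 1)%nat else 0).
  set (B1 := fun n => if le_lt_dec n N then A n else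
      A N + INR (n - N) * d + INR (n - N) * (INR (n - N) + 1) / 2).
  set (B := fun n => match n with O => 1 + 2 * B1 1%nat - B1 2%nat | _ => B1 n end).
  exists B. split.
  - intros n Hn. destruct n as [|n]; [lia|]. unfold B, B1. destruct (le_lt_dec (S n) N); [reflexivity|lia].
  - intros n. destruct n as [|n]; [unfold B; lra|]. unfold B.
    destruct (le_lt_dec (S n + 2) N) as [H|H].
    { unfold B1. destruct (le_lt_dec (S (S (S n))) N); [|lia]. destruct (le_lt_dec (S (S n)) N); [|lia].
      destruct (le_lt_dec (S n) N); [|lia]. apply HA; lia. }
    assert (Hout : forall j, B1 (N + j)%nat = A N + INR j * d + INR j * (INR j + 1) / 2).
    { intros j. unfold B1. destruct (le_lt_dec (N + j) N).
      - replace j with O by lia. rewrite Nat.add_0_r. simpl. lra.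
      - replace (N + j - N)%nat with j by lia. reflexivity. }
    destruct (le_lt_dec N (S n)) as [H1|H1].
    + set (j := (S n - N)%nat). replace (S (S (S n))) with (N + (j + 2))%nat by lia.
      replace (S (S n)) with (N + (j + 1))%nat by lia. replace (S n) with (N + j)%nat by lia.
      rewrite !Hout, !plus_INR. simpl (INR 2). simpl (INR 1). nra.
    + assert (E : S (S n) = N) by lia.
      replace (S (S (S n))) with (N + 1)%nat by lia. replace (S (S n)) with (N + 0)%nat by lia.
      rewrite !Hout. replace (B1 (S n)) with (A (N - 1)%nat).
      * unfold d. destruct (le_lt_dec 2 N); [|lia]. simpl (INR 1). simpl (INR 0). lra.
      * unfold B1. destruct (le_lt_dec (S n) N); [|lia]. f_equal. lia.
Qed.

(** The factor 16 brings the second differences between 4 and 64. Rounding down three values moves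
    them by less than 2, so they remain positive. *)
Lemma convex_rounding N a : (1 <= N)%nat -> uniformly_convex N a ->
  exists alpha : nat -> Z,
    (forall n, (1 <= alpha (S (S n)) - 2 * alpha (S n) + alpha n <= 66)%Z) /\
    (forall n, (1 <= n <= N)%nat -> 0 <= 16 * (INR N ^ 2 * a n) - IZR (alpha n) < 1).
Proof.
  intros HN [_ Ha]. assert (HN' : 1 <= INR N) by (apply (le_INR 1); lia).
  assert (HN2 : 0 < INR N ^ 2) by (apply pow_lt; lra).
  destruct (convex_extension N (fun n => INR N ^ 2 * a n) HN) as [B [HB1 HB2]].
  { intros n H1 H2. specialize (Ha n H1 H2). rewrite Rinv_mult in Ha.
    assert (Hl := Rmult_le_compat_l (INR N ^ 2) _ _ (Rlt_le _ _ HN2) (proj1 Ha)).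
    assert (Hr := Rmult_le_compat_l (INR N ^ 2) _ _ (Rlt_le _ _ HN2) (proj2 Ha)).
    replace (INR N ^ 2 * (/ 4 * / INR N ^ 2)) with (/ 4) in Hl by (field; lra).
    replace (INR N ^ 2 * (4 / INR N ^ 2)) with 4 in Hr by (field; lra). lra. }
  exists (fun n => Int_part (16 * B n)).
  assert (Hfl : forall n, 0 <= 16 * B n - IZR (Int_part (16 * B n)) < 1).
  { intros n. destruct (base_Int_part (16 * B n)). lra. }
  split.
  - intros n. pose proof (Hfl n) as F0. pose proof (Hfl (S n)) as F1. pose proof (Hfl (S (S n))) as F2. specialize (HB2 n).
    set (z2 := Int_part (16 * B (S (S n)))) in *. set (z1 := Int_part (16 * B (S n))) in *. set (z0 := Int_part (16 * B n)) in *.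
    assert (E : IZR (z2 - 2 * z1 + z0) = IZR z2 - 2 * IZR z1 + IZR z0) by (rewrite plus_IZR, minus_IZR, mult_IZR; reflexivity).
    assert (H1 : (0 < z2 - 2 * z1 + z0)%Z) by (apply lt_IZR; rewrite E; lra).
    assert (H2 : (z2 - 2 * z1 + z0 < 67)%Z) by (apply lt_IZR; rewrite E; lra). lia.
  - intros n Hn. rewrite <- HB1 by auto. apply Hfl.
Qed.

Lemma Z_bounded (f : nat -> Z) N : exists B, (0 <= B)%Z /\ forall n, (n < N)%nat -> (- B <= f n <= B)%Z.
Proof.
  induction N as [|N [B [HB IH]]]; [exists 0%Z; split; lia|].
  exists (B + Z.abs (f N))%Z. split; [lia|]. intros n Hn.
  destruct (Nat.eq_dec n N) as [->|]; [lia|]. specialize (IH n ltac:(lia)). lia.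
Qed.

(** If |alpha| <= B below [N], two sums of three values differ by at most 6B < [H], so an equation
    between sums of [v] forces the index equation and then the one for [alpha]. [S0] leaves room in
    [Q] for later shifts of the frequencies. *)
Lemma admissible_exists Cc (alpha : nat -> Z) (N S0 : nat) :
  (forall n, (1 <= alpha (S (S n)) - 2 * alpha (S n) + alpha n <= Cc)%Z) ->
  exists (H : Z) (Q : nat), let v := fun n => (alpha n + H * Z.of_nat n)%Z in
    admissible Cc N Q alpha v /\
    forall n1 n2 n3 n4 n5 n6,
     (n1 < N)%nat -> (n2 < N)%nat -> (n3 < N)%nat -> (n4 < N)%nat -> (n5 < N)%nat -> (n6 < N)%nat ->
     (Z.abs (v n1 + v n2 + v n3 - (v n4 + v n5 + v n6)) + Z.of_nat S0 < Z.of_nat Q)%Z.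
Proof.
  intros Hc. destruct (Z_bounded alpha N) as [B [HB HBn]]. set (H := (6 * B + 1)%Z).
  set (v := fun n => (alpha n + H * Z.of_nat n)%Z).
  destruct (Z_bounded v N) as [B' [HB' HBv]].
  exists H, (Z.to_nat (6 * B' + 1 + Z.of_nat S0)). cbv zeta. fold v.
  assert (HQ : forall n1 n2 n3 n4 n5 n6,
     (n1 < N)%nat -> (n2 < N)%nat -> (n3 < N)%nat -> (n4 < N)%nat -> (n5 < N)%nat -> (n6 < N)%nat ->
     (Z.abs (v n1 + v n2 + v n3 - (v n4 + v n5 + v n6)) + Z.of_nat S0 < Z.of_nat (Z.to_nat (6 * B' + 1 + Z.of_nat S0)))%Z).
  { intros n1 n2 n3 n4 n5 n6 h1 h2 h3 h4 h5 h6.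
    apply HBv in h1; apply HBv in h2; apply HBv in h3; apply HBv in h4; apply HBv in h5; apply HBv in h6. lia. }
  split; [|exact HQ]. split; [lia|]. split; [exact Hc|].
  intros n1 n2 n3 n4 n5 n6 h1 h2 h3 h4 h5 h6. split.
  { specialize (HQ n1 n2 n3 n4 n5 n6 h1 h2 h3 h4 h5 h6). lia. }
  unfold v. intros E. apply HBn in h1; apply HBn in h2; apply HBn in h3; apply HBn in h4; apply HBn in h5; apply HBn in h6.
  set (dz := (Z.of_nat n1 + Z.of_nat n2 + Z.of_nat n3 - (Z.of_nat n4 + Z.of_nat n5 + Z.of_nat n6))%Z).
  assert (E' : (H * dz = alpha n4 + alpha n5 + alpha n6 - (alpha n1 + alpha n2 + alpha n3))%Z) by (unfold dz; lia).
  assert (Hd : dz = 0%Z).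
  { destruct (Z.eq_dec dz 0) as [|Hnz]; auto. exfalso.
    assert (Hab : (- (6 * B) <= H * dz <= 6 * B)%Z) by (rewrite E'; lia). clear - Hab Hnz HB. unfold H in *. nia. }
  rewrite Hd in E'. unfold dz in Hd. lia.
Qed.

(** * Triples of indices and approximate solutions *)

Definition triples (N : nat) : list (nat * nat * nat) := list_prod (list_prod (seq 1 N) (seq 1 N)) (seq 1 N).
Definition tsum (f : nat -> Z) (p : nat * nat * nat) : Z := (f (fst (fst p)) + f (snd (fst p)) + f (snd p))%Z.
Definition ksum (p : nat * nat * nat) : nat := (fst (fst p) + snd (fst p) + snd p)%nat.
Definition rsum3 (f : nat -> R) (p : nat * nat * nat) : R := f (fst (fst p)) + f (snd (fst p)) + f (snd p).
Definition prod3 (f : nat -> R) (p : nat * nat * nat) : R := f (fst (fst p)) * f (snd (fst p)) * f (snd p).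
Definition cprod3 (f : nat -> C) (p : nat * nat * nat) : C := Cmult (Cmult (f (fst (fst p))) (f (snd (fst p)))) (f (snd p)).

Lemma in_triples N p : In p (triples N) ->
  (1 <= fst (fst p) <= N)%nat /\ (1 <= snd (fst p) <= N)%nat /\ (1 <= snd p <= N)%nat.
Proof. destruct p as [[n1 n2] n3]. unfold triples. rewrite !in_prod_iff, !in_seq. simpl. lia. Qed.

(* Solutions with a prescribed discrepancy [s] are at most as many as exact solutions, since shifting by [s] only modulates one factor of |F|^6. *)
Lemma shell_le_sixth Cc N Q alpha v H b s :
  admissible Cc (S N) Q alpha v -> (forall n, v n = (alpha n + H * Z.of_nat n)%Z) ->
  (forall p p', In p (triples N) -> In p' (triples N) -> (Z.abs (tsum v p - tsum v p') + Z.abs s < Z.of_nat Q)%Z) ->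
  (forall n, 0 <= b n) -> b 0%nat = 0 ->
  rsum (triples N) (fun p => rsum (triples N) (fun p' =>
     if (Nat.eqb (ksum p) (ksum p') && Z.eqb (tsum alpha p - tsum alpha p') s)%bool then prod3 b p * prod3 b p' else 0))
  <= sixth (S N) Q v b.
Proof.
  intros Hadm Hv HQ Hb Hb0.
  assert (Hp : forall p, 0 <= prod3 b p) by (intros; unfold prod3; repeat apply Rmult_le_pos; auto).
  assert (HT : forall x, trigpoly (triples N) (prod3 b) (tsum v) x = Cmult (Cmult (expo (S N) v b x) (expo (S N) v b x)) (expo (S N) v b x)).
  (* [expo] starts at index 0 and [triples] at 1; the coefficient at 0 vanishes. *)
  { intros x. replace (expo (S N) v b x) with (trigpoly (seq 1 N) b v x).
    - rewrite !trigpoly_mult. reflexivity.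
    - unfold expo, trigpoly. simpl seq. rewrite csum_cons, Hb0. ring. }
  apply Rle_trans with (rsum (triples N) (fun p => rsum (triples N) (fun p' =>
     if Z.eqb (tsum v p) (tsum v p' + s) then prod3 b p * prod3 b p' else 0))).
  - apply rsum_le; intros p _. apply rsum_le; intros p' _. pose proof (Hp p). pose proof (Hp p').
    assert (0 <= prod3 b p * prod3 b p') by now apply Rmult_le_pos.
    destruct (Nat.eqb_spec (ksum p) (ksum p')) as [E|]; [|simpl; destruct Z.eqb; lra].
    destruct (Z.eqb_spec (tsum alpha p - tsum alpha p') s) as [E'|]; [|simpl; destruct Z.eqb; lra]. simpl.
    destruct (Z.eqb_spec (tsum v p) (tsum v p' + s)) as [|Hne]; [lra|]. exfalso. apply Hne.
    unfold tsum, ksum in *. rewrite !Hv. apply (f_equal Z.of_nat) in E. rewrite !Nat2Z.inj_add in E. 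
    apply (f_equal (Z.mul H)) in E. lia.
  - rewrite <- (parseval (triples N) (triples N) (prod3 b) (prod3 b) (tsum v) (fun p => (tsum v p + s)%Z) Q).
    + apply avg_le; intros x.
      replace (trigpoly (triples N) (prod3 b) (fun p => (tsum v p + s)%Z) x)
        with (Cmult (trigpoly (triples N) (prod3 b) (tsum v) x) (e (IZR s * x))).
      * unfold dot. eapply Rle_trans; [apply Re_mult_conj_le|].
        rewrite Cmod_mult, Cmod_e, HT, !Cmod_mult. apply Req_le. field.
      * unfold trigpoly. rewrite <- csum_scal_r. apply csum_ext; intros p _.
        rewrite plus_IZR, Rmult_plus_distr_r, e_plus. ring.
    + apply Hadm.
    + intros p p' Hin Hin'. specialize (HQ p p' Hin Hin'). lia.
Qed.

Lemma rsum_inv_le_ln S0 : rsum (seq 0 (S S0)) (fun m => / (1 + INR m)) <= 1 + ln (1 + INR S0).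
Proof.
  induction S0 as [|S0 IH].
  - unfold rsum; simpl. rewrite !Rplus_0_r, ln_1, Rinv_1. lra.
  - rewrite seq_S, rsum_app. unfold rsum at 2. cbn [map fold_right]. rewrite Nat.add_0_l.
    set (x := 1 + INR S0) in *. pose proof (pos_INR S0).
    replace (1 + INR (S S0)) with (x + 1) by (unfold x; rewrite S_INR; ring).
    assert (Hx : 1 <= x) by (unfold x; lra).
    assert (Hln : ln (x / (x + 1)) <= x / (x + 1) - 1).
    { assert (Hpos : 0 < x / (x + 1)) by (apply Rdiv_lt_0_compat; lra).
      pose proof (exp_ineq1_le (ln (x / (x + 1)))) as He. rewrite exp_ln in He by auto. lra. }
    unfold Rdiv in Hln. rewrite ln_mult, ln_Rinv in Hln; try lra; [|apply Rinv_0_lt_compat; lra].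
    replace (x * / (x + 1) - 1) with (- / (x + 1)) in Hln by (field; lra). lra.
Qed.

(** * The upper bound *)

Definition pair_term (a : nat -> R) (b : nat -> C) (p p' : nat * nat * nat) (t : R) : R :=
  if Nat.eqb (ksum p) (ksum p')
  then dot (Cmult (cprod3 b p) (e (t * rsum3 a p))) (Cmult (cprod3 b p') (e (t * rsum3 a p')))
  else 0.

(** By orthogonality in x, this is the mean of |F(x,t)|^6 over x in [0,N]. *)
Definition cube_mass (N : nat) (a : nat -> R) (b : nat -> C) (t : R) : R :=
  rsum (triples N) (fun p => rsum (triples N) (fun p' => pair_term a b p p' t)).

Lemma expsum_cube N a b t x :
  Cmult (Cmult (expsum N a b t x) (expsum N a b t x)) (expsum N a b t x) =
  csum (triples N) (fun p => Cmult (cprod3 b p) (e (x * INR (ksum p) / INR N + t * rsum3 a p))).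
Proof.
  rewrite !expsum_csum, <- !csum_list_prod. apply csum_ext; intros [[n1 n2] n3] _.
  unfold cprod3, ksum, rsum3; simpl. rewrite !plus_INR.
  replace (x * (INR n1 + INR n2 + INR n3) / INR N + t * (a n1 + a n2 + a n3)) with
    ((x * INR n1 / INR N + t * a n1) + (x * INR n2 / INR N + t * a n2) + (x * INR n3 / INR N + t * a n3))
    by (unfold Rdiv; ring).
  rewrite !e_plus. ring.
Qed.

(* The cube is a trigonometric polynomial of degree at most 3N in x, so its supremum is controlled by Cauchy-Schwarz on its 3N+1 coefficients. *)
Lemma expsum_pow6_le N a b t x : Cmod (expsum N a b t x) ^ 6 <= INR (3 * N + 1) * cube_mass N a b t.
Proof.
  set (h := fun k => csum (triples N) (fun p => if Nat.eqb (ksum p) k then Cmult (cprod3 b p) (e (t * rsum3 a p)) else RtoC 0)).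
  set (S := seq 0 (3 * N + 1)).
  assert (Hk : forall p, In p (triples N) -> In (ksum p) S).
  { intros p Hp. apply in_triples in Hp. unfold S, ksum. apply in_seq. lia. }
  assert (E1 : Cmult (Cmult (expsum N a b t x) (expsum N a b t x)) (expsum N a b t x) =
     csum S (fun k => Cmult (e (x * INR k / INR N)) (h k))).
  { rewrite expsum_cube. unfold h.
    rewrite (csum_ext S _ (fun k => csum (triples N) (fun p => if Nat.eqb (ksum p) k then
       Cmult (e (x * INR k / INR N)) (Cmult (cprod3 b p) (e (t * rsum3 a p))) else RtoC 0))).
    - rewrite csum_swap. apply csum_ext; intros p Hp.
      rewrite (csum_indic S (ksum p) (fun k => Cmult (e (x * INR k / INR N)) (Cmult (cprod3 b p) (e (t * rsum3 a p))))); auto.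
      + rewrite e_plus. ring.
      + apply seq_NoDup.
    - intros k _. rewrite <- csum_scal. apply csum_ext; intros p _. destruct Nat.eqb; ring. }
  replace (Cmod (expsum N a b t x) ^ 6) with (Cmod (csum S (fun k => Cmult (e (x * INR k / INR N)) (h k))) ^ 2).
  2:{ rewrite <- E1, !Cmod_mult. ring. }
  apply Rle_trans with (rsum S (fun k => Cmod (h k)) ^ 2).
  { apply pow_incr. split; [apply Cmod_ge_0|]. eapply Rle_trans; [apply csum_mod|].
    apply rsum_le; intros k _. rewrite Cmod_mult, Cmod_e. lra. }
  eapply Rle_trans; [apply rsum_sq_le|]. unfold S at 1. rewrite length_seq.
  apply Rmult_le_compat_l; [apply pos_INR|]. apply Req_le.
  rewrite (rsum_ext S _ (fun k => rsum (triples N) (fun p => rsum (triples N) (fun p' =>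
     if Nat.eqb (ksum p) k then (if Nat.eqb (ksum p') k then
        dot (Cmult (cprod3 b p) (e (t * rsum3 a p))) (Cmult (cprod3 b p') (e (t * rsum3 a p'))) else 0) else 0)))).
  - rewrite rsum_swap. apply rsum_ext; intros p Hp. rewrite rsum_swap. apply rsum_ext; intros p' Hp'.
    rewrite (rsum_indic S (ksum p) (fun k => if Nat.eqb (ksum p') k then
        dot (Cmult (cprod3 b p) (e (t * rsum3 a p))) (Cmult (cprod3 b p') (e (t * rsum3 a p'))) else 0)); auto.
    + unfold pair_term. now rewrite Nat.eqb_sym.
    + apply seq_NoDup.
  - intros k _. rewrite <- dot_self. unfold h. rewrite dot_csum. apply rsum_ext; intros p _. apply rsum_ext; intros p' _.
    destruct (Nat.eqb (ksum p) k); destruct (Nat.eqb (ksum p') k); auto; unfold dot; simpl; ring.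
Qed.

(** [maxfun] is a supremum of moduli rather than of their sixth powers, so the bound has to pass
    through a sixth root. *)
Lemma maxfun_pow6_le N a b t R0 : (forall x, Cmod (expsum N a b t x) ^ 6 <= R0) -> maxfun N a b t ^ 6 <= R0.
Proof.
  intros H. pose proof (maxfun_ge0 N a b t) as Hg.
  assert (HR : 0 <= R0) by (eapply Rle_trans; [|apply (H 0)]; apply pow_le, Cmod_ge_0).
  destruct (Rle_dec (maxfun N a b t ^ 6) R0) as [|Hn]; auto. exfalso.
  assert (Hroot : exists M, 0 <= M /\ M ^ 6 = R0).
  { destruct (Req_dec R0 0) as [->|].
    - exists 0. split; [lra|ring].
    - exists (Rpower R0 (/ 6)). split; [left; apply Rpower_pos|].
      rewrite <- Rpower_pow by apply Rpower_pos. rewrite Rpower_mult.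
      replace (/ 6 * INR 6) with 1 by (simpl; field). apply Rpower_1; lra. }
  destruct Hroot as [M [HM EM]].
  assert (Hle : maxfun N a b t <= M).
  { apply (proj2 (maxfun_lub N a b t)). intros x _. destruct (Rle_dec (Cmod (expsum N a b t x)) M) as [|Hx]; auto.
    exfalso. apply Rnot_le_lt in Hx. specialize (H x). rewrite <- EM in H.
    set (y := Cmod (expsum N a b t x)) in *.
    assert (Hq : forall j, M ^ S j < y ^ S j).
    { induction j as [|j IH]; [simpl; lra|]. change (M * M ^ S j < y * y ^ S j).
      apply Rmult_le_0_lt_compat; auto. apply pow_le; auto. }
    specialize (Hq 5%nat). lra. }
  apply Hn. rewrite <- EM. apply pow_incr; lra.
Qed.

Lemma uniformly_convex_spread N a n m : uniformly_convex N a -> (1 <= n <= N)%nat -> (1 <= m <= N)%nat ->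
  Rabs (a n - a m) <= 4.
Proof.
  intros [Ha _] Hn Hm.
  assert (HN' : 1 <= INR N) by (apply (le_INR 1); lia).
  assert (H : forall n j, (1 <= n)%nat -> (n + j <= N)%nat -> 0 <= a (n + j)%nat - a n <= INR j * (4 / INR N)).
  { intros k j Hk. induction j as [|j IH]; intros Hj.
    - rewrite Nat.add_0_r. simpl. lra.
    - specialize (IH ltac:(lia)). specialize (Ha (k + j)%nat ltac:(lia) ltac:(lia)).
      replace (k + S j)%nat with (S (k + j)) by lia. rewrite S_INR.
      assert (0 < / (4 * INR N)) by (apply Rinv_0_lt_compat; lra). lra. }
  assert (H4 : forall j, (j <= N)%nat -> INR j * (4 / INR N) <= 4).
  { intros j Hj. apply le_INR in Hj. replace 4 with (INR N * (4 / INR N)) at 2 by (field; lra).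
    apply Rmult_le_compat_r; auto. apply Rdiv_le_0_compat; lra. }
  apply Rabs_le. destruct (le_lt_dec m n) as [L|L].
  - specialize (H m (n - m)%nat ltac:(lia) ltac:(lia)). replace (m + (n - m))%nat with n in H by lia.
    specialize (H4 (n - m)%nat ltac:(lia)). lra.
  - specialize (H n (m - n)%nat ltac:(lia) ltac:(lia)). replace (n + (m - n))%nat with m in H by lia.
    specialize (H4 (m - n)%nat ltac:(lia)). lra.
Qed.

Section Rounding.
Variables (N : nat) (a : nat -> R) (b : nat -> C) (alpha : nat -> Z).
Hypothesis HN : (1 <= N)%nat.
Hypothesis Ha : uniformly_convex N a.
Hypothesis Hround : forall n, (1 <= n <= N)%nat -> 0 <= 16 * (INR N ^ 2 * a n) - IZR (alpha n) < 1.

Definition shell (p p' : nat * nat * nat) : nat := Z.abs_nat (tsum alpha p - tsum alpha p').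

Lemma shell_approx p p' : In p (triples N) -> In p' (triples N) ->
  Rabs (16 * INR N ^ 2 * (rsum3 a p - rsum3 a p') - IZR (tsum alpha p - tsum alpha p')) < 3.
Proof.
  intros Hp Hp'. apply in_triples in Hp as (h1 & h2 & h3). apply in_triples in Hp' as (h4 & h5 & h6).
  apply Hround in h1, h2, h3, h4, h5, h6.
  unfold tsum, rsum3. rewrite minus_IZR, !plus_IZR. apply Rabs_def1; lra.
Qed.

Lemma INR_shell p p' : INR (shell p p') = Rabs (IZR (tsum alpha p - tsum alpha p')).
Proof. unfold shell. rewrite INR_IZR_INZ, Zabs2Nat.id_abs. apply abs_IZR. Qed.

(** 195 = 16 * 12 + 3: each [a n] varies by at most 4, so a sum of three varies by at most 12, and 3
    is the rounding error. *)
Lemma shell_le p p' : In p (triples N) -> In p' (triples N) -> (shell p p' <= 195 * N ^ 2)%nat.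
Proof.
  intros Hp Hp'. pose proof (shell_approx p p' Hp Hp') as H. apply INR_le. rewrite INR_shell, mult_INR, pow_INR.
  assert (HN' : 1 <= INR N) by (apply (le_INR 1); lia).
  assert (HN2 : 1 <= INR N ^ 2) by (apply pow_R1_Rle; auto).
  apply in_triples in Hp as (h1 & h2 & h3). apply in_triples in Hp' as (h4 & h5 & h6).
  pose proof (uniformly_convex_spread N a _ _ Ha h1 h4) as s1.
  pose proof (uniformly_convex_spread N a _ _ Ha h2 h5) as s2.
  pose proof (uniformly_convex_spread N a _ _ Ha h3 h6) as s3.
  assert (Hs : Rabs (rsum3 a p - rsum3 a p') <= 12).
  { unfold rsum3. apply Rabs_le_between in s1, s2, s3. apply Rabs_le. lra. }
  apply Rabs_le_between in Hs. apply Rabs_def2 in H.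
  replace (INR 195) with 195 by (simpl; ring). apply Rabs_le. nra.
Qed.

(** For a shell m <= 6 the trivial bound N^2 is enough. For m > 6 the rounding error 3 is at most
    m/2, hence 16 N^2 |d| >= m/2 for the frequency difference d, and oscillation gives 1/|d| <= 32
    N^2/m <= 64 N^2/(1+m). *)
Lemma pair_term_integral p p' : In p (triples N) -> In p' (triples N) ->
  is_RInt (pair_term a b p p') 0 (INR N ^ 2) (RInt (pair_term a b p p') 0 (INR N ^ 2)) /\
  RInt (pair_term a b p p') 0 (INR N ^ 2) <=
    if Nat.eqb (ksum p) (ksum p')
    then Cmod (cprod3 b p) * Cmod (cprod3 b p') * (64 * INR N ^ 2 * / (1 + INR (shell p p'))) else 0.
Proof.
  intros Hp Hp'. unfold pair_term.
  assert (HN' : 1 <= INR N) by (apply (le_INR 1); lia).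
  assert (HN2 : 1 <= INR N ^ 2) by (apply pow_R1_Rle; auto).
  destruct (Nat.eqb_spec (ksum p) (ksum p')) as [E|E].
  2:{ assert (H0 : is_RInt (fun _ : R => 0) 0 (INR N ^ 2) 0).
      { pose proof (@is_RInt_const R_NormedModule 0 (INR N ^ 2) 0) as H0.
        change (is_RInt (fun _ => 0) 0 (INR N ^ 2) ((INR N ^ 2 - 0) * 0)) in H0. rewrite Rmult_0_r in H0. exact H0. }
      rewrite (is_RInt_unique _ _ _ _ H0). split; [exact H0|lra]. }
  destruct (dot_oscillation (cprod3 b p) (cprod3 b p') (rsum3 a p) (rsum3 a p') (INR N ^ 2)) as (I & HI & H1 & H2); [lra|].
  rewrite (is_RInt_unique _ _ _ _ HI). split; [exact HI|].
  eapply Rle_trans; [apply Rle_abs|].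
  set (w := Cmod (cprod3 b p) * Cmod (cprod3 b p')) in *.
  assert (Hw : 0 <= w) by (apply Rmult_le_pos; apply Cmod_ge_0).
  pose proof (shell_approx p p' Hp Hp') as H. pose proof (INR_shell p p') as Hsh.
  set (m := INR (shell p p')) in *. set (s := IZR (tsum alpha p - tsum alpha p')) in *.
  assert (Hm0 : 0 <= m) by apply pos_INR.
  set (d := rsum3 a p - rsum3 a p') in *.
  destruct (Rle_dec m 6) as [Hm|Hm].
  - eapply Rle_trans; [exact H1|]. apply Rmult_le_compat_l; auto.
    apply Rmult_le_reg_r with (1 + m); [lra|]. rewrite Rmult_assoc, Rinv_l; nra.
  - assert (Hd : m / 2 <= 16 * INR N ^ 2 * Rabs d).
    { replace (16 * INR N ^ 2 * Rabs d) with (Rabs (16 * INR N ^ 2 * d)).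
      - pose proof (Rabs_triang (16 * INR N ^ 2 * d) (- (16 * INR N ^ 2 * d - s))) as Ht.
        rewrite Rabs_Ropp in Ht. replace (16 * INR N ^ 2 * d + - (16 * INR N ^ 2 * d - s)) with s in Ht by ring. lra.
      - rewrite Rabs_mult, (Rabs_right (16 * INR N ^ 2)); lra. }
    assert (Hd0 : 0 < Rabs d).
    { destruct (Rle_lt_or_eq_dec 0 (Rabs d) (Rabs_pos d)) as [|Hz]; auto. rewrite <- Hz in Hd. lra. }
    eapply Rle_trans; [apply H2|].
    { intros Heq. unfold d in Hd0. rewrite Heq, Rminus_diag, Rabs_R0 in Hd0. lra. }
    unfold Rdiv. apply Rmult_le_compat_l; auto.
    apply Rmult_le_reg_r with (Rabs d); auto. rewrite Rinv_l by lra.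
    apply Rmult_le_reg_r with (1 + m); [lra|].
    replace (64 * INR N ^ 2 * / (1 + m) * Rabs d * (1 + m)) with (64 * INR N ^ 2 * Rabs d) by (field; lra). lra.
Qed.
End Rounding.

Lemma ln_le_Rpower x d : 1 <= x -> 0 < d -> ln x <= Rpower x d / d.
Proof.
  intros Hx Hd. apply Rmult_le_reg_r with d; auto. unfold Rdiv. rewrite Rmult_assoc, Rinv_l, Rmult_1_r by lra.
  unfold Rpower. pose proof (exp_ineq1_le (d * ln x)). lra.
Qed.

Lemma log_shells_le (N : nat) d : (1 <= N)%nat -> 0 < d ->
  1 + ln (1 + INR (195 * N ^ 2)) <= (197 + 2 / d) * Rpower (INR N) d.
Proof.
  intros HN Hd. assert (HN' : 1 <= INR N) by (apply (le_INR 1); lia).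
  pose proof (ln_le_Rpower (INR N) d HN' Hd) as Hl.
  pose proof (Rpower_ge_1 (INR N) d HN' ltac:(lra)) as Hp.
  assert (H1 : ln (1 + INR (195 * N ^ 2)) <= ln (196 * (INR N * INR N))).
  { rewrite mult_INR, pow_INR. replace (INR 195) with 195 by (simpl; ring).
    apply ln_le; [nra|nra]. }
  rewrite !ln_mult in H1 by nra.
  assert (H2 : ln 196 <= 196).
  { pose proof (exp_ineq1_le (ln 196)) as H. rewrite exp_ln in H by lra. lra. }
  replace ((197 + 2 / d) * Rpower (INR N) d) with (197 * Rpower (INR N) d + 2 * (Rpower (INR N) d / d)) by (field; lra).
  lra.
Qed.

(** Pairs of triples are sorted by shell. A pair in shell m costs 64 N^2/(1+m) times the moduli of
    its coefficients, and by [shell_le_sixth], applied to both signs of the discrepancy and to the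
    moduli [beta], the shell has total weight at most [2 * X]. The harmonic sum over about N^2
    shells is the logarithm. *)
Lemma cube_mass_integral N a b K d : (1 <= N)%nat -> 0 <= K -> 0 < d -> sixth_moment_bound 66 d K ->
  uniformly_convex N a ->
  exists I, is_RInt (cube_mass N a b) 0 (INR N ^ 2) I /\
    I <= 128 * INR N ^ 2 * ((197 + 2 / d) * Rpower (INR N) d) *
         (K * Rpower (INR N) d * (rsum (seq 1 N) (fun n => Cmod (b n) ^ 2)) ^ 3).
Proof.
  intros HN HK Hd HB Ha. assert (HN' : 1 <= INR N) by (apply (le_INR 1); lia).
  assert (HN2 : 1 <= INR N ^ 2) by (apply pow_R1_Rle; auto).
  destruct (convex_rounding N a HN Ha) as (alpha & Hconv & Hround).
  set (S0 := (195 * N ^ 2)%nat).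
  destruct (admissible_exists 66 alpha (S N) S0 Hconv) as (H & Q & Hadm & HQ).
  set (v := fun n => (alpha n + H * Z.of_nat n)%Z) in *.
  set (beta := fun n => if (Nat.leb 1 n && Nat.leb n N)%bool then Cmod (b n) else 0).
  assert (Hbeta : forall n, (1 <= n <= N)%nat -> beta n = Cmod (b n)).
  { intros n Hn. unfold beta. destruct (Nat.leb_spec 1 n); [|lia]. destruct (Nat.leb_spec n N); [reflexivity|lia]. }
  assert (Hbeta0 : forall n, 0 <= beta n) by (intros n; unfold beta; destruct andb; [apply Cmod_ge_0|lra]).
  set (E := rsum (seq 1 N) (fun n => Cmod (b n) ^ 2)).
  assert (HE : energy (S N) beta = E).
  { unfold energy, E. simpl seq. rewrite rsum_cons. replace (beta 0%nat) with 0 by reflexivity.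
    rewrite (rsum_ext (seq 1 N) (fun n => beta n ^ 2) (fun n => Cmod (b n) ^ 2)); [ring|].
    intros n Hn. apply in_seq in Hn. rewrite Hbeta by lia. reflexivity. }
  set (X := sixth (S N) Q v beta).
  assert (HX : X <= K * Rpower (INR N) d * E ^ 3).
  { rewrite <- HE. apply (HB (S N) Q alpha v Hadm 1%nat N); auto.
    intros n Hn. unfold beta in Hn. destruct (Nat.leb_spec 1 n); [|now elim Hn].
    destruct (Nat.leb_spec n N); [lia|now elim Hn]. }
  assert (HX0 : 0 <= X) by apply sixth_ge0.
  assert (Hprod : forall p, In p (triples N) -> Cmod (cprod3 b p) = prod3 beta p).
  { intros p Hp. apply in_triples in Hp as (h1 & h2 & h3). unfold cprod3, prod3. rewrite !Cmod_mult, !Hbeta; auto. }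
  assert (Hprod0 : forall p, 0 <= prod3 beta p) by (intros; unfold prod3; repeat apply Rmult_le_pos; auto).
  exists (rsum (triples N) (fun p => rsum (triples N) (fun p' => RInt (pair_term a b p p') 0 (INR N ^ 2)))). split.
  { unfold cube_mass. apply is_RInt_rsum; intros p Hp. apply is_RInt_rsum; intros p' Hp'.
    apply (pair_term_integral N a b alpha HN Hround p p' Hp Hp'). }
  set (F := fun (m : nat) p p' => if (Nat.eqb (ksum p) (ksum p') && Nat.eqb (shell alpha p p') m)%bool
     then prod3 beta p * prod3 beta p' else 0).
  assert (Hshell : forall m, (m <= S0)%nat ->
     rsum (triples N) (fun p => rsum (triples N) (fun p' => F m p p')) <= 2 * X).
  { intros m Hm.
    assert (Hs : forall s, Z.abs s = Z.of_nat m -> rsum (triples N) (fun p => rsum (triples N) (fun p' =>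
       if (Nat.eqb (ksum p) (ksum p') && Z.eqb (tsum alpha p - tsum alpha p') s)%bool then prod3 beta p * prod3 beta p' else 0)) <= X).
    { intros s Es. apply (shell_le_sixth 66 N Q alpha v H beta s); auto.
      intros p p' Hp Hp'. apply in_triples in Hp as (h1 & h2 & h3). apply in_triples in Hp' as (h4 & h5 & h6).
      unfold tsum. rewrite Es.
      specialize (HQ (fst (fst p)) (snd (fst p)) (snd p) (fst (fst p')) (snd (fst p')) (snd p')
        ltac:(lia) ltac:(lia) ltac:(lia) ltac:(lia) ltac:(lia) ltac:(lia)). clear - HQ Hm. unfold v; lia. }
    apply Rle_trans with (X + X); [|lra].
    eapply Rle_trans; [|apply Rplus_le_compat; [apply (Hs (Z.of_nat m)); clear; lia|apply (Hs (- Z.of_nat m)%Z); clear; lia]].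
    rewrite <- rsum_plus. apply rsum_le; intros p _. rewrite <- rsum_plus. apply rsum_le; intros p' _. unfold F.
    assert (0 <= prod3 beta p * prod3 beta p') by (apply Rmult_le_pos; auto).
    destruct (Nat.eqb (ksum p) (ksum p')); cbn [andb]; [|lra].
    destruct (Nat.eqb_spec (shell alpha p p') m) as [Em|]; [|destruct Z.eqb; destruct Z.eqb; lra].
    unfold shell in Em.
    destruct (Z.eqb_spec (tsum alpha p - tsum alpha p') (Z.of_nat m));
    destruct (Z.eqb_spec (tsum alpha p - tsum alpha p') (- Z.of_nat m)); try lra. lia. }
  apply Rle_trans with (rsum (triples N) (fun p => rsum (triples N) (fun p' =>
     rsum (seq 0 (S S0)) (fun m => 64 * INR N ^ 2 * / (1 + INR m) * F m p p')))).
  { apply rsum_le; intros p Hp. apply rsum_le; intros p' Hp'.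
    eapply Rle_trans; [apply (pair_term_integral N a b alpha HN Hround p p' Hp Hp')|].
    rewrite (Hprod p Hp), (Hprod p' Hp'). unfold F.
    destruct (Nat.eqb (ksum p) (ksum p')); cbn [andb].
    - rewrite (rsum_ext _ _ (fun m => if Nat.eqb (shell alpha p p') m then
        64 * INR N ^ 2 * / (1 + INR m) * (prod3 beta p * prod3 beta p') else 0)).
      + rewrite (rsum_indic (seq 0 (S S0)) (shell alpha p p') (fun m => 64 * INR N ^ 2 * / (1 + INR m) * (prod3 beta p * prod3 beta p'))).
        * lra.
        * apply seq_NoDup.
        * apply in_seq. pose proof (shell_le N a alpha HN Ha Hround p p' Hp Hp'). unfold S0. lia.
      + intros m _. destruct Nat.eqb; ring.
    - rewrite rsum_0; [lra|]. intros; ring. }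
  rewrite (rsum_ext (triples N) _ (fun p => rsum (seq 0 (S S0)) (fun m => rsum (triples N) (fun p' =>
     64 * INR N ^ 2 * / (1 + INR m) * F m p p')))) by (intros; apply rsum_swap).
  rewrite rsum_swap.
  apply Rle_trans with (rsum (seq 0 (S S0)) (fun m => 128 * INR N ^ 2 * X * / (1 + INR m))).
  { apply rsum_le; intros m Hm. apply in_seq in Hm. specialize (Hshell m ltac:(lia)).
    rewrite (rsum_ext _ _ (fun p => 64 * INR N ^ 2 * / (1 + INR m) * rsum (triples N) (fun p' => F m p p')))
      by (intros; apply rsum_scal).
    rewrite rsum_scal.
    assert (0 < / (1 + INR m)) by (apply Rinv_0_lt_compat; pose proof (pos_INR m); lra).
    replace (128 * INR N ^ 2 * X * / (1 + INR m)) with (64 * INR N ^ 2 * / (1 + INR m) * (2 * X)) by ring.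
    apply Rmult_le_compat_l; auto. apply Rmult_le_pos; lra. }
  rewrite rsum_scal.
  apply Rle_trans with (128 * INR N ^ 2 * X * ((197 + 2 / d) * Rpower (INR N) d)).
  { apply Rmult_le_compat_l; [apply Rmult_le_pos; lra|].
    eapply Rle_trans; [apply rsum_inv_le_ln|]. now apply log_shells_le. }
  assert (0 <= (197 + 2 / d) * Rpower (INR N) d).
  { apply Rmult_le_pos; [|left; apply Rpower_pos]. assert (0 < 2 / d) by (apply Rdiv_lt_0_compat; lra). lra. }
  rewrite (Rmult_assoc _ X), (Rmult_comm X), <- Rmult_assoc.
  apply Rmult_le_compat_l; auto. apply Rmult_le_pos; auto. lra.
Qed.

Lemma sqrt_sqrt_le y z : 0 <= z -> y <= z ^ 4 -> sqrt (sqrt y) <= z.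
Proof.
  intros Hz Hy. rewrite <- (sqrt_pow2 z) by auto. apply sqrt_le_1_alt.
  rewrite <- (sqrt_pow2 (z ^ 2)) by apply pow2_ge_0. apply sqrt_le_1_alt. nra.
Qed.

Lemma le_sqrt_sqrt y z : 0 <= z -> z ^ 4 <= y -> z <= sqrt (sqrt y).
Proof.
  intros Hz Hy. rewrite <- (sqrt_pow2 z) at 1 by auto. apply sqrt_le_1_alt.
  rewrite <- (sqrt_pow2 (z ^ 2)) by apply pow2_ge_0. apply sqrt_le_1_alt. nra.
Qed.

Lemma maxfun_quartic_upper N a b I m2 : (1 <= N)%nat -> 0 < m2 -> is_RInt (cube_mass N a b) 0 (INR N ^ 2) I ->
  RInt (fun t => maxfun N a b t ^ 4) 0 (INR N ^ 2) <= INR N ^ 2 * m2 ^ 2 + / m2 * (INR (3 * N + 1) * I).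
Proof.
  intros HN Hm HI.
  assert (HR : is_RInt (fun t => m2 ^ 2 + / m2 * (INR (3 * N + 1) * cube_mass N a b t)) 0 (INR N ^ 2)
      (INR N ^ 2 * m2 ^ 2 + / m2 * (INR (3 * N + 1) * I))).
  { apply (is_RInt_plus (V := R_NormedModule)).
    - pose proof (@is_RInt_const R_NormedModule 0 (INR N ^ 2) (m2 ^ 2)) as H0.
      change (is_RInt (fun _ => m2 ^ 2) 0 (INR N ^ 2) ((INR N ^ 2 - 0) * m2 ^ 2)) in H0. now rewrite Rminus_0_r in H0.
    - apply (is_RInt_scal (V := R_NormedModule)). apply (is_RInt_scal (V := R_NormedModule)). exact HI. }
  rewrite <- (is_RInt_unique _ _ _ _ HR). apply RInt_le.
  - apply pow2_ge_0.
  - apply ex_RInt_maxfun.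
  - eexists; exact HR.
  - intros t _. pose proof (maxfun_pow6_le N a b t _ (expsum_pow6_le N a b t)) as H6.
    set (g := maxfun N a b t) in *. set (P := INR (3 * N + 1) * cube_mass N a b t) in *.
    apply Rle_trans with (m2 ^ 2 + / m2 * g ^ 6).
    + apply Rmult_le_reg_l with m2; auto.
      replace (m2 * (m2 ^ 2 + / m2 * g ^ 6)) with (m2 ^ 3 + g ^ 6) by (field; lra).
      pose proof (pow2_ge_0 g). replace (g ^ 4) with ((g ^ 2) ^ 2) by ring. replace (g ^ 6) with ((g ^ 2) ^ 3) by ring.
      set (y := g ^ 2) in *. destruct (Rle_dec y m2).
      * assert (y ^ 2 <= m2 ^ 2) by (apply pow_incr; lra). assert (0 <= y ^ 3) by (apply pow_le; auto). nra.
      * assert (0 <= m2 ^ 3) by (apply pow_le; lra). assert (m2 * y ^ 2 <= y * y ^ 2) by (apply Rmult_le_compat_r; [apply pow2_ge_0|lra]). nra.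
    + apply Rplus_le_compat_l, Rmult_le_compat_l; auto. left; now apply Rinv_0_lt_compat.
Qed.

Lemma l2norm_rsum N b : l2norm N b = sqrt (rsum (seq 1 N) (fun n => Cmod (b n) ^ 2)).
Proof. reflexivity. Qed.

Theorem maximal_upper_bound eps : 0 < eps ->
  exists Ceps : R, 0 < Ceps /\
    forall N : nat, (1 <= N)%nat ->
      forall (a : nat -> R) (b : nat -> C),
        uniformly_convex N a ->
        L4norm N a b <= Ceps * Rpower (INR N) eps * Rpower (INR N) (2 / 3) * l2norm N b.
Proof.
  (* The quartic integral loses N^d twice, in the sixth moment and in the logarithm; its fourth root
     loses N^(d/2). *)
  intros Heps. set (d := 2 * eps).
  destruct (sixth_moment 66 d ltac:(lia) ltac:(unfold d; lra)) as [K [HK HB]].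
  assert (Hd2 : 0 < 2 / d) by (unfold d; apply Rdiv_lt_0_compat; lra).
  set (C1 := 1 + 512 * (197 + 2 / d) * K).
  assert (HC1 : 1 <= C1).
  { unfold C1. assert (0 <= 512 * (197 + 2 / d) * K) by (apply Rmult_le_pos; lra). lra. }
  exists C1. split; [lra|]. intros N HN a b Ha.
  assert (HN' : 1 <= INR N) by (apply (le_INR 1); lia).
  rewrite l2norm_rsum. set (E := rsum (seq 1 N) (fun n => Cmod (b n) ^ 2)).
  assert (HE : 0 <= E) by (apply rsum_ge0; intros; apply pow2_ge_0).
  assert (Hrhs : 0 <= C1 * Rpower (INR N) eps * Rpower (INR N) (2 / 3) * sqrt E).
  { repeat apply Rmult_le_pos; try (left; apply Rpower_pos); try apply sqrt_pos; lra. }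
  unfold L4norm. apply sqrt_sqrt_le; auto.
  (* The level used below is a multiple of [E] and is divided by, so vanishing coefficients are
     treated apart. *)
  destruct (Req_dec E 0) as [E0|E0].
  { assert (Hb : forall n, In n (seq 1 N) -> Cmod (b n) = 0).
    { intros n Hn. pose proof (rsum_term (seq 1 N) (fun n => Cmod (b n) ^ 2) n Hn (fun y _ => pow2_ge_0 _)) as Ht.
      cbv beta in Ht. fold E in Ht. rewrite E0 in Ht. pose proof (Cmod_ge_0 (b n)). nra. }
    rewrite (RInt_ext _ (fun _ => 0)).
    - rewrite RInt_const. apply Rle_trans with 0; [|now apply pow_le].
      change (scal (INR N ^ 2 - 0) 0) with ((INR N ^ 2 - 0) * 0). lra.
    - intros t _. assert (Hz : maxfun N a b t <= 0).
      2:{ replace (maxfun N a b t) with 0; [apply Rmult_0_l|]. apply Rle_antisym; [apply maxfun_ge0|exact Hz]. }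
      apply (proj2 (maxfun_lub N a b t)). intros x _. eapply Rle_trans; [apply expsum_mod_le|].
      rewrite rsum_0; [lra|auto]. }
  assert (HEp : 0 < E) by lra.
  destruct (cube_mass_integral N a b K d HN HK ltac:(unfold d; lra) HB Ha) as [I [HI HIle]]. fold E in HIle.
  set (r := Rpower (INR N) (1 / 3)). assert (Hr : 0 < r) by apply Rpower_pos.
  assert (Hr3 : r ^ 3 = INR N).
  { unfold r. rewrite <- Rpower_pow by apply Rpower_pos. rewrite Rpower_mult.
    replace (1 / 3 * INR 3) with 1 by (simpl; field). apply Rpower_1; lra. }
  assert (Hr1 : 1 <= r) by (apply Rpower_ge_1; lra).
  set (y := Rpower (INR N) eps). assert (Hy : 1 <= y) by (apply Rpower_ge_1; lra).
  assert (Hyd : Rpower (INR N) d = y ^ 2).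
  { unfold y, d. rewrite <- Rpower_pow by apply Rpower_pos. rewrite Rpower_mult. f_equal. simpl. ring. }
  assert (Hr23 : Rpower (INR N) (2 / 3) = r ^ 2).
  { unfold r. rewrite <- Rpower_pow by apply Rpower_pos. rewrite Rpower_mult. f_equal. simpl. field. }
  rewrite Hr23. rewrite Hyd in HIle.
  (* Up to N^eps the two terms are N^2 m2^2 and N^3 E^3 / m2; they balance at m2^3 = N E^3, that is
     at [m2 = r * E]. *)
  eapply Rle_trans; [apply (maxfun_quartic_upper N a b I (r * E) HN); [now apply Rmult_lt_0_compat|exact HI]|].
  assert (Hsq : sqrt E ^ 4 = E ^ 2).
  { replace (sqrt E ^ 4) with ((sqrt E ^ 2) ^ 2) by ring. now rewrite pow2_sqrt. }
  replace ((C1 * y * r ^ 2 * sqrt E) ^ 4) with (C1 ^ 4 * y ^ 4 * r ^ 8 * E ^ 2) by (rewrite <- Hsq; ring).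
  rewrite <- Hr3 in HIle |- *.
  assert (H3N : INR (3 * N + 1) <= 4 * r ^ 3).
  { rewrite Hr3, plus_INR, mult_INR. simpl (INR 3). simpl (INR 1). lra. }
  apply Rle_trans with ((r ^ 3) ^ 2 * (r * E) ^ 2 + / (r * E) * (4 * r ^ 3 *
     (128 * (r ^ 3) ^ 2 * ((197 + 2 / d) * y ^ 2) * (K * y ^ 2 * E ^ 3)))).
  - apply Rplus_le_compat_l, Rmult_le_compat_l.
    { left; apply Rinv_0_lt_compat, Rmult_lt_0_compat; auto. }
    assert (Hbig : 0 <= 128 * (r ^ 3) ^ 2 * ((197 + 2 / d) * y ^ 2) * (K * y ^ 2 * E ^ 3)).
    { assert (0 <= (r ^ 3) ^ 2) by apply pow2_ge_0. assert (0 <= y ^ 2) by apply pow2_ge_0.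
      assert (0 <= E ^ 3) by (apply pow_le; lra). assert (0 <= K * y ^ 2) by (apply Rmult_le_pos; lra).
      assert (0 <= (197 + 2 / d) * y ^ 2) by (apply Rmult_le_pos; lra).
      apply Rmult_le_pos; apply Rmult_le_pos; auto; lra. }
    eapply Rle_trans; [apply Rmult_le_compat_l; [apply pos_INR|exact HIle]|].
    apply Rmult_le_compat_r; auto.
  - replace ((r ^ 3) ^ 2 * (r * E) ^ 2 + / (r * E) * (4 * r ^ 3 *
     (128 * (r ^ 3) ^ 2 * ((197 + 2 / d) * y ^ 2) * (K * y ^ 2 * E ^ 3))))
     with ((1 + (C1 - 1) * y ^ 4) * (r ^ 8 * E ^ 2)) by (unfold C1; field; unfold d; repeat split; lra).
    rewrite (Rmult_assoc (C1 ^ 4 * y ^ 4)). apply Rmult_le_compat_r.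
    { apply Rmult_le_pos; apply pow_le; lra. }
    assert (Hy4 : 1 <= y ^ 4) by (apply pow_R1_Rle; auto).
    apply Rle_trans with (C1 * y ^ 4); [lra|]. apply Rmult_le_compat_r; [lra|].
    rewrite <- (pow_1 C1) at 1. apply Rle_pow; auto.
Qed.

(** * Gauss sums and the lower bound *)

Lemma pigeonhole (f : nat -> nat) n : (forall i, (i <= n)%nat -> (f i < n)%nat) ->
  exists i j, (i < j <= n)%nat /\ f i = f j.
Proof.
  intros Hf. apply NNPP. intros Hno.
  assert (Hd : NoDup (map f (seq 0 (S n)))).
  { apply Injective_map_NoDup_in; [|apply seq_NoDup]. intros x y Hx Hy E. apply in_seq in Hx, Hy.
    destruct (lt_eq_lt_dec x y) as [[H|H]|H]; auto; exfalso; apply Hno;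
    [exists x, y | exists y, x]; (split; [lia|auto]). }
  assert (Hl := NoDup_incl_length (l' := seq 0 n) Hd).
  rewrite length_map, !length_seq in Hl. cut (S n <= n)%nat; [lia|]. apply Hl.
  intros y Hy. apply in_map_iff in Hy as [x [<- Hx]]. apply in_seq in Hx. apply in_seq.
  specialize (Hf x ltac:(lia)). lia.
Qed.

Lemma natfloor_spec x : 0 <= x -> INR (Z.to_nat (Int_part x)) <= x < INR (Z.to_nat (Int_part x)) + 1.
Proof.
  intros Hx. destruct (base_Int_part x) as [H1 H2].
  assert (H : (0 <= Int_part x)%Z) by (cut (-1 < Int_part x)%Z; [lia|apply lt_IZR; lra]).
  rewrite INR_IZR_INZ, Z2Nat.id by auto. lra.
Qed.

Lemma dirichlet_approximation s Q : 0 <= s -> (1 <= Q)%nat ->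
  exists q r, (1 <= q <= Q)%nat /\ Rabs (INR q * s - INR r) <= / INR Q.
Proof.
  intros Hs HQ. assert (HQ' : 0 < INR Q) by (apply lt_0_INR; lia).
  set (k := fun i => Z.to_nat (Int_part (INR i * s))).
  assert (Hk : forall i, INR (k i) <= INR i * s < INR (k i) + 1).
  { intros i. apply natfloor_spec. apply Rmult_le_pos; auto; apply pos_INR. }
  set (m := fun i => Z.to_nat (Int_part (INR Q * (INR i * s - INR (k i))))).
  assert (Hm : forall i, INR (m i) <= INR Q * (INR i * s - INR (k i)) < INR (m i) + 1).
  { intros i. apply natfloor_spec. specialize (Hk i). apply Rmult_le_pos; lra. }
  destruct (pigeonhole m Q) as (i & j & Hij & E).
  { intros i _. apply INR_lt. eapply Rle_lt_trans; [apply Hm|].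
    rewrite <- (Rmult_1_r (INR Q)) at 2. specialize (Hk i). apply Rmult_lt_compat_l; lra. }
  assert (Hkij : (k i <= k j)%nat).
  { cut (k i < S (k j))%nat; [lia|]. apply INR_lt. rewrite S_INR. pose proof (Hk i). pose proof (Hk j).
    assert (INR i * s <= INR j * s) by (apply Rmult_le_compat_r; auto; apply le_INR; lia). lra. }
  exists (j - i)%nat, (k j - k i)%nat. split; [lia|]. rewrite !minus_INR by lia.
  pose proof (Hm i) as Hi. pose proof (Hm j) as Hj. rewrite E in Hi.
  apply Rmult_le_reg_l with (INR Q); auto. rewrite Rinv_r by lra.
  rewrite <- (Rabs_right (INR Q)) at 1 by lra. rewrite <- Rabs_mult. apply Rabs_le. lra.
Qed.

Lemma rsum_periodic (P : nat) (F : nat -> R) k : (forall i, F (i + P)%nat = F i) -> (0 < P)%nat ->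
  rsum (seq k P) F = rsum (seq 0 P) F.
Proof.
  intros HF HP. induction k as [|k IH]; [reflexivity|]. rewrite <- IH.
  destruct P as [|P]; [lia|]. rewrite seq_S, rsum_app. simpl seq. rewrite !rsum_cons.
  replace (S k + P)%nat with (k + S P)%nat by lia. rewrite HF. unfold rsum at 2. simpl. ring.
Qed.

Lemma e_plus_Z x z : e (x + IZR z) = e x.
Proof. rewrite e_plus, e_Z. ring. Qed.

(** Expanding the square and putting k = h + k' leaves for each h a complete geometric sum over k'
    with ratio e(-2h/P), which vanishes unless P divides 2h. The term h = 0 gives P. For h = P/2 the
    phase is +1 or -1; the hypothesis selects +1, while -1 would cancel the first term. *)
Lemma gauss_sum_lower (P : nat) (u : Z) : (0 < P)%nat ->
  (forall h, (2 * h = P)%nat -> exists z, (u * Z.of_nat h - Z.of_nat h * Z.of_nat h = z * Z.of_nat P)%Z) ->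
  INR P <= Cmod (csum (seq 0 P) (fun k => e (IZR (u * Z.of_nat k - Z.of_nat k * Z.of_nat k) / INR P))) ^ 2.
Proof.
  intros HP Hu. assert (HP' : 0 < INR P) by now apply lt_0_INR.
  set (ph := fun k : nat => IZR (u * Z.of_nat k - Z.of_nat k * Z.of_nat k) / INR P).
  change (INR P <= Cmod (csum (seq 0 P) (fun k => e (ph k))) ^ 2).
  assert (Hper : forall k, exists z, ph (k + P)%nat = ph k + IZR z).
  { intros k. exists (u - 2 * Z.of_nat k - Z.of_nat P)%Z. unfold ph. rewrite Nat2Z.inj_add.
    rewrite !minus_IZR, !mult_IZR, !plus_IZR, <- !INR_IZR_INZ. field. lra. }
  rewrite <- dot_self, dot_csum.
  assert (E : forall k', rsum (seq 0 P) (fun k => dot (e (ph k)) (e (ph k'))) =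
     rsum (seq 0 P) (fun h => Re (e (ph (h + k')%nat - ph k')))).
  { intros k'. rewrite <- (rsum_periodic P _ k'); auto.
    - replace (seq k' P) with (map (fun h => (h + k')%nat) (seq 0 P)).
      + rewrite rsum_map. apply rsum_ext; intros h _.
        pose proof (dot_scal_e 1 1 (ph (h + k')%nat) (ph k')) as Hd. rewrite !Cmult_1_l, Rmult_1_l, Rmult_1_l in Hd. exact Hd.
      + cut (forall o, map (fun h => (h + k')%nat) (seq o P) = seq (o + k') P); [intros H; apply (H 0%nat)|].
        clear. induction P as [|P IH]; intros o; [reflexivity|]. simpl. f_equal. apply (IH (S o)).
    - intros i. destruct (Hper i) as [z ->]. now rewrite e_plus_Z. }
  rewrite rsum_swap. rewrite (rsum_ext _ _ _ (fun k' _ => E k')). rewrite rsum_swap.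
  assert (Hh : forall h, In h (seq 0 P) -> (if Nat.eqb 0 h then INR P else 0) <=
     rsum (seq 0 P) (fun k' => Re (e (ph (h + k')%nat - ph k')))).
  (* [w] represents -2h modulo P with absolute value below P for h <> 0 and 2h <> P, as [csum_e_eq0]
     requires. *)
  { intros h Hin. apply in_seq in Hin. set (w := IZR (if Nat.ltb P (2 * h) then Z.of_nat P - 2 * Z.of_nat h else - (2 * Z.of_nat h))).
    assert (E2 : forall k', e (ph (h + k')%nat - ph k') = Cmult (e (ph h)) (e (w * (INR k' / INR P)))).
    { intros k'. rewrite <- e_plus. unfold w, ph. destruct (Nat.ltb P (2 * h)).
      - rewrite <- (e_plus_Z _ (Z.of_nat k')). f_equal. rewrite Nat2Z.inj_add.
        rewrite !minus_IZR, !mult_IZR, !plus_IZR, <- !INR_IZR_INZ. field. lra.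
      - f_equal. rewrite Nat2Z.inj_add. rewrite opp_IZR.
        rewrite !minus_IZR, !mult_IZR, !plus_IZR, <- !INR_IZR_INZ. field. lra. }
    rewrite (rsum_ext _ _ (fun k' => Re (Cmult (e (ph h)) (e (w * (INR k' / INR P)))))) by (intros k' _; now rewrite E2).
    rewrite <- Re_csum, csum_scal.
    destruct (Nat.eqb_spec 0 h) as [<-|Hne].
    - assert (Hw : w = 0) by (unfold w; destruct (Nat.ltb_spec P (2 * 0)); [lia|reflexivity]).
      rewrite (csum_ext _ _ (fun _ => RtoC 1)) by (intros; rewrite Hw, Rmult_0_l; apply e_0).
      replace (e (ph 0%nat)) with (RtoC 1).
      + rewrite Cmult_1_l, Re_csum. unfold RtoC, Re; simpl. rewrite rsum_const, length_seq. lra.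
      + rewrite <- e_0. f_equal. unfold ph. simpl. rewrite Z.mul_0_r. simpl. field. lra.
    - destruct (Nat.eq_dec (2 * h) P) as [Heq|Hneq].
      + destruct (Hu h Heq) as [z Hz].
        replace (e (ph h)) with (RtoC 1).
        * rewrite Cmult_1_l, Re_csum. apply rsum_ge0; intros k' _.
          assert (Hw : w * (INR k' / INR P) = IZR (- Z.of_nat k')).
          { unfold w. destruct (Nat.ltb_spec P (2 * h)); [lia|]. rewrite !opp_IZR, mult_IZR, <- !INR_IZR_INZ.
            rewrite <- Heq, mult_INR in *. simpl (INR 2) in *. field. nra. }
          rewrite Hw, e_Z. simpl. lra.
        * symmetry. rewrite <- (e_Z z). f_equal. unfold ph. rewrite Hz, mult_IZR, <- INR_IZR_INZ. field. lra.
      + unfold w. rewrite csum_e_eq0; [rewrite Cmult_0_r; simpl; lra| |]; destruct (Nat.ltb_spec P (2 * h)); lia. }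
  eapply Rle_trans; [|apply rsum_le; exact Hh].
  rewrite (rsum_indic (seq 0 P) 0 (fun _ => INR P)); [lra|apply seq_NoDup|apply in_seq; lia].
Qed.

Lemma csum_periodic (P : nat) (F : nat -> C) k : (forall i, F (i + P)%nat = F i) -> (0 < P)%nat ->
  csum (seq k P) F = csum (seq 0 P) F.
Proof.
  intros HF HP. apply injective_projections.
  - change (Re (csum (seq k P) F) = Re (csum (seq 0 P) F)). rewrite !Re_csum.
    apply rsum_periodic; auto. intros; now rewrite HF.
  - change (Im (csum (seq k P) F) = Im (csum (seq 0 P) F)). rewrite !Im_csum.
    apply rsum_periodic; auto. intros; now rewrite HF.
Qed.

Lemma Cmod_ge_sub (z w : C) : Cmod w - Cmod (Cminus z w) <= Cmod z.
Proof.
  pose proof (Cmod_triangle z (Copp (Cminus z w))) as H. rewrite Cmod_opp in H.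
  replace (Cplus z (Copp (Cminus z w))) with w in H by ring. lra.
Qed.

Definition quad_phase (P : nat) (u : Z) (k : nat) : R := IZR (u * Z.of_nat k - Z.of_nat k * Z.of_nat k) / INR P.

Lemma quad_phase_period P u k j : (0 < P)%nat -> e (quad_phase P u (k + P * j)) = e (quad_phase P u k).
Proof.
  intros HP. assert (0 < INR P) by now apply lt_0_INR.
  rewrite <- (e_plus_Z (quad_phase P u k) (Z.of_nat j * (u - 2 * Z.of_nat k - Z.of_nat P * Z.of_nat j))). f_equal. unfold quad_phase.
  rewrite Nat2Z.inj_add, Nat2Z.inj_mul.
  repeat rewrite ?minus_IZR, ?mult_IZR, ?plus_IZR, <- ?INR_IZR_INZ. field. lra.
Qed.

Lemma csum_blocks (P J : nat) (F : nat -> C) :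
  csum (seq 1 (P * J)) F = csum (seq 0 J) (fun j => csum (seq 1 P) (fun i => F (i + P * j)%nat)).
Proof.
  induction J as [|J IH]; [now rewrite Nat.mul_0_r|].
  replace (P * S J)%nat with (P * J + P)%nat by ring.
  rewrite seq_app, csum_app, IH, seq_S, csum_app. f_equal.
  unfold csum at 2. simpl. rewrite Cplus_0_r.
  replace (seq (S (P * J)) P) with (map (fun i => (i + P * J)%nat) (seq 1 P)); [apply csum_map|].
  cut (forall o, map (fun h => (h + P * J)%nat) (seq o P) = seq (o + P * J) P); [intros H; apply (H 1%nat)|].
  clear. generalize (P * J)%nat as w. intros w. induction P as [|P IH]; intros o; [reflexivity|].
  simpl. f_equal. apply (IH (S o)).
Qed.

Lemma two_PI_le : 2 * PI <= 8.
Proof. pose proof PI_4. lra. Qed.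

(** The quadratic phase has period P and the drift is linear, so the sum over the J = M/P full
    blocks factors as one block [B] times [D], the sum of the drifts at block starts. Since 2 pi <=
    8, the bound on P^2 |th| puts [B] within 8 * 4 = 32 of a complete Gauss sum, and the bound on M
    |th| puts [D] within J/2 of J. The incomplete block costs at most P. *)
Lemma incomplete_gauss_lower (P M : nat) (u : Z) (th : R) : (0 < P)%nat ->
  (forall h, (2 * h = P)%nat -> exists z, (u * Z.of_nat h - Z.of_nat h * Z.of_nat h = z * Z.of_nat P)%Z) ->
  INR M * Rabs th <= / 16 -> INR P ^ 2 * Rabs th <= 4 -> 32 <= sqrt (INR P) ->
  INR (M / P) / 2 * (sqrt (INR P) - 32) - INR P <=
    Cmod (csum (seq 1 M) (fun k => e (quad_phase P u k + INR k * th))).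
Proof.
  intros HP Hu HM HPt HPs. assert (HP' : 0 < INR P) by now apply lt_0_INR.
  pose proof two_PI_le as HPI. pose proof PI_RGT_0. pose proof (Rabs_pos th) as Hth.
  set (J := (M / P)%nat). pose proof (Nat.div_mod_eq M P) as Hdiv. pose proof (Nat.mod_upper_bound M P ltac:(lia)) as Hmod.
  fold J in Hdiv.
  set (B := csum (seq 1 P) (fun i => e (quad_phase P u i + INR i * th))).
  set (G := csum (seq 0 P) (fun k => e (quad_phase P u k))).
  assert (HG : sqrt (INR P) <= Cmod G).
  { rewrite <- (sqrt_pow2 (Cmod G)) by apply Cmod_ge_0. apply sqrt_le_1_alt. now apply gauss_sum_lower. }
  assert (HB : sqrt (INR P) - 32 <= Cmod B).
  { pose proof (Cmod_ge_sub B G) as Hs. cut (Cmod (Cminus B G) <= 32); [lra|].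
    replace G with (csum (seq 1 P) (fun k => e (quad_phase P u k))).
    2:{ apply csum_periodic; auto. intros i. rewrite <- (quad_phase_period P u i 1 HP). do 2 f_equal. lia. }
    replace (Cminus B (csum (seq 1 P) (fun k => e (quad_phase P u k)))) with
      (csum (seq 1 P) (fun k => Cminus (e (quad_phase P u k + INR k * th)) (e (quad_phase P u k)))).
    - eapply Rle_trans; [apply csum_mod|]. apply Rle_trans with (rsum (seq 1 P) (fun _ => 8 * (INR P * Rabs th))).
      + apply rsum_le; intros k Hk. apply in_seq in Hk. eapply Rle_trans; [apply e_lipschitz|].
        replace (quad_phase P u k + INR k * th - quad_phase P u k) with (INR k * th) by ring.
        rewrite Rabs_mult, (Rabs_right (INR k)) by (apply Rle_ge, pos_INR).
        apply Rmult_le_compat; try lra; [apply Rmult_le_pos; auto; apply pos_INR|].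
        apply Rmult_le_compat_r; auto. apply le_INR; lia.
      + rewrite rsum_const, length_seq. replace (INR P * (8 * (INR P * Rabs th))) with (8 * (INR P ^ 2 * Rabs th)) by ring. lra.
    - unfold B. rewrite (csum_ext _ _ (fun k => Cplus (e (quad_phase P u k + INR k * th)) (Cmult (Copp (RtoC 1)) (e (quad_phase P u k))))).
      + rewrite csum_plus, csum_scal. ring.
      + intros; ring. }
  set (D := csum (seq 0 J) (fun j => e (INR (P * j) * th))).
  assert (HD : INR J / 2 <= Cmod D).
  { pose proof (Cmod_ge_sub D (RtoC (INR J))) as Hs. rewrite Cmod_R, Rabs_right in Hs by (apply Rle_ge, pos_INR).
    cut (Cmod (Cminus D (RtoC (INR J))) <= INR J / 2); [lra|].
    assert (Hone : csum (seq 0 J) (fun _ => e 0) = RtoC (INR J)).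
    { rewrite e_0. apply injective_projections.
      - change (Re (csum (seq 0 J) (fun _ => RtoC 1)) = INR J). rewrite Re_csum. simpl. rewrite rsum_const, length_seq. ring.
      - change (Im (csum (seq 0 J) (fun _ => RtoC 1)) = 0). rewrite Im_csum. apply rsum_0. reflexivity. }
    rewrite <- Hone.
    replace (Cminus D (csum (seq 0 J) (fun _ => e 0))) with (csum (seq 0 J) (fun j => Cminus (e (INR (P * j) * th)) (e 0))).
    - eapply Rle_trans; [apply csum_mod|]. apply Rle_trans with (rsum (seq 0 J) (fun _ => / 2)).
      + apply rsum_le; intros j Hj. apply in_seq in Hj. eapply Rle_trans; [apply e_lipschitz|].
        rewrite Rminus_0_r, Rabs_mult, (Rabs_right (INR _)) by (apply Rle_ge, pos_INR).
        assert (INR (P * j) * Rabs th <= INR M * Rabs th).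
        { apply Rmult_le_compat_r; auto. apply le_INR. nia. }
        assert (0 <= INR (P * j) * Rabs th) by (apply Rmult_le_pos; auto; apply pos_INR). nra.
      + rewrite rsum_const, length_seq. lra.
    - unfold D. rewrite (csum_ext _ _ (fun j => Cplus (e (INR (P * j) * th)) (Cmult (Copp (RtoC 1)) (e 0)))).
      + rewrite csum_plus, csum_scal. ring.
      + intros; ring. }
  replace (seq 1 M) with (seq 1 (P * J + M mod P)) by (f_equal; lia).
  rewrite seq_app, csum_app, csum_blocks.
  assert (E : csum (seq 0 J) (fun j => csum (seq 1 P) (fun i => e (quad_phase P u (i + P * j) + INR (i + P * j) * th))) = Cmult B D).
  { unfold D. rewrite <- csum_scal. apply csum_ext; intros j _. unfold B. rewrite <- csum_scal_r. apply csum_ext; intros i _.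
    rewrite e_plus, quad_phase_period, <- e_plus, <- e_plus by auto. f_equal. rewrite plus_INR. ring. }
  rewrite E. set (R0 := csum (seq (1 + P * J) (M mod P)) _).
  assert (HR0 : Cmod R0 <= INR P).
  { unfold R0. eapply Rle_trans; [apply csum_mod|]. apply Rle_trans with (rsum (seq (1 + P * J) (M mod P)) (fun _ => 1)).
    - apply rsum_le; intros. rewrite Cmod_e. lra.
    - rewrite rsum_const, length_seq, Rmult_1_r. apply le_INR. lia. }
  pose proof (Cmod_ge_sub (Cplus (Cmult B D) R0) (Cmult B D)) as Hs.
  replace (Cminus (Cplus (Cmult B D) R0) (Cmult B D)) with R0 in Hs by ring. rewrite Cmod_mult in Hs.
  assert (INR J / 2 * (sqrt (INR P) - 32) <= Cmod B * Cmod D).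
  { rewrite Rmult_comm. apply Rmult_le_compat; try lra. pose proof (pos_INR J). lra. }
  lra.
Qed.

(* For odd q take y = 1/q; for even q the sum with y = 1/q may vanish, but with y = 1/(2q) it does not since [2 * m0] is even. *)
Lemma large_value (m0 M Q q r : nat) (s : R) :
  (1 <= q <= Q)%nat -> Rabs (INR q * s - INR r) <= / INR Q -> (Q < 32 * q)%nat ->
  512 * INR M <= INR Q ^ 2 -> INR Q ^ 2 <= 1024 * INR M -> 200000 ^ 2 <= INR Q ->
  exists y, 0 <= y <= 1 /\
    sqrt (INR Q) ^ 3 / 100000 <=
    Cmod (csum (seq 1 M) (fun k => e ((2 * INR m0 * INR k - INR k ^ 2) * y + INR k * s))).
Proof.
  intros Hq Hdir Hq32 HQ1 HQ2 HQbig.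
  assert (Hq' : 1 <= INR q) by (apply (le_INR 1); lia).
  assert (HqQ : INR q <= INR Q) by (apply le_INR; lia).
  assert (HQq : INR Q <= 32 * INR q).
  { replace 32 with (INR 32) by (simpl; ring). rewrite <- mult_INR. apply le_INR; lia. }
  set (th := s - INR r / INR q).
  assert (Hth : Rabs th * INR q <= / INR Q).
  { rewrite <- (Rabs_right (INR q)) by lra. rewrite <- Rabs_mult. unfold th.
    replace ((s - INR r / INR q) * INR q) with (INR q * s - INR r) by (field; lra). exact Hdir. }
  assert (HthQ : Rabs th * INR q * INR Q <= 1).
  { apply Rmult_le_compat_r with (r := INR Q) in Hth; [|lra]. rewrite Rinv_l in Hth by lra. lra. }
  pose proof (Rabs_pos th) as Hth0.
  (* |th| <= 1/(qQ) < 32/Q^2, and Q^2 >= 512 M. *)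
  assert (HMth : INR M * Rabs th <= / 16).
  { assert (Rabs th * INR Q * INR Q <= 32) by nra. nra. }
  set (P := if Nat.even q then (2 * q)%nat else q).
  set (u := if Nat.even q then (2 * (Z.of_nat m0 + Z.of_nat r))%Z else (2 * Z.of_nat m0 + Z.of_nat r)%Z).
  assert (HPq : (q <= P <= 2 * q)%nat) by (unfold P; destruct Nat.even; lia).
  assert (HP1 : INR q <= INR P) by (apply le_INR; lia).
  assert (HP2 : INR P <= 2 * INR q).
  { replace 2 with (INR 2) by reflexivity. rewrite <- mult_INR. apply le_INR; lia. }
  assert (Hu : forall h, (2 * h = P)%nat -> exists z, (u * Z.of_nat h - Z.of_nat h * Z.of_nat h = z * Z.of_nat P)%Z).
  { intros h Hh. unfold P, u in *. destruct (Nat.even q) eqn:Ev.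
    - apply Nat.even_spec in Ev as [w Hw]. exists (Z.of_nat m0 + Z.of_nat r - Z.of_nat w)%Z.
      replace h with q by lia. subst q. rewrite !Nat2Z.inj_mul. ring.
    - exfalso. assert (Nat.even q = true); [|congruence]. apply Nat.even_spec. now exists h. }
  exists (/ INR P). split.
  { split; [left; apply Rinv_0_lt_compat; lra|]. rewrite <- Rinv_1. apply Rinv_le_contravar; lra. }
  rewrite (csum_ext _ _ (fun k => e (quad_phase P u k + INR k * th))).
  2:{ intros k _. f_equal. unfold quad_phase, u, P, th. rewrite minus_IZR, !mult_IZR, <- !INR_IZR_INZ.
      destruct (Nat.even q).
      - rewrite mult_IZR, plus_IZR, <- !INR_IZR_INZ, mult_INR. simpl (INR 2). field. lra.
      - rewrite plus_IZR, mult_IZR, <- !INR_IZR_INZ. field. lra. }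
  assert (Hsq : 0 <= INR Q) by lra. set (w := sqrt (INR Q)). assert (Hw2 : w ^ 2 = INR Q) by (apply pow2_sqrt; auto).
  assert (Hw0 : 200000 <= w).
  { unfold w. rewrite <- (sqrt_pow2 200000) by lra. apply sqrt_le_1_alt. exact HQbig. }
  assert (HsP : w / 6 <= sqrt (INR P)).
  { rewrite <- (sqrt_pow2 (w / 6)) by lra. apply sqrt_le_1_alt. nra. }
  eapply Rle_trans; [|apply incomplete_gauss_lower; auto; [lia| |lra]].
  2:{ assert (INR P ^ 2 <= 4 * (INR q * INR Q)) by nra.
      apply Rle_trans with (4 * (INR q * INR Q) * Rabs th); [apply Rmult_le_compat_r; auto|]. lra. }
  assert (HJ : INR Q / 2048 - 1 <= INR (M / P)).
  { pose proof (INR_div_gt M P ltac:(lia)) as Hg. rewrite plus_INR in Hg. simpl (INR 1) in Hg.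
    assert (INR Q / 2048 <= INR M / INR P); [|lra].
    apply Rmult_le_reg_r with (INR P); [lra|]. unfold Rdiv at 2. rewrite Rmult_assoc, Rinv_l, Rmult_1_r by lra. nra. }
  assert (HJ2 : INR Q / 4096 <= INR (M / P)) by nra.
  (* The main term is w^3/49152 with w = sqrt Q; for w >= 200000 its surplus over w^3/100000 covers
     the errors, which are of order w^2. *)
  apply Rle_trans with (INR Q / 4096 / 2 * (w / 6 - 32) - 2 * INR Q).
  - rewrite <- Hw2. nra.
  - assert (INR Q / 4096 / 2 * (w / 6 - 32) <= INR (M / P) / 2 * (sqrt (INR P) - 32)); [|lra].
    apply Rmult_le_compat; lra.
Qed.

(** * The exceptional set of [t] *)

Lemma bump_integral al be T : 0 < al -> 0 <= T ->
  exists I, is_RInt (fun t => 2 / (1 + (al * t - be) ^ 2)) 0 T I /\ I <= 8 / al.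
Proof.
  intros Ha HT. set (F := fun t => 2 * atan (al * t - be) / al).
  assert (Hpos : forall t, 0 < 1 + (al * t - be) ^ 2) by (intros t; pose proof (pow2_ge_0 (al * t - be)); lra).
  exists (minus (F T) (F 0)). split.
  - apply (is_RInt_derive (V := R_CompleteNormedModule)).
    + intros t _. unfold F. specialize (Hpos t). auto_derive; auto. unfold Rsqr. field. split; [|lra].
      simpl in Hpos. lra.
    + intros t _. apply (ex_derive_continuous (K := R_AbsRing) (V := R_NormedModule)). specialize (Hpos t).
      auto_derive. simpl in *. lra.
  - unfold minus, plus, opp, F; simpl. pose proof (atan_bound (al * T - be)). pose proof (atan_bound (al * 0 - be)).
    pose proof PI_4.
    replace (2 * atan (al * T - be) / al + - (2 * atan (al * 0 - be) / al)) with
      ((2 * (atan (al * T - be) - atan (al * 0 - be))) / al) by (field; lra).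
    unfold Rdiv. apply Rmult_le_compat_r; [left; now apply Rinv_0_lt_compat|lra].
Qed.

(* Majorant, with easily computed integral, of the set where some q <= Q/32 satisfies |q lam t - r| <= 1/Q. *)
Definition bad_weight (Q Lc : nat) (lam t : R) : R :=
  rsum (seq 1 (Q / 32)) (fun q => rsum (seq 0 (q * Lc + 2)) (fun r =>
    2 / (1 + (INR Q * INR q * lam * t - INR Q * INR r) ^ 2))).

(** For each q there are [q * Lc + 2] values of r, each costing at most 8/(Q q lam), so every q
    costs about the same; there are at most Q/32 of them. For [Lc] close to [lam * T] the total is
    about T/4: this is the purpose of the 32. *)
Lemma bad_weight_integral (Q Lc : nat) lam T : (1 <= Q)%nat -> 0 < lam -> 0 <= T ->
  exists I, is_RInt (bad_weight Q Lc lam) 0 T I /\ I <= (INR Lc + 2) / (4 * lam).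
Proof.
  intros HQ Hl HT. assert (HQ' : 1 <= INR Q) by (apply (le_INR 1); lia).
  set (f := fun (q r : nat) t => 2 / (1 + (INR Q * INR q * lam * t - INR Q * INR r) ^ 2)).
  assert (Hf : forall q r, In q (seq 1 (Q / 32)) -> is_RInt (f q r) 0 T (RInt (f q r) 0 T) /\ RInt (f q r) 0 T <= 8 / (INR Q * INR q * lam)).
  { intros q r Hq. apply in_seq in Hq. assert (Hq' : 1 <= INR q) by (apply (le_INR 1); lia).
    destruct (bump_integral (INR Q * INR q * lam) (INR Q * INR r) T) as [I [HI HI2]]; auto.
    { repeat apply Rmult_lt_0_compat; lra. }
    change (is_RInt (f q r) 0 T I) in HI. rewrite (is_RInt_unique _ _ _ _ HI). split; auto. }
  exists (rsum (seq 1 (Q / 32)) (fun q => rsum (seq 0 (q * Lc + 2)) (fun r => RInt (f q r) 0 T))). split.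
  - unfold bad_weight. apply is_RInt_rsum; intros q Hq. apply is_RInt_rsum; intros r _. now apply Hf.
  - apply Rle_trans with (rsum (seq 1 (Q / 32)) (fun _ => (INR Lc + 2) * (8 / (INR Q * lam)))).
    + apply rsum_le; intros q Hq. apply Rle_trans with (rsum (seq 0 (q * Lc + 2)) (fun _ => 8 / (INR Q * INR q * lam))).
      { apply rsum_le; intros r _. now apply Hf. }
      apply in_seq in Hq. assert (Hq' : 1 <= INR q) by (apply (le_INR 1); lia).
      rewrite rsum_const, length_seq, plus_INR, mult_INR. simpl (INR 2).
      replace (8 / (INR Q * INR q * lam)) with (/ INR q * (8 / (INR Q * lam))) by (field; lra).
      rewrite <- Rmult_assoc. apply Rmult_le_compat_r; [apply Rdiv_le_0_compat; [lra|apply Rmult_lt_0_compat; lra]|].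
      apply Rmult_le_reg_r with (INR q); [lra|]. rewrite Rmult_assoc, Rinv_l by lra. nra.
    + rewrite rsum_const, length_seq. pose proof (INR_div_le Q 32 ltac:(lia)) as Hd.
      replace (INR 32) with 32 in Hd by (simpl; ring).
      assert (Hk : 0 <= (INR Lc + 2) * (8 / (INR Q * lam))).
      { apply Rmult_le_pos; [pose proof (pos_INR Lc); lra|]. apply Rdiv_le_0_compat; [lra|apply Rmult_lt_0_compat; lra]. }
      apply Rle_trans with (INR Q / 32 * ((INR Lc + 2) * (8 / (INR Q * lam)))); [now apply Rmult_le_compat_r|].
      apply Req_le. field. lra.
Qed.

(** * The extremal sequence and its nodes *)

Definition node (m0 k : nat) : nat := (k * (2 * m0 - k))%nat.

(** The indicator of the nodes, written as a sum over k so that exchanging sums turns [expsum] into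
    a sum over k. *)
Definition node_coeff (m0 M n : nat) : C :=
  csum (seq 1 M) (fun k => if Nat.eqb (node m0 k) n then RtoC 1 else RtoC 0).

Definition root_sequence (N m0 : nat) (n : nat) : R :=
  6 * INR N * sqrt (INR N) * (INR m0 - sqrt (INR m0 ^ 2 - INR n)) / INR N ^ 2.

(** With s = sqrt N the roots lie between s and 7s/4, as 7/4 exceeds sqrt 3. Rationalising, the
    first differences are 6/(s (x+y)) and the second are 12/(s D) with 8 s^3 <= D <= 48 s^3. The
    factor 6 is chosen for 12/48 = 1/4. *)
Lemma root_sequence_convex N m0 : (1 <= N)%nat -> 2 * INR N <= INR m0 ^ 2 <= 3 * INR N ->
  uniformly_convex N (root_sequence N m0).
Proof.
  intros HN Hm. assert (HN' : 1 <= INR N) by (apply (le_INR 1); lia).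
  set (s := sqrt (INR N)). assert (Hs : s ^ 2 = INR N) by (apply pow2_sqrt; lra).
  assert (Hs1 : 1 <= s) by (rewrite <- sqrt_1; apply sqrt_le_1_alt; lra).
  set (g := fun n : nat => sqrt (INR m0 ^ 2 - INR n)).
  assert (Hg : forall n, (n <= N)%nat -> g n ^ 2 = INR m0 ^ 2 - INR n /\ s <= g n <= 7 / 4 * s).
  { intros n Hn. apply le_INR in Hn. pose proof (pos_INR n). split; [apply pow2_sqrt; lra|]. split.
    - apply sqrt_le_1_alt. lra.
    - rewrite <- (sqrt_pow2 (7 / 4 * s)) by lra. apply sqrt_le_1_alt. nra. }
  assert (Ha : forall n, root_sequence N m0 n = 6 * (INR m0 - g n) / s).
  { intros n. unfold root_sequence. fold s. fold (g n). rewrite <- Hs. field. lra. }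
  split.
  - intros n H1 H2. rewrite !Ha. destruct (Hg n ltac:(lia)) as [E1 B1]. destruct (Hg (S n) ltac:(lia)) as [E2 B2].
    rewrite S_INR in E2. set (x := g n) in *. set (y := g (S n)) in *.
    assert (E : (x - y) * (x + y) = 1) by nra.
    replace (6 * (INR m0 - y) / s - 6 * (INR m0 - x) / s) with (6 * (x - y) / s) by (field; lra).
    rewrite <- Hs. assert (Hxy : x - y = / (x + y)) by (field_simplify_eq; lra). rewrite Hxy. split.
    + replace (/ (4 * s ^ 2)) with (/ (4 * s) / s) by (field; lra). unfold Rdiv.
      apply Rmult_le_compat_r; [left; apply Rinv_0_lt_compat; lra|].
      apply Rle_trans with (6 * / (4 * s)); [assert (0 < / (4 * s)) by (apply Rinv_0_lt_compat; lra); lra|].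
      apply Rmult_le_compat_l; [lra|]. apply Rinv_le_contravar; lra.
    + replace (4 / s ^ 2) with (8 * / (2 * s) / s) by (field; lra). unfold Rdiv.
      apply Rmult_le_compat_r; [left; apply Rinv_0_lt_compat; lra|].
      apply Rle_trans with (6 * / (2 * s)); [|assert (0 < / (2 * s)) by (apply Rinv_0_lt_compat; lra); lra].
      apply Rmult_le_compat_l; [lra|]. apply Rinv_le_contravar; lra.
  - intros n H1 H2. rewrite !Ha. destruct (Hg n ltac:(lia)) as [E1 B1]. destruct (Hg (S n) ltac:(lia)) as [E2 B2].
    destruct (Hg (S (S n)) ltac:(lia)) as [E3 B3].
    rewrite !S_INR in E3. rewrite S_INR in E2. set (x := g n) in *. set (y := g (S n)) in *. set (z := g (S (S n))) in *.
    assert (Exy : x - y = / (x + y)) by (field_simplify_eq; nra).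
    assert (Eyz : y - z = / (y + z)) by (field_simplify_eq; nra).
    assert (Exz : x - z = 2 * / (x + z)) by (field_simplify_eq; nra).
    replace (6 * (INR m0 - z) / s - 6 * (INR m0 - y) / s - (6 * (INR m0 - y) / s - 6 * (INR m0 - x) / s))
      with (6 * ((y - z) - (x - y)) / s) by (field; lra).
    rewrite Exy, Eyz.
    replace (/ (y + z) - / (x + y)) with ((x - z) * / ((y + z) * (x + y))) by (field; lra). rewrite Exz.
    set (D := (x + z) * ((y + z) * (x + y))).
    assert (HD1 : 8 * s ^ 3 <= D).
    { replace (8 * s ^ 3) with ((2 * s) * ((2 * s) * (2 * s))) by ring. unfold D. repeat apply Rmult_le_compat; try lra; nra. }
    assert (HD2 : D <= 48 * s ^ 3).
    { apply Rle_trans with ((7 / 2 * s) * ((7 / 2 * s) * (7 / 2 * s))).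
      - unfold D. repeat apply Rmult_le_compat; try lra; nra.
      - assert (0 < s ^ 3) by (apply pow_lt; lra). nra. }
    assert (Hs3 : 0 < s ^ 3) by (apply pow_lt; lra).
    replace (6 * (2 * / (x + z) * / ((y + z) * (x + y))) / s) with (12 * / D / s) by (unfold D; field; lra).
    rewrite <- Hs. split.
    + replace (/ (4 * (s ^ 2) ^ 2)) with (12 * / (48 * s ^ 3) / s) by (field; lra). unfold Rdiv.
      apply Rmult_le_compat_r; [left; apply Rinv_0_lt_compat; lra|].
      apply Rmult_le_compat_l; [lra|]. apply Rinv_le_contravar; lra.
    + replace (4 / (s ^ 2) ^ 2) with (32 * / (8 * s ^ 3) / s) by (field; lra). unfold Rdiv.
      apply Rmult_le_compat_r; [left; apply Rinv_0_lt_compat; lra|].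
      apply Rle_trans with (12 * / (8 * s ^ 3)); [|assert (0 < / (8 * s ^ 3)) by (apply Rinv_0_lt_compat; lra); lra].
      apply Rmult_le_compat_l; [lra|]. apply Rinv_le_contravar; lra.
Qed.

Section Nodes.
Variables (N m0 M : nat).
Hypothesis HN : (1 <= N)%nat.
Hypothesis Hm0 : 2 * INR N <= INR m0 ^ 2 <= 3 * INR N.
Hypothesis HM : INR M <= sqrt (INR N) / 4.

(** Prevents truncation of the subtraction in [node] and keeps k on the increasing branch of the
    parabola, where nodes are distinct. *)
Lemma M_lt_m0 : (M < m0)%nat.
Proof.
  assert (HN' : 1 <= INR N) by (apply (le_INR 1); lia).
  assert (Hs : sqrt (INR N) ^ 2 = INR N) by (apply pow2_sqrt; lra).
  pose proof (sqrt_lt_R0 (INR N) ltac:(lra)). apply INR_lt. pose proof (pos_INR m0). nra.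
Qed.

Lemma INR_node k : (k <= M)%nat -> INR (node m0 k) = 2 * INR m0 * INR k - INR k ^ 2.
Proof.
  intros Hk. pose proof M_lt_m0. unfold node. rewrite mult_INR, minus_INR, mult_INR by lia. simpl (INR 2). ring.
Qed.

Lemma node_range k : (1 <= k <= M)%nat -> (1 <= node m0 k <= N)%nat.
Proof.
  intros Hk. pose proof M_lt_m0. split; [unfold node; nia|]. apply INR_le. rewrite INR_node by lia.
  assert (HN' : 1 <= INR N) by (apply (le_INR 1); lia).
  assert (Hs : sqrt (INR N) ^ 2 = INR N) by (apply pow2_sqrt; lra).
  pose proof (sqrt_lt_R0 (INR N) ltac:(lra)) as Hs0. set (s := sqrt (INR N)) in *.
  assert (Hm : INR m0 <= 2 * s) by (pose proof (pos_INR m0); nra).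
  assert (Hk' : INR k <= s / 4) by (apply Rle_trans with (INR M); auto; apply le_INR; lia).
  pose proof (pos_INR k). pose proof (pos_INR m0). nra.
Qed.

Lemma node_inj k k' : (k <= M)%nat -> (k' <= M)%nat -> node m0 k = node m0 k' -> k = k'.
Proof. intros Hk Hk' E. pose proof M_lt_m0. unfold node in E. nia. Qed.

Lemma expsum_nodes t y :
  expsum N (root_sequence N m0) (node_coeff m0 M) t (y * INR N) =
  csum (seq 1 M) (fun k => e ((2 * INR m0 * INR k - INR k ^ 2) * y + INR k * (6 * INR N * sqrt (INR N) / INR N ^ 2 * t))).
Proof.
  assert (HN' : 1 <= INR N) by (apply (le_INR 1); lia).
  rewrite expsum_csum. unfold node_coeff.
  rewrite (csum_ext _ _ (fun n => csum (seq 1 M) (fun k => if Nat.eqb (node m0 k) n then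
     e (y * INR N * INR n / INR N + t * root_sequence N m0 n) else RtoC 0))).
  2:{ intros n _. rewrite <- csum_scal_r. apply csum_ext; intros k _. destruct Nat.eqb; ring. }
  rewrite csum_swap. apply csum_ext; intros k Hk. apply in_seq in Hk.
  rewrite (csum_indic (seq 1 N) (node m0 k) (fun n => e (y * INR N * INR n / INR N + t * root_sequence N m0 n))).
  - f_equal. unfold root_sequence. pose proof M_lt_m0. rewrite INR_node by lia.
    replace (INR m0 ^ 2 - (2 * INR m0 * INR k - INR k ^ 2)) with ((INR m0 - INR k) ^ 2) by ring.
    rewrite sqrt_pow2; [field; lra|]. rewrite <- minus_INR by lia. apply pos_INR.
  - apply seq_NoDup.
  - apply in_seq. pose proof (node_range k ltac:(lia)). lia.
Qed.

Lemma node_energy_le : rsum (seq 1 N) (fun n => Cmod (node_coeff m0 M n) ^ 2) <= INR M.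
Proof.
  set (c := fun n => rsum (seq 1 M) (fun k => if Nat.eqb (node m0 k) n then 1 else 0)).
  assert (Hc : forall n, 0 <= c n <= 1).
  { intros n. split; [apply rsum_ge0; intros; destruct Nat.eqb; lra|]. unfold c.
    destruct (classic (exists k, In k (seq 1 M) /\ node m0 k = n)) as [[k0 [Hk0 E0]]|Hno].
    - apply in_seq in Hk0. rewrite (rsum_ext _ _ (fun k => if Nat.eqb k0 k then 1 else 0)).
      + apply rsum_indic_le, seq_NoDup.
      + intros k Hk. apply in_seq in Hk. destruct (Nat.eqb_spec (node m0 k) n) as [E|E]; destruct (Nat.eqb_spec k0 k) as [E'|E']; auto.
        * exfalso. apply E', node_inj; try lia; congruence.
        * exfalso. apply E. now subst k.
    - rewrite rsum_0; [lra|]. intros k Hk. destruct (Nat.eqb_spec (node m0 k) n) as [E|E]; auto.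
      exfalso. apply Hno. now exists k. }
  apply Rle_trans with (rsum (seq 1 N) c).
  - apply rsum_le; intros n _. specialize (Hc n).
    assert (Hmod : Cmod (node_coeff m0 M n) <= c n).
    { unfold node_coeff. eapply Rle_trans; [apply csum_mod|]. apply rsum_le; intros k _.
      destruct Nat.eqb; rewrite Cmod_R, ?Rabs_R1, ?Rabs_R0; lra. }
    pose proof (Cmod_ge_0 (node_coeff m0 M n)). nra.
  - unfold c. rewrite rsum_swap. apply Rle_trans with (rsum (seq 1 M) (fun _ => 1)).
    + apply rsum_le; intros k _. apply rsum_indic_le, seq_NoDup.
    + rewrite rsum_const, length_seq. lra.
Qed.

Lemma node_energy_pos : (1 <= M)%nat -> 0 < rsum (seq 1 N) (fun n => Cmod (node_coeff m0 M n) ^ 2).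
Proof.
  intros H1. apply Rlt_le_trans with (Cmod (node_coeff m0 M (node m0 1)) ^ 2).
  - unfold node_coeff. rewrite (csum_ext _ _ (fun k => if Nat.eqb 1 k then RtoC 1 else RtoC 0)).
    + rewrite (csum_indic (seq 1 M) 1 (fun _ => RtoC 1)); [rewrite Cmod_1; lra|apply seq_NoDup|apply in_seq; lia].
    + intros k Hk. apply in_seq in Hk. destruct (Nat.eqb_spec (node m0 k) (node m0 1)) as [E|E]; destruct (Nat.eqb_spec 1 k) as [E'|E']; auto.
      * exfalso. apply E'. symmetry. apply node_inj; auto; lia.
      * exfalso. apply E. now subst k.
  - apply (rsum_term (seq 1 N) (fun n => Cmod (node_coeff m0 M n) ^ 2)).
    + apply in_seq. pose proof (node_range 1 ltac:(lia)). lia.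
    + intros; apply pow2_ge_0.
Qed.
End Nodes.

(** * Lower bound for the fourth moment *)

Lemma bad_weight_ge0 Q Lc lam t : 0 <= bad_weight Q Lc lam t.
Proof.
  apply rsum_ge0; intros q _. apply rsum_ge0; intros r _.
  left. apply Rdiv_lt_0_compat; [lra|]. pose proof (pow2_ge_0 (INR Q * INR q * lam * t - INR Q * INR r)). lra.
Qed.

Lemma bad_weight_ge1 Q Lc lam t q r : (1 <= Q)%nat -> (1 <= q)%nat -> (32 * q <= Q)%nat -> lam * t <= INR Lc ->
  Rabs (INR q * (lam * t) - INR r) <= / INR Q -> 1 <= bad_weight Q Lc lam t.
Proof.
  intros HQ Hq HqQ HL Hr. assert (HQ' : 1 <= INR Q) by (apply (le_INR 1); lia).
  assert (HiQ : / INR Q <= 1) by (rewrite <- Rinv_1; apply Rinv_le_contravar; lra).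
  assert (Hterm : forall q r, 0 <= 2 / (1 + (INR Q * INR q * lam * t - INR Q * INR r) ^ 2)).
  { intros q' r'. left. apply Rdiv_lt_0_compat; [lra|]. pose proof (pow2_ge_0 (INR Q * INR q' * lam * t - INR Q * INR r')). lra. }
  apply Rle_trans with (2 / (1 + (INR Q * INR q * lam * t - INR Q * INR r) ^ 2)).
  - set (X := INR Q * INR q * lam * t - INR Q * INR r).
    assert (HX : Rabs X <= 1).
    { unfold X. replace (INR Q * INR q * lam * t - INR Q * INR r) with (INR Q * (INR q * (lam * t) - INR r)) by ring.
      rewrite Rabs_mult, (Rabs_right (INR Q)) by lra. apply Rmult_le_compat_l with (r := INR Q) in Hr; [|lra].
      rewrite Rinv_r in Hr by lra. exact Hr. }
    assert (X ^ 2 <= 1).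
    { rewrite <- pow2_abs. replace 1 with (1 ^ 2) by ring. apply pow_incr. split; [apply Rabs_pos|exact HX]. }
    pose proof (pow2_ge_0 X). apply Rmult_le_reg_r with (1 + X ^ 2); [lra|]. unfold Rdiv. rewrite Rmult_assoc, Rinv_l; lra.
  (* [r] exceeds q lam t <= q Lc by at most 1/Q <= 1, so the range of r in [bad_weight] contains
     it. *)
  - assert (Hr2 : (r < q * Lc + 2)%nat).
    { apply INR_lt. rewrite plus_INR, mult_INR. simpl (INR 2). apply Rabs_le_between in Hr.
      assert (INR q * (lam * t) <= INR q * INR Lc) by (apply Rmult_le_compat_l; auto; apply pos_INR). lra. }
    apply Rle_trans with (rsum (seq 0 (q * Lc + 2)) (fun r => 2 / (1 + (INR Q * INR q * lam * t - INR Q * INR r) ^ 2))).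
    + apply (rsum_term (seq 0 (q * Lc + 2)) (fun r => 2 / (1 + (INR Q * INR q * lam * t - INR Q * INR r) ^ 2)) r); auto.
      apply in_seq; lia.
    + apply (rsum_term (seq 1 (Q / 32)) (fun q => rsum (seq 0 (q * Lc + 2)) (fun r => 2 / (1 + (INR Q * INR q * lam * t - INR Q * INR r) ^ 2))) q).
      * apply in_seq. split; auto. assert (q <= Q / 32)%nat; [|lia]. apply Nat.div_le_lower_bound; lia.
      * intros; apply rsum_ge0; auto.
Qed.

(** The integrand is compared pointwise with w^4 (1 - [bad_weight]), which is at most 0 where the
    Dirichlet denominator is too small and at most w^4 elsewhere. Thus the exceptional set never has
    to be measured. *)
Lemma quartic_lower (N m0 M Q : nat) : (1 <= N)%nat -> 2 * INR N <= INR m0 ^ 2 <= 3 * INR N ->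
  INR M <= sqrt (INR N) / 4 ->
  512 * INR M <= INR Q ^ 2 -> INR Q ^ 2 <= 1024 * INR M -> 200000 ^ 2 <= INR Q ->
  (sqrt (INR Q) ^ 3 / 100000) ^ 4 * (INR N ^ 2 / 2) <=
    RInt (fun t => maxfun N (root_sequence N m0) (node_coeff m0 M) t ^ 4) 0 (INR N ^ 2).
Proof.
  intros HN Hm0 HM HQ1 HQ2 HQb. assert (HN' : 1 <= INR N) by (apply (le_INR 1); lia).
  assert (HQn : (1 <= Q)%nat) by (destruct Q; [simpl in HQb; lra|lia]).
  assert (Hs1 : 1 <= sqrt (INR N)) by (rewrite <- sqrt_1; apply sqrt_le_1_alt; lra).
  set (a := root_sequence N m0). set (b := node_coeff m0 M).
  set (lam := 6 * INR N * sqrt (INR N) / INR N ^ 2).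
  assert (HN2 : 0 < INR N ^ 2) by (apply pow_lt; lra).
  set (L := 6 * INR N * sqrt (INR N)). assert (HL : 6 <= L) by (unfold L; nra).
  assert (Hlam : 0 < lam) by (apply Rdiv_lt_0_compat; auto; unfold L in HL; lra).
  assert (HlamL : lam * INR N ^ 2 = L) by (unfold lam, L; field; lra).
  destruct (nfloor_ex L) as [f [Hf1 Hf2]]; [lra|]. set (Lc := (f + 1)%nat).
  assert (HLc : L <= INR Lc <= L + 1) by (unfold Lc; rewrite plus_INR; simpl (INR 1); lra).
  destruct (bad_weight_integral Q Lc lam (INR N ^ 2) HQn Hlam) as [I [HI HIle]]; [lra|].
  (* [INR Lc + 2 <= L + 3 <= 2 * L], because [6 <= L]. *)
  assert (HI2 : I <= INR N ^ 2 / 2).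
  { eapply Rle_trans; [exact HIle|]. apply Rmult_le_reg_r with (4 * lam); [lra|].
    unfold Rdiv at 1. rewrite Rmult_assoc, Rinv_l, Rmult_1_r by lra.
    replace (INR N ^ 2 / 2 * (4 * lam)) with (2 * L) by (rewrite <- HlamL; field). lra. }
  set (w := sqrt (INR Q) ^ 3 / 100000).
  assert (Hw : 0 <= w) by (apply Rdiv_le_0_compat; [apply pow_le, sqrt_pos|lra]).
  assert (Hw4 : 0 <= w ^ 4) by now apply pow_le.
  assert (HR : is_RInt (fun t => w ^ 4 * (1 - bad_weight Q Lc lam t)) 0 (INR N ^ 2) (w ^ 4 * (INR N ^ 2 - I))).
  { apply (is_RInt_scal (V := R_NormedModule)). apply (is_RInt_minus (V := R_NormedModule)); auto.
    pose proof (@is_RInt_const R_NormedModule 0 (INR N ^ 2) 1) as H0.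
    change (is_RInt (fun _ => 1) 0 (INR N ^ 2) ((INR N ^ 2 - 0) * 1)) in H0. now rewrite Rminus_0_r, Rmult_1_r in H0. }
  apply Rle_trans with (w ^ 4 * (INR N ^ 2 - I)); [apply Rmult_le_compat_l; lra|].
  rewrite <- (is_RInt_unique _ _ _ _ HR). apply RInt_le.
  - lra.
  - eexists; exact HR.
  - apply ex_RInt_maxfun.
  - intros t Ht. pose proof (maxfun_ge0 N a b t) as Hg0. pose proof (bad_weight_ge0 Q Lc lam t) as Hb0.
    assert (Hlt : lam * t <= L) by (rewrite <- HlamL; apply Rmult_le_compat_l; lra).
    destruct (dirichlet_approximation (lam * t) Q) as (q & r & Hq & Hr); auto.
    { apply Rmult_le_pos; lra. }
    destruct (le_lt_dec (32 * q) Q) as [Hbad|Hgood].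
    + assert (Hb1 : 1 <= bad_weight Q Lc lam t) by (apply (bad_weight_ge1 Q Lc lam t q r); auto; lra || lia).
      assert (0 <= maxfun N a b t ^ 4) by now apply pow_le. nra.
    + destruct (large_value m0 M Q q r (lam * t)) as (y & Hy & Hyv); auto.
      assert (Hgw : w <= maxfun N a b t).
      { eapply Rle_trans; [exact Hyv|]. unfold lam. rewrite <- (expsum_nodes N m0 M HN Hm0 HM).
        apply (proj1 (maxfun_lub N a b t)). split; [apply Rmult_le_pos; lra|].
        rewrite <- (Rmult_1_l (INR N)) at 2. apply Rmult_le_compat_r; lra. }
      apply Rle_trans with (w ^ 4); [nra|]. apply pow_incr; lra.
Qed.

(** A single exponential already gives N^(1/2), which falls short of N^(5/8) by N^(1/8) only; this
    settles all N below a fixed bound. *)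
Lemma delta_lower N a : (1 <= N)%nat ->
  let b := fun n => if Nat.eqb n 1 then RtoC 1 else RtoC 0 in
  l2norm N b = 1 /\ sqrt (INR N) <= L4norm N a b.
Proof.
  intros HN b. assert (HN' : 1 <= INR N) by (apply (le_INR 1); lia).
  assert (Hexp : forall t x, Cmod (expsum N a b t x) = 1).
  { intros t x. rewrite expsum_csum.
    rewrite (csum_ext _ _ (fun n => if Nat.eqb 1 n then e (x * INR n / INR N + t * a n) else RtoC 0)).
    - rewrite (csum_indic (seq 1 N) 1 (fun n => e (x * INR n / INR N + t * a n)));
        [apply Cmod_e|apply seq_NoDup|apply in_seq; lia].
    - intros n _. unfold b. rewrite Nat.eqb_sym. destruct Nat.eqb; ring. }
  split.
  - rewrite l2norm_rsum. rewrite (rsum_ext _ _ (fun n => if Nat.eqb 1 n then 1 else 0)).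
    + rewrite (rsum_indic (seq 1 N) 1 (fun _ => 1)); [apply sqrt_1|apply seq_NoDup|apply in_seq; lia].
    + intros n _. unfold b. rewrite Nat.eqb_sym. destruct Nat.eqb; rewrite ?Cmod_1, ?Cmod_0; ring.
  - unfold L4norm. apply le_sqrt_sqrt; [apply sqrt_pos|].
    replace (sqrt (INR N) ^ 4) with ((sqrt (INR N) ^ 2) ^ 2) by ring. rewrite pow2_sqrt by lra.
    assert (H0 : is_RInt (fun _ => 1) 0 (INR N ^ 2) (INR N ^ 2)).
    { pose proof (@is_RInt_const R_NormedModule 0 (INR N ^ 2) 1) as H0.
      change (is_RInt (fun _ => 1) 0 (INR N ^ 2) ((INR N ^ 2 - 0) * 1)) in H0. now rewrite Rminus_0_r, Rmult_1_r in H0. }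
    apply Rle_trans with (RInt (fun _ => 1) 0 (INR N ^ 2)); [rewrite (is_RInt_unique _ _ _ _ H0); lra|].
    apply RInt_le; [apply pow2_ge_0|eexists; exact H0|apply ex_RInt_maxfun|].
    intros t _. apply pow_R1_Rle. rewrite <- (Hexp t 0). apply (proj1 (maxfun_lub N a b t)). lra.
Qed.

Theorem maximal_lower_bound : exists C0 : R, 0 < C0 /\
  forall N : nat, (10 <= N)%nat ->
    exists (a : nat -> R) (b : nat -> C),
      uniformly_convex N a /\ 0 < l2norm N b /\
      L4norm N a b >= C0 * Rpower (INR N) (5 / 8) * l2norm N b.
Proof.
  exists (/ 10 ^ 6). split; [apply Rinv_0_lt_compat; lra|]. intros N HN.
  assert (HN' : 10 <= INR N) by (replace 10 with (INR 10) by (simpl; ring); apply le_INR; lia).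
  destruct (nfloor_ex (sqrt (2 * INR N))) as [f [Hf1 Hf2]]; [apply sqrt_pos|].
  set (m0 := (f + 1)%nat).
  set (p := Rpower (INR N) (/ 8)). assert (Hp1 : 1 <= p) by (apply Rpower_ge_1; lra).
  assert (Hp8 : p ^ 8 = INR N).
  { unfold p. rewrite <- Rpower_pow by apply Rpower_pos. rewrite Rpower_mult.
    replace (/ 8 * INR 8) with 1 by (simpl; field). apply Rpower_1; lra. }
  assert (Hp5 : Rpower (INR N) (5 / 8) = p ^ 5).
  { unfold p. rewrite <- Rpower_pow by apply Rpower_pos. rewrite Rpower_mult. f_equal. simpl. field. }
  assert (Hp4 : sqrt (INR N) = p ^ 4).
  { rewrite <- Hp8. replace (p ^ 8) with ((p ^ 4) ^ 2) by ring. apply sqrt_pow2. apply pow_le; lra. }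
  assert (Hm0 : 2 * INR N <= INR m0 ^ 2 <= 3 * INR N).
  { assert (Hy2 : sqrt (2 * INR N) ^ 2 = 2 * INR N) by (apply pow2_sqrt; lra).
    assert (Hm : INR m0 = INR f + 1) by (unfold m0; rewrite plus_INR; reflexivity).
    (* Here N >= 10 is needed: m0 <= y + 1, and (y+1)^2 <= 3 y^2/2 holds from y = 4.45 on, while
       sqrt 20 > 4.47. *)
    assert (Hy : 4.47 <= sqrt (2 * INR N)) by (rewrite <- (sqrt_pow2 4.47) by lra; apply sqrt_le_1_alt; lra).
    set (y := sqrt (2 * INR N)) in *. rewrite <- Hy2. replace (3 * INR N) with (3 / 2 * y ^ 2) by lra. split; nra. }
  (* p = N^(1/8). Up to 10^6 the constant 10^(-6) makes up for the deficit of the single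
     exponential; beyond it [Q] is large enough for [quartic_lower]. *)
  rewrite Hp5. destruct (Rle_dec p 1000000) as [Hsmall|Hlarge].
  - destruct (delta_lower N (root_sequence N m0) ltac:(lia)) as [E1 E2].
    exists (root_sequence N m0), (fun n => if Nat.eqb n 1 then RtoC 1 else RtoC 0).
    split; [apply root_sequence_convex; auto; lia|]. rewrite E1. split; [lra|].
    apply Rle_ge. eapply Rle_trans; [|exact E2]. rewrite Hp4.
    assert (0 <= p ^ 4) by (apply pow_le; lra). replace (p ^ 5) with (p ^ 4 * p) by ring. 
    apply Rmult_le_reg_l with (10 ^ 6); [lra|]. rewrite Rmult_1_r, <- Rmult_assoc, Rinv_r by lra. nra.
  - assert (Hp4b : 10 ^ 24 <= p ^ 4) by (replace (10 ^ 24) with (1000000 ^ 4) by ring; apply pow_incr; lra).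
    destruct (nfloor_ex (sqrt (INR N) / 4)) as [M [HM1 HM2]]; [rewrite Hp4; lra|].
    rewrite Hp4 in HM2.
    assert (HM8 : p ^ 4 / 8 <= INR M) by lra.
    (* [Q] is the square root of 512 M rounded up; the gap between 512 and 1024 leaves room for the
       rounding. *)
    destruct (nfloor_ex (sqrt (512 * INR M))) as [Q' [HQ1 HQ2]]; [apply sqrt_pos|].
    set (Q := (Q' + 1)%nat).
    assert (HQ' : INR Q = INR Q' + 1) by (unfold Q; rewrite plus_INR; reflexivity).
    assert (Hsq : sqrt (512 * INR M) ^ 2 = 512 * INR M) by (apply pow2_sqrt; lra).
    set (y := sqrt (512 * INR M)) in *.
    assert (Hy : 10 ^ 12 <= y).
    { rewrite <- (sqrt_pow2 (10 ^ 12)) by lra. apply sqrt_le_1_alt. lra. }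
    assert (HQa : 512 * INR M <= INR Q ^ 2) by (rewrite <- Hsq; apply pow_incr; lra).
    assert (HQb : INR Q ^ 2 <= 1024 * INR M).
    { replace (1024 * INR M) with (2 * y ^ 2) by lra. rewrite HQ'. nra. }
    assert (HQc : 200000 ^ 2 <= INR Q) by lra.
    pose proof (quartic_lower N m0 M Q ltac:(lia) Hm0 HM1 HQa HQb HQc) as Hq.
    assert (HM1n : (1 <= M)%nat) by (destruct M; [simpl in HM8; lra|lia]).
    exists (root_sequence N m0), (node_coeff m0 M).
    split; [apply root_sequence_convex; auto; lia|].
    pose proof (node_energy_pos N m0 M ltac:(lia) Hm0 HM1 HM1n) as He0.
    pose proof (node_energy_le N m0 M ltac:(lia) Hm0 HM1) as He1.
    rewrite l2norm_rsum. set (E := rsum (seq 1 N) (fun n => Cmod (node_coeff m0 M n) ^ 2)) in *.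
    split; [now apply sqrt_lt_R0|]. apply Rle_ge. unfold L4norm. apply le_sqrt_sqrt.
    { apply Rmult_le_pos; [|apply sqrt_pos]. apply Rmult_le_pos; [lra|apply pow_le; lra]. }
    eapply Rle_trans; [|exact Hq].
    replace ((/ 10 ^ 6 * p ^ 5 * sqrt E) ^ 4) with (/ 10 ^ 24 * p ^ 20 * (sqrt E ^ 2) ^ 2) by (field; lra).
    rewrite pow2_sqrt by lra.
    replace ((sqrt (INR Q) ^ 3 / 100000) ^ 4) with ((sqrt (INR Q) ^ 2) ^ 6 / 10 ^ 20) by field.
    rewrite pow2_sqrt by (apply pos_INR). rewrite <- Hp8.
    assert (HE2 : E ^ 2 <= INR M ^ 2) by (apply pow_incr; lra).
    assert (HQ6 : (512 * INR M) ^ 3 <= INR Q ^ 6).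
    { replace (INR Q ^ 6) with ((INR Q ^ 2) ^ 3) by ring. apply pow_incr; lra. }
    assert (Hp20 : 0 <= p ^ 20) by (apply pow_le; lra). assert (Hp16 : 0 <= p ^ 16) by (apply pow_le; lra).
    assert (HM0 : 0 <= INR M ^ 2) by apply pow2_ge_0.
    (* The lower bound grows like M^3 p^16 and the target like M^2 p^20, so one factor M is traded
       for p^4/8. *)
    apply Rle_trans with (/ 10 ^ 24 * p ^ 20 * INR M ^ 2).
    { apply Rmult_le_compat_l; auto. apply Rmult_le_pos; auto. lra. }
    apply Rle_trans with ((512 * INR M) ^ 3 / 10 ^ 20 * (p ^ 16 / 2)).
    { replace ((512 * INR M) ^ 3 / 10 ^ 20 * (p ^ 16 / 2)) with (512 ^ 3 / 10 ^ 20 / 2 * (p ^ 16 * INR M ^ 2 * INR M)) by field.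
      replace (/ 10 ^ 24 * p ^ 20 * INR M ^ 2) with (/ 10 ^ 24 * (p ^ 16 * INR M ^ 2 * p ^ 4)) by ring.
      assert (Hx : 0 <= p ^ 16 * INR M ^ 2) by now apply Rmult_le_pos.
      assert (p ^ 16 * INR M ^ 2 * p ^ 4 <= p ^ 16 * INR M ^ 2 * (8 * INR M)) by (apply Rmult_le_compat_l; auto; lra).
      assert (0 <= p ^ 16 * INR M ^ 2 * INR M) by (apply Rmult_le_pos; auto; apply pos_INR). lra. }
    replace ((p ^ 8) ^ 2) with (p ^ 16) by ring. apply Rmult_le_compat_r; [lra|].
    unfold Rdiv. apply Rmult_le_compat_r; [lra|exact HQ6].
Qed.

Theorem theorem2 :
  (exists C0 : R, 0 < C0 /\
     forall N : nat, (10 <= N)%nat ->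
       exists (a : nat -> R) (b : nat -> C),
         uniformly_convex N a /\ 0 < l2norm N b /\
         L4norm N a b >= C0 * Rpower (INR N) (5 / 8) * l2norm N b)
  /\
  (forall eps : R, 0 < eps ->
     exists Ceps : R, 0 < Ceps /\
       forall N : nat, (1 <= N)%nat ->
         forall (a : nat -> R) (b : nat -> C),
           uniformly_convex N a ->
           L4norm N a b <= Ceps * Rpower (INR N) eps * Rpower (INR N) (2 / 3) * l2norm N b).
Proof. split; [exact maximal_lower_bound | exact maximal_upper_bound]. Qed.
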